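(* There is a biequivalence between the bicategory $\mathsf{DFLCompCat}$ of DFL comprehension categories and the bicategory $\mathsf{FinLim}$ of univalent categories with finite limits.
   Context: **Foundations.** We work in univalent foundations. Categories have a type of objects and sets of morphisms; composition is written in diagrammatic order ($f\cdot g : x\to z$ for $f:x\to y$, $g:y\to z$). A category $C$ is univalent if for all $x,y:C$ the canonical map from $x=y$ to the type of isomorphisms $x\cong y$ is an equivalence of types. Bicategories have a type of objects, types of 1-cells and sets of 2-cells. **Displayed categories.** A displayed category $D$ over $C$ consists of a type $D(x)$ of objects over each $x:C$, a set $\bar x\to_f\bar y$ of morphisms over each $f:x\to y$ for $\bar x:D(x),\bar y:D(y)$, with identities over identities and compositions over compositions satisfying unit and associativity laws (as dependent equalities). $D[x]$ denotes the fiber category: objects $D(x)$, morphisms those over $\mathrm{id}_x$. A displayed functor $\bar F:D\to D'$ over $F:C\to C'$ sends objects over $x$ to objects over $F(x)$ and morphisms over $f$ to morphisms over $F(f)$, functorially; it induces $\bar F[x]:D[x]\to D'[F(x)]$. A displayed natural transformation $\bar\tau:\bar F\Rightarrow\bar G$ over $\tau:F\Rightarrow G$ is a natural family of morphisms $\bar F(\bar x)\to_{\tau(x)}\bar G(\bar x)$. $D$ is univalent if for $p:x=y$, $\bar x:D(x)$, $\bar y:D(y)$, identities $\bar x=\bar y$ over $p$ are equivalent (via the canonical map) to displayed isomorphisms over the isomorphism induced by $p$. A morphism $\bar f:\bar x\to_f\bar y$ is Cartesian if every $\bar h:\bar w\to_{g\cdot f}\bar y$ factors uniquely as $\bar g\cdot\bar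 f$ with $\bar g:\bar w\to_g\bar x$. A cleaving chooses for each $f:x\to y$ and $\bar y:D(y)$ a Cartesian morphism $\bar f : f^*(\bar y)\to_f\bar y$; this gives functors $f^*:D[y]\to D[x]$. A displayed functor is Cartesian if it preserves Cartesian morphisms. $C^{\downarrow}$ is the displayed category over $C$ whose objects over $y$ are morphisms $x\to y$ and whose morphisms over $f$ are commuting squares with bottom side $f$; its fibers are the slices $C/y$. A functor $F:C_1\to C_2$ induces $F^{\downarrow}:C_1^{\downarrow}\to C_2^{\downarrow}$ over $F$. **Comprehension categories.** A comprehension category $\chi:D\to C^{\downarrow}$ consists of a category $C$ with terminal object $\langle\rangle$, a displayed category $D$ over $C$ with a cleaving, and a Cartesian displayed functor $\chi:D\to C^{\downarrow}$ over $\mathrm{id}_C$. It is full if $\chi$ is fully faithful, univalent if $C$ and $D$ are univalent. For $A:D(\Gamma)$ write $\chi(A)=\pi_A:\Gamma.A\to\Gamma$. **DFL comprehension categories.** A DFL comprehension category is a full univalent comprehension category such that: - each $D[\Gamma]$ has a terminal object $1_\Gamma$, binary products and equalizers, and each $s^*:D[\Delta]\to D[\Gamma]$ (for $s:\Gamma\to\Delta$) preserves them; and $\pi_{1_\Gamma}$ is an isomorphism for every $\Gamma$; - (strong $\Sigma$-types) for each $A:D(\Gamma)$ the functor $\pi_A^*:D[\Gamma]\to D[\Gamma.A]$ has a left adjoint $\Sigma_A$ with unit $\eta$, the Beck–Chevalley condition for left adjoints holds for every pullback square (the canonical comparison between $\Sigma$ and substitution is an isomorphism), and for all $A:D(\Gamma)$,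 $B:D(\Gamma.A)$ the composite $\Gamma.A.B\to\Gamma.A.\pi_A^*(\Sigma_AB)\to\Gamma.\Sigma_AB$ of $\chi(\eta(B))$ with $\chi$ of the Cartesian lift of $\pi_A$ is an isomorphism; - (democracy) for each $\Gamma:C$ there are a type $\widehat\Gamma:D(\langle\rangle)$ and an isomorphism $\gamma_\Gamma:\Gamma\cong\langle\rangle.\widehat\Gamma$. **The bicategory $\mathsf{DFLCompCat}$.** Objects are DFL comprehension categories. A 1-cell from $\chi_1:D_1\to C_1^{\downarrow}$ to $\chi_2:D_2\to C_2^{\downarrow}$ is a triple $(F,\bar F,F_\chi)$: a functor $F:C_1\to C_2$ preserving terminal objects, a Cartesian displayed functor $\bar F:D_1\to D_2$ over $F$ such that each $\bar F[\Gamma]$ preserves terminal objects, binary products and equalizers, and a displayed natural isomorphism $F_\chi$ over the identity from $\chi_1\cdot F^{\downarrow}$ to $\bar F\cdot\chi_2$ (so $F_\chi(A):F(\Gamma.A)\cong F(\Gamma).\bar F(A)$ over $F(\Gamma)$). A 2-cell $(F,\bar F,F_\chi)\Rightarrow(G,\bar G,G_\chi)$ is a natural transformation $\tau:F\Rightarrow G$ and a displayed natural transformation $\bar\tau:\bar F\Rightarrow\bar G$ over $\tau$ with $F_\chi(A)\cdot\chi_2(\bar\tau(A))=\tau(\Gamma.A)\cdot G_\chi(A)$ for all $A:D_1(\Gamma)$. **The bicategory $\mathsf{FinLim}$.** Objects: univalent categories with finite limits (terminal object and pullbacks); 1-cells: functors preserving finite limits; 2-cells: natural transformations. **Biequivalence.**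 A biequivalence between $B_1$ and $B_2$ consists of pseudofunctors $F:B_1\to B_2$, $G:B_2\to B_1$ and pseudotransformations $\eta:\mathrm{id}_{B_2}\Rightarrow G\cdot F$ and $\varepsilon:F\cdot G\Rightarrow\mathrm{id}_{B_1}$ (composites in diagrammatic order) that are adjoint equivalences in the respective bicategories of pseudofunctors. *)

(* Defs.v *)
From Stdlib Require Import FunctionalExtensionality.

(* The identity type of univalent foundations is [eq], used without uniqueness
   of identity proofs: h-levels and equivalences of types are spelled out, and
   universal properties are stated in [Type] as contractibility conditions. *)

Definition isaset (A : Type) : Prop := forall (x y : A) (p q : x = y), p = q.

Definition iscontr (A : Type) : Type := { a : A | forall b : A, b = a }.

Definition isweq {A B : Type} (f : A -> B) : Type :=
  forall b : B, iscontr { a : A | f a = b }.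

(* For a predicate on a set, this is contractibility of the type of solutions. *)
Definition unique_sol {A : Type} (P : A -> Prop) : Type := { a : A | unique P a }.

Definition pathover {A : Type} {P : A -> Type} {a b : A} (p : a = b)
  (u : P a) (v : P b) : Prop := eq_rect a P u b p = v.

Lemma isaset_const_endo {A : Type} (c : forall x y : A, x = y -> x = y) :
  (forall x y (p q : x = y), c x y p = c x y q) -> isaset A.
Proof.
  intros H x y.
  assert (K : forall p : x = y, p = eq_trans (eq_sym (c x x eq_refl)) (c x y p)).
  { intros []. destruct (c x x eq_refl). reflexivity. }
  intros p q. rewrite (K p), (K q), (H _ _ p q). reflexivity.
Qed.

Lemma isaset_inj {A B : Type} (g : A -> B) :
  isaset B -> (forall a a', g a = g a' -> a = a') -> isaset A.
Proof.
  intros HB Hg.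
  apply (isaset_const_endo (fun x y p => Hg x y (f_equal g p))).
  intros x y p q. f_equal. apply HB.
Qed.

Lemma isaset_forall {A : Type} (B : A -> Type) :
  (forall a, isaset (B a)) -> isaset (forall a, B a).
Proof.
  intros H.
  apply (isaset_const_endo
    (fun f g p => functional_extensionality_dep f g (fun a => f_equal (fun h => h a) p))).
  intros f g p q. f_equal. apply functional_extensionality_dep. intros a. apply H.
Qed.

Lemma sigT_eq {A : Type} {B : A -> Type} (u v : { a : A & B a })
  (p : projT1 u = projT1 v) : eq_rect _ B (projT2 u) _ p = projT2 v -> u = v.
Proof.
  destruct u as [a b], v as [a' b']; cbn in *. destruct p. intros []. reflexivity.
Qed.

Lemma isaset_sigT {A : Type} (B : A -> Type) :
  isaset A -> (forall a, isaset (B a)) -> isaset { a : A & B a }.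
Proof.
  intros HA HB.
  apply (isaset_const_endo (fun u v p => sigT_eq u v (projT1_eq p) (projT2_eq p))).
  intros u v p q.
  generalize (projT2_eq p), (projT2_eq q).
  rewrite (HA _ _ (projT1_eq p) (projT1_eq q)). intros r s.
  f_equal. apply HB.
Qed.

Lemma isaset_prod (A B : Type) : isaset A -> isaset B -> isaset (A * B).
Proof.
  intros HA HB.
  apply (isaset_const_endo
    (fun u v p => injective_projections u v (f_equal fst p) (f_equal snd p))).
  intros u v p q. f_equal; [apply HA | apply HB].
Qed.

Lemma sig_eq {A : Type} {P : A -> Prop} (HP : forall a (p q : P a), p = q)
  (u v : { a : A | P a }) : proj1_sig u = proj1_sig v -> u = v.
Proof.
  destruct u as [u pu], v as [v pv]; cbn. intros <-. f_equal. apply HP.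
Qed.

Lemma isaset_sig {A : Type} {P : A -> Prop} (HP : forall a (p q : P a), p = q) :
  isaset A -> isaset { a : A | P a }.
Proof. intros HA. apply (isaset_inj (@proj1_sig A P) HA). intros a b. apply sig_eq, HP. Qed.

Declare Scope cat_scope.
Open Scope cat_scope.

Reserved Notation "f ;; g" (at level 40, left associativity).
Reserved Notation "f ;;; g" (at level 40, left associativity).

Record category : Type := {
  ob :> Type;
  hom : ob -> ob -> Type;
  idm : forall x, hom x x;
  comp : forall {x y z}, hom x y -> hom y z -> hom x z
    where "f ;; g" := (comp f g);
  id_left : forall {x y} (f : hom x y), idm x ;; f = f;
  id_right : forall {x y} (f : hom x y), f ;; idm y = f;
  assoc : forall {w x y z} (f : hom w x) (g : hom x y) (h : hom y z),
    f ;; (g ;; h) = (f ;; g) ;; h;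
  hom_set : forall x y, isaset (hom x y)
}.

Arguments hom {_} _ _.
Arguments idm {_} _.
Arguments comp {_ _ _ _} _ _.
Arguments id_left {_ _ _} _.
Arguments id_right {_ _ _} _.
Arguments assoc {_ _ _ _ _} _ _ _.
Arguments hom_set _ {_ _} _ _ _ _.
Notation "f ;; g" := (comp f g) : cat_scope.

Record is_iso {C : category} {x y : C} (f : hom x y) : Type := {
  inv : hom y x;
  inv_r : f ;; inv = idm x;
  inv_l : inv ;; f = idm y
}.
Arguments inv {_ _ _ _} _.
Arguments inv_r {_ _ _ _} _.
Arguments inv_l {_ _ _ _} _.

Record iso {C : category} (x y : C) : Type := {
  iso_mor :> hom x y;
  iso_is_iso : is_iso iso_mor
}.
Arguments iso_mor {_ _ _} _.
Arguments iso_is_iso {_ _ _} _.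
Arguments Build_iso {_ _ _} _ _.

Definition iso_inv {C : category} {x y : C} (i : iso x y) : hom y x := inv (iso_is_iso i).

Definition id_is_iso {C : category} (x : C) : is_iso (idm x) :=
  {| inv := idm x; inv_r := id_left (idm x); inv_l := id_left (idm x) |}.

Definition id_iso {C : category} (x : C) : iso x x := Build_iso (idm x) (id_is_iso x).

Definition idtoiso {C : category} {x y : C} (p : x = y) : iso x y :=
  match p with eq_refl => id_iso x end.

Definition is_univalent (C : category) : Type :=
  forall x y : C, isweq (@idtoiso C x y).

Definition comp_is_iso {C : category} {x y z : C} {f : hom x y} {g : hom y z}
  (Hf : is_iso f) (Hg : is_iso g) : is_iso (f ;; g).
Proof.
  exists (inv Hg ;; inv Hf).
  - rewrite assoc, <- (assoc f), inv_r, id_right. apply inv_r.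
  - rewrite assoc, <- (assoc _ (inv Hf)), inv_l, id_right. apply inv_l.
Defined.

Record functor (C D : category) : Type := {
  fob :> C -> D;
  fmap : forall {x y}, hom x y -> hom (fob x) (fob y);
  fmap_id : forall x, fmap (idm x) = idm (fob x);
  fmap_comp : forall {x y z} (f : hom x y) (g : hom y z),
    fmap (f ;; g) = fmap f ;; fmap g
}.
Arguments fmap {_ _} _ {_ _} _.
Arguments fmap_id {_ _} _ _.
Arguments fmap_comp {_ _} _ {_ _ _} _ _.

Definition functor_id (C : category) : functor C C :=
  {| fob := fun x => x; fmap := fun x y f => f;
     fmap_id := fun x => eq_refl; fmap_comp := fun x y z f g => eq_refl |}.

Definition functor_comp {C D E : category} (F : functor C D) (G : functor D E) : functor C E.
Proof.
  refine {| fob := fun x => G (F x); fmap := fun x y f => fmap G (fmap F f) |}.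
  - intros x. rewrite fmap_id. apply fmap_id.
  - intros x y z f g. rewrite fmap_comp. apply fmap_comp.
Defined.

Definition fmap_is_iso {C D : category} (F : functor C D) {x y : C} {f : hom x y}
  (Hf : is_iso f) : is_iso (fmap F f).
Proof.
  exists (fmap F (inv Hf)); rewrite <- fmap_comp.
  - rewrite inv_r. apply fmap_id.
  - rewrite inv_l. apply fmap_id.
Defined.

Record nat_trans {C D : category} (F G : functor C D) : Type := {
  nt_ob :> forall x : C, hom (F x) (G x);
  nt_nat : forall {x y} (f : hom x y), fmap F f ;; nt_ob y = nt_ob x ;; fmap G f
}.
Arguments nt_ob {_ _ _ _} _ _.
Arguments nt_nat {_ _ _ _} _ {_ _} _.

Lemma nat_trans_eq {C D : category} {F G : functor C D} (s t : nat_trans F G) :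
  (forall x, s x = t x) -> s = t.
Proof.
  destruct s as [s Hs], t as [t Ht]; cbn. intros H.
  apply functional_extensionality_dep in H. destruct H. f_equal.
  repeat (apply functional_extensionality_dep; intro). apply hom_set.
Qed.

Lemma isaset_nat_trans {C D : category} (F G : functor C D) : isaset (nat_trans F G).
Proof.
  apply (isaset_inj (fun s : nat_trans F G => nt_ob s)).
  - apply isaset_forall. intros x. apply hom_set.
  - intros s t H. apply nat_trans_eq. intros x. rewrite H. reflexivity.
Qed.

Definition nat_id {C D : category} (F : functor C D) : nat_trans F F.
Proof.
  refine {| nt_ob := fun x => idm (F x) |}.
  intros x y f. rewrite id_left. apply id_right.
Defined.

Definition nat_comp {C D : category} {F G H : functor C D}
  (s : nat_trans F G) (t : nat_trans G H) : nat_trans F H.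
Proof.
  refine {| nt_ob := fun x => s x ;; t x |}.
  intros x y f. rewrite assoc, nt_nat, <- assoc, nt_nat. apply assoc.
Defined.

Definition nat_lwhisker {C D E : category} (F : functor C D) {G H : functor D E}
  (t : nat_trans G H) : nat_trans (functor_comp F G) (functor_comp F H).
Proof.
  refine {| nt_ob := fun x => t (F x) : hom (functor_comp F G x) (functor_comp F H x) |}.
  intros x y f. apply (nt_nat t).
Defined.

Definition nat_rwhisker {C D E : category} {F G : functor C D}
  (s : nat_trans F G) (H : functor D E) : nat_trans (functor_comp F H) (functor_comp G H).
Proof.
  refine {| nt_ob := fun x => fmap H (s x) : hom (functor_comp F H x) (functor_comp G H x) |}.
  intros x y f. cbn. rewrite <- !fmap_comp, nt_nat. reflexivity.
Defined.

Ltac nat_unit := intros; cbn; rewrite id_left; apply id_right.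

Definition nat_lunitor {C D : category} (F : functor C D) :
  nat_trans (functor_comp (functor_id C) F) F.
Proof. refine {| nt_ob := fun x => idm (F x) : hom (functor_comp (functor_id C) F x) (F x) |}. nat_unit. Defined.
Definition nat_linvunitor {C D : category} (F : functor C D) :
  nat_trans F (functor_comp (functor_id C) F).
Proof. refine {| nt_ob := fun x => idm (F x) : hom (F x) (functor_comp (functor_id C) F x) |}. nat_unit. Defined.
Definition nat_runitor {C D : category} (F : functor C D) :
  nat_trans (functor_comp F (functor_id D)) F.
Proof. refine {| nt_ob := fun x => idm (F x) : hom (functor_comp F (functor_id D) x) (F x) |}. nat_unit. Defined.
Definition nat_rinvunitor {C D : category} (F : functor C D) :
  nat_trans F (functor_comp F (functor_id D)).
Proof. refine {| nt_ob := fun x => idm (F x) : hom (F x) (functor_comp F (functor_id D) x) |}. nat_unit. Defined.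
Definition nat_lassociator {C1 C2 C3 C4 : category}
  (F : functor C1 C2) (G : functor C2 C3) (H : functor C3 C4) :
  nat_trans (functor_comp F (functor_comp G H)) (functor_comp (functor_comp F G) H).
Proof.
  refine {| nt_ob := fun x => idm (H (G (F x))) :
    hom (functor_comp F (functor_comp G H) x) (functor_comp (functor_comp F G) H x) |}.
  nat_unit.
Defined.
Definition nat_rassociator {C1 C2 C3 C4 : category}
  (F : functor C1 C2) (G : functor C2 C3) (H : functor C3 C4) :
  nat_trans (functor_comp (functor_comp F G) H) (functor_comp F (functor_comp G H)).
Proof.
  refine {| nt_ob := fun x => idm (H (G (F x))) :
    hom (functor_comp (functor_comp F G) H x) (functor_comp F (functor_comp G H) x) |}.
  nat_unit.
Defined.

Definition is_terminal {C : category} (t : C) : Type := forall x : C, iscontr (hom x t).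

Record terminal (C : category) : Type := {
  term_ob :> C;
  term_is : is_terminal term_ob
}.
Arguments term_ob {_} _.
Arguments term_is {_} _ _.

Definition is_bin_product {C : category} {a b p : C} (p1 : hom p a) (p2 : hom p b) : Type :=
  forall (x : C) (f : hom x a) (g : hom x b),
    unique_sol (fun h : hom x p => h ;; p1 = f /\ h ;; p2 = g).

Record bin_product {C : category} (a b : C) : Type := {
  bp_ob : C;
  bp_pr1 : hom bp_ob a;
  bp_pr2 : hom bp_ob b;
  bp_is : is_bin_product bp_pr1 bp_pr2
}.

Definition is_equalizer {C : category} {a b e : C} (f g : hom a b) (i : hom e a) : Type :=
  (i ;; f = i ;; g) *
  (forall (x : C) (h : hom x a), h ;; f = h ;; g ->
     unique_sol (fun k : hom x e => k ;; i = h)).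

Record equalizer {C : category} {a b : C} (f g : hom a b) : Type := {
  eq_ob : C;
  eq_arr : hom eq_ob a;
  eq_is : is_equalizer f g eq_arr
}.

Definition is_pullback {C : category} {a b c p : C} (f : hom a c) (g : hom b c)
  (p1 : hom p a) (p2 : hom p b) : Type :=
  (p1 ;; f = p2 ;; g) *
  (forall (x : C) (h : hom x a) (k : hom x b), h ;; f = k ;; g ->
     unique_sol (fun u : hom x p => u ;; p1 = h /\ u ;; p2 = k)).

Record pullback {C : category} {a b c : C} (f : hom a c) (g : hom b c) : Type := {
  pb_ob : C;
  pb_pr1 : hom pb_ob a;
  pb_pr2 : hom pb_ob b;
  pb_is : is_pullback f g pb_pr1 pb_pr2
}.

Definition preserves_terminal {C D : category} (F : functor C D) : Type :=
  forall t : C, is_terminal t -> is_terminal (F t).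

Definition preserves_bin_products {C D : category} (F : functor C D) : Type :=
  forall (a b p : C) (p1 : hom p a) (p2 : hom p b),
    is_bin_product p1 p2 -> is_bin_product (fmap F p1) (fmap F p2).

Definition preserves_equalizers {C D : category} (F : functor C D) : Type :=
  forall (a b e : C) (f g : hom a b) (i : hom e a),
    is_equalizer f g i -> is_equalizer (fmap F f) (fmap F g) (fmap F i).

Definition preserves_pullbacks {C D : category} (F : functor C D) : Type :=
  forall (a b c p : C) (f : hom a c) (g : hom b c) (p1 : hom p a) (p2 : hom p b),
    is_pullback f g p1 p2 -> is_pullback (fmap F f) (fmap F g) (fmap F p1) (fmap F p2).

Record left_adjoint {C D : category} (R : functor D C) : Type := {
  ladj :> functor C D;
  ladj_unit : nat_trans (functor_id C) (functor_comp ladj R);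
  ladj_counit : nat_trans (functor_comp R ladj) (functor_id D);
  ladj_triangle1 : forall x : C,
    fmap ladj (ladj_unit x) ;; ladj_counit (ladj x) = idm (ladj x);
  ladj_triangle2 : forall y : D,
    ladj_unit (R y) ;; fmap R (ladj_counit y) = idm (R y)
}.
Arguments ladj {_ _ _} _.
Arguments ladj_unit {_ _ _} _.
Arguments ladj_counit {_ _ _} _.

Record disp_cat (C : category) : Type := {
  dob :> C -> Type;
  dhom : forall {x y : C}, dob x -> dob y -> hom x y -> Type;
  did : forall {x : C} (xx : dob x), dhom xx xx (idm x);
  dcomp : forall {x y z : C} {xx : dob x} {yy : dob y} {zz : dob z}
    {f : hom x y} {g : hom y z}, dhom xx yy f -> dhom yy zz g -> dhom xx zz (f ;; g)
    where "ff ;;; gg" := (dcomp ff gg);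
  did_left : forall {x y} {xx : dob x} {yy : dob y} {f : hom x y} (ff : dhom xx yy f),
    pathover (id_left f) (did xx ;;; ff) ff;
  did_right : forall {x y} {xx : dob x} {yy : dob y} {f : hom x y} (ff : dhom xx yy f),
    pathover (id_right f) (ff ;;; did yy) ff;
  dassoc : forall {w x y z} {ww : dob w} {xx : dob x} {yy : dob y} {zz : dob z}
    {f : hom w x} {g : hom x y} {h : hom y z}
    (ff : dhom ww xx f) (gg : dhom xx yy g) (hh : dhom yy zz h),
    pathover (assoc f g h) (ff ;;; (gg ;;; hh)) ((ff ;;; gg) ;;; hh);
  dhom_set : forall {x y} (xx : dob x) (yy : dob y) (f : hom x y), isaset (dhom xx yy f)
}.
Arguments dob {_} _ _.
Arguments dhom {_} _ {_ _} _ _ _.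
Arguments did {_ _ _} _.
Arguments dcomp {_ _ _ _ _ _ _ _ _ _} _ _.
Arguments did_left {_ _ _ _ _ _ _} _.
Arguments did_right {_ _ _ _ _ _ _} _.
Arguments dassoc {_ _ _ _ _ _ _ _ _ _ _ _ _} _ _ _.
Arguments dhom_set {_} _ {_ _} _ _ _ _ _ _ _.
Notation "ff ;;; gg" := (dcomp ff gg) : cat_scope.

(* Dependent equations over equations in a set of morphisms are the same as
    equations between morphisms of the total category. *)

Section Total.
  Context {C : category} (D : disp_cat C).

  Definition thom {x y : C} (xx : D x) (yy : D y) : Type := { f : hom x y & dhom D xx yy f }.

  Definition tot {x y : C} {xx : D x} {yy : D y} {f : hom x y} (ff : dhom D xx yy f) :
    thom xx yy := existT _ f ff.

  Lemma tot_of_pathover {x y : C} {xx : D x} {yy : D y} {f g : hom x y} {p : f = g}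
    {ff : dhom D xx yy f} {gg : dhom D xx yy g} : pathover p ff gg -> tot ff = tot gg.
  Proof. destruct p. intros []. reflexivity. Qed.

  Lemma pathover_of_tot {x y : C} {xx : D x} {yy : D y} {f g : hom x y} (p : f = g)
    {ff : dhom D xx yy f} {gg : dhom D xx yy g} : tot ff = tot gg -> pathover p ff gg.
  Proof.
    intros e. unfold pathover. rewrite (hom_set C _ _ p (projT1_eq e)). exact (projT2_eq e).
  Qed.

  Lemma tot_inj {x y : C} {xx : D x} {yy : D y} {f : hom x y}
    {ff gg : dhom D xx yy f} : tot ff = tot gg -> ff = gg.
  Proof. intros e. exact (pathover_of_tot eq_refl e). Qed.

  Lemma tot_transport {x y : C} {xx : D x} {yy : D y} {f g : hom x y} (p : f = g)
    (ff : dhom D xx yy f) : tot (eq_rect f (dhom D xx yy) ff g p) = tot ff.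
  Proof. destruct p. reflexivity. Qed.

  Lemma isaset_thom {x y : C} (xx : D x) (yy : D y) : isaset (thom xx yy).
  Proof. apply isaset_sigT; [apply hom_set | intros f; apply dhom_set]. Qed.

  Definition total_cat : category.
  Proof.
    refine {| ob := { x : C & D x };
      hom := fun a b => thom (projT2 a) (projT2 b);
      idm := fun a => tot (did (projT2 a));
      comp := fun a b c f g => tot (projT2 f ;;; projT2 g) |}.
    - intros a b [f ff]. apply (tot_of_pathover (did_left ff)).
    - intros a b [f ff]. apply (tot_of_pathover (did_right ff)).
    - intros a b c d [f ff] [g gg] [h hh]. apply (tot_of_pathover (dassoc ff gg hh)).
    - intros a b. apply isaset_thom.
  Defined.

  Definition tc {x y z : C} {xx : D x} {yy : D y} {zz : D z}
    (f : thom xx yy) (g : thom yy zz) : thom xx zz := tot (projT2 f ;;; projT2 g).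
  Definition ti {x : C} (xx : D x) : thom xx xx := tot (did xx).

  Lemma tot_comp {x y z : C} {xx : D x} {yy : D y} {zz : D z} {f : hom x y} {g : hom y z}
    (ff : dhom D xx yy f) (gg : dhom D yy zz g) : tot (ff ;;; gg) = tc (tot ff) (tot gg).
  Proof. reflexivity. Qed.
  Lemma tot_id {x : C} (xx : D x) : tot (did xx) = ti xx.
  Proof. reflexivity. Qed.

  Lemma tc_id_left {x y : C} {xx : D x} {yy : D y} (f : thom xx yy) : tc (ti xx) f = f.
  Proof. exact (@id_left total_cat (existT _ x xx) (existT _ y yy) f). Qed.
  Lemma tc_id_right {x y : C} {xx : D x} {yy : D y} (f : thom xx yy) : tc f (ti yy) = f.
  Proof. exact (@id_right total_cat (existT _ x xx) (existT _ y yy) f). Qed.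
  Lemma tc_assoc {w x y z : C} {ww : D w} {xx : D x} {yy : D y} {zz : D z}
    (f : thom ww xx) (g : thom xx yy) (h : thom yy zz) : tc f (tc g h) = tc (tc f g) h.
  Proof.
    exact (@assoc total_cat (existT _ w ww) (existT _ x xx) (existT _ y yy)
      (existT _ z zz) f g h).
  Qed.
End Total.
Arguments tot {_ _ _ _ _ _ _} _.
Arguments thom {_ _ _ _} _ _.
Arguments tc {_ _ _ _ _ _ _ _} _ _.
Arguments ti {_ _ _} _.
Arguments tot_of_pathover {_ _ _ _ _ _ _ _ _ _ _} _.
Arguments pathover_of_tot {_ _ _ _ _ _ _ _} _ {_ _} _.
Arguments tot_inj {_ _ _ _ _ _ _ _ _} _.

Record is_disp_iso {C : category} {D : disp_cat C} {x y : C} (i : iso x y)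
  {xx : D x} {yy : D y} (ff : dhom D xx yy i) : Type := {
  dinv : dhom D yy xx (iso_inv i);
  dinv_r : pathover (inv_r (iso_is_iso i)) (ff ;;; dinv) (did xx);
  dinv_l : pathover (inv_l (iso_is_iso i)) (dinv ;;; ff) (did yy)
}.
Arguments dinv {_ _ _ _ _ _ _ _} _.
Arguments dinv_r {_ _ _ _ _ _ _ _} _.
Arguments dinv_l {_ _ _ _ _ _ _ _} _.

Record disp_iso {C : category} {D : disp_cat C} {x y : C} (i : iso x y)
  (xx : D x) (yy : D y) : Type := {
  disp_iso_mor :> dhom D xx yy i;
  disp_iso_is_iso : is_disp_iso i disp_iso_mor
}.

Definition id_disp_iso {C : category} {D : disp_cat C} {x : C} (xx : D x) :
  disp_iso (id_iso x) xx xx :=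
  {| disp_iso_mor := did xx : dhom D xx xx (id_iso x);
     disp_iso_is_iso :=
       Build_is_disp_iso _ D x x (id_iso x) xx xx (did xx)
         (did xx) (did_left (did xx)) (did_left (did xx)) |}.

Definition idtoiso_disp {C : category} {D : disp_cat C} {x y : C} (p : x = y)
  (xx : D x) (yy : D y) : pathover p xx yy -> disp_iso (idtoiso p) xx yy :=
  match p as q in _ = z
    return forall zz : D z, pathover q xx zz -> disp_iso (idtoiso q) xx zz
  with eq_refl => fun zz pp =>
    match pp in _ = zz' return disp_iso (id_iso x) xx zz' with
    | eq_refl => id_disp_iso xx
    end
  end yy.

Definition is_univalent_disp {C : category} (D : disp_cat C) : Type :=
  forall (x y : C) (p : x = y) (xx : D x) (yy : D y), isweq (idtoiso_disp p xx yy).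

Record disp_functor {C C' : category} (F : functor C C') (D : disp_cat C) (D' : disp_cat C') :
  Type := {
  dfob :> forall x : C, D x -> D' (F x);
  dfmap : forall {x y : C} {xx : D x} {yy : D y} {f : hom x y},
    dhom D xx yy f -> dhom D' (dfob x xx) (dfob y yy) (fmap F f);
  dfmap_id : forall {x : C} (xx : D x),
    pathover (fmap_id F x) (dfmap (did xx)) (did (dfob x xx));
  dfmap_comp : forall {x y z : C} {xx : D x} {yy : D y} {zz : D z}
    {f : hom x y} {g : hom y z} (ff : dhom D xx yy f) (gg : dhom D yy zz g),
    pathover (fmap_comp F f g) (dfmap (ff ;;; gg)) (dfmap ff ;;; dfmap gg)
}.
Arguments dfob {_ _ _ _ _} _ {_} _.
Arguments dfmap {_ _ _ _ _} _ {_ _ _ _ _} _.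
Arguments dfmap_id {_ _ _ _ _} _ {_} _.
Arguments dfmap_comp {_ _ _ _ _} _ {_ _ _ _ _ _ _ _} _ _.

Definition tmap {C C' : category} {F : functor C C'} {D : disp_cat C} {D' : disp_cat C'}
  (FF : disp_functor F D D') {x y : C} {xx : D x} {yy : D y} (f : thom xx yy) :
  thom (dfob FF xx) (dfob FF yy) := tot (dfmap FF (projT2 f)).

Section TotalFunctor.
  Context {C C' : category} {F : functor C C'} {D : disp_cat C} {D' : disp_cat C'}
    (FF : disp_functor F D D').

  Lemma tot_map {x y : C} {xx : D x} {yy : D y} {f : hom x y} (ff : dhom D xx yy f) :
    tot (dfmap FF ff) = tmap FF (tot ff).
  Proof. reflexivity. Qed.
  Lemma tmap_id {x : C} (xx : D x) : tmap FF (ti xx) = ti (dfob FF xx).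
  Proof. apply (tot_of_pathover (dfmap_id FF xx)). Qed.
  Lemma tmap_comp {x y z : C} {xx : D x} {yy : D y} {zz : D z}
    (f : thom xx yy) (g : thom yy zz) : tmap FF (tc f g) = tc (tmap FF f) (tmap FF g).
  Proof. apply (tot_of_pathover (dfmap_comp FF (projT2 f) (projT2 g))). Qed.
End TotalFunctor.

Definition disp_functor_id {C : category} (D : disp_cat C) : disp_functor (functor_id C) D D.
Proof.
  refine (Build_disp_functor C C (functor_id C) D D
    (fun x xx => xx) (fun x y xx yy f ff => ff) _ _); reflexivity.
Defined.

Definition disp_functor_comp {C1 C2 C3 : category} {F : functor C1 C2} {G : functor C2 C3}
  {D1 : disp_cat C1} {D2 : disp_cat C2} {D3 : disp_cat C3}
  (FF : disp_functor F D1 D2) (GG : disp_functor G D2 D3) :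
  disp_functor (functor_comp F G) D1 D3.
Proof.
  refine (Build_disp_functor C1 C3 (functor_comp F G) D1 D3
    (fun x xx => dfob GG (dfob FF xx))
    (fun x y xx yy f ff => dfmap GG (dfmap FF ff)) _ _).
  - intros x xx. apply pathover_of_tot.
    change (tmap GG (tmap FF (ti xx)) = ti (dfob GG (dfob FF xx))).
    rewrite !tmap_id. reflexivity.
  - intros x y z xx yy zz f g ff gg. apply pathover_of_tot.
    change (tmap GG (tmap FF (tc (tot ff) (tot gg))) =
      tc (tmap GG (tmap FF (tot ff))) (tmap GG (tmap FF (tot gg)))).
    rewrite !tmap_comp. reflexivity.
Defined.

Record disp_nat_trans {C C' : category} {F G : functor C C'} (s : nat_trans F G)
  {D : disp_cat C} {D' : disp_cat C'} (FF : disp_functor F D D') (GG : disp_functor G D D') :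
  Type := {
  dnt_ob :> forall (x : C) (xx : D x), dhom D' (dfob FF xx) (dfob GG xx) (s x);
  dnt_nat : forall {x y : C} {xx : D x} {yy : D y} {f : hom x y} (ff : dhom D xx yy f),
    pathover (nt_nat s f) (dfmap FF ff ;;; dnt_ob y yy) (dnt_ob x xx ;;; dfmap GG ff)
}.
Arguments dnt_ob {_ _ _ _ _ _ _ _ _} _ {_} _.
Arguments dnt_nat {_ _ _ _ _ _ _ _ _} _ {_ _ _ _ _} _.

Definition tnt {C C' : category} {F G : functor C C'} {s : nat_trans F G}
  {D : disp_cat C} {D' : disp_cat C'} {FF : disp_functor F D D'} {GG : disp_functor G D D'}
  (ss : disp_nat_trans s FF GG) {x : C} (xx : D x) : thom (dfob FF xx) (dfob GG xx) :=
  tot (dnt_ob ss xx).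

Lemma tnt_nat {C C' : category} {F G : functor C C'} {s : nat_trans F G}
  {D : disp_cat C} {D' : disp_cat C'} {FF : disp_functor F D D'} {GG : disp_functor G D D'}
  (ss : disp_nat_trans s FF GG) {x y : C} {xx : D x} {yy : D y} (f : thom xx yy) :
  tc (tmap FF f) (tnt ss yy) = tc (tnt ss xx) (tmap GG f).
Proof. apply (tot_of_pathover (dnt_nat ss (projT2 f))). Qed.

Lemma tot_nt {C C' : category} {F G : functor C C'} {s : nat_trans F G}
  {D : disp_cat C} {D' : disp_cat C'} {FF : disp_functor F D D'} {GG : disp_functor G D D'}
  (ss : disp_nat_trans s FF GG) {x : C} (xx : D x) : tot (dnt_ob ss xx) = tnt ss xx.
Proof. reflexivity. Qed.

Lemma disp_nat_trans_eq {C C' : category} {F G : functor C C'} {s : nat_trans F G}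
  {D : disp_cat C} {D' : disp_cat C'} {FF : disp_functor F D D'} {GG : disp_functor G D D'}
  (ss tt : disp_nat_trans s FF GG) :
  (forall x (xx : D x), dnt_ob ss xx = dnt_ob tt xx) -> ss = tt.
Proof.
  destruct ss as [ss Hs], tt as [tt Ht]; cbn. intros H.
  assert (e : ss = tt).
  { apply functional_extensionality_dep; intros x.
    apply functional_extensionality_dep; intros xx. apply H. }
  destruct e. f_equal.
  repeat (apply functional_extensionality_dep; intro). apply dhom_set.
Qed.

Definition fiber {C : category} (D : disp_cat C) (x : C) : category.
Proof.
  refine {| ob := D x;
    hom := fun a b => dhom D a b (idm x);
    idm := fun a => did a;
    comp := fun a b c f g => eq_rect _ (dhom D a c) (f ;;; g) _ (id_left (idm x)) |}.
  - intros a b f. apply did_left.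
  - intros a b f. apply tot_inj. rewrite tot_transport, tot_comp. apply tc_id_right.
  - intros a b c d f g h. apply tot_inj.
    repeat (rewrite ?tot_transport, ?tot_comp). apply tc_assoc.
  - intros a b. apply dhom_set.
Defined.

Lemma tot_fiber_comp {C : category} {D : disp_cat C} {x : C} {a b c : fiber D x}
  (f : hom a b) (g : hom b c) :
  tot (f ;; g : dhom D a c (idm x)) =
  tc (tot (f : dhom D a b (idm x))) (tot (g : dhom D b c (idm x))).
Proof. apply tot_transport. Qed.

Definition fiber_functor {C C' : category} {F : functor C C'} {D : disp_cat C} {D' : disp_cat C'}
  (FF : disp_functor F D D') (x : C) : functor (fiber D x) (fiber D' (F x)).
Proof.
  refine (Build_functor (fiber D x) (fiber D' (F x))
    (fun a => dfob FF (a : D x))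
    (fun a b f => eq_rect _ (dhom D' _ _) (dfmap FF f) _ (fmap_id F x)) _ _).
  - intros a. apply dfmap_id.
  - intros a b c f g. apply tot_inj.
    rewrite tot_fiber_comp, !tot_transport, !tot_map, tot_fiber_comp. apply tmap_comp.
Defined.

Definition is_cartesian {C : category} {D : disp_cat C} {x y : C} {xx : D x} {yy : D y}
  {f : hom x y} (ff : dhom D xx yy f) : Type :=
  forall (w : C) (ww : D w) (g : hom w x) (hh : dhom D ww yy (g ;; f)),
    unique_sol (fun gg : dhom D ww xx g => gg ;;; ff = hh).

Record cartesian_lift {C : category} {D : disp_cat C} {x y : C} (f : hom x y) (yy : D y) :
  Type := {
  cl_ob : D x;
  cl_mor : dhom D cl_ob yy f;
  cl_cart : is_cartesian cl_mor
}.
Arguments cl_ob {_ _ _ _ _ _} _.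
Arguments cl_mor {_ _ _ _ _ _} _.
Arguments cl_cart {_ _ _ _ _ _} _.

Definition cleaving {C : category} (D : disp_cat C) : Type :=
  forall (x y : C) (f : hom x y) (yy : D y), cartesian_lift f yy.

Definition is_cartesian_functor {C C' : category} {F : functor C C'} {D : disp_cat C}
  {D' : disp_cat C'} (FF : disp_functor F D D') : Type :=
  forall (x y : C) (xx : D x) (yy : D y) (f : hom x y) (ff : dhom D xx yy f),
    is_cartesian ff -> is_cartesian (dfmap FF ff).

(* Factorization through a Cartesian morphism, for a morphism lying over
   something equal to the composite. *)
Definition cart_factor {C : category} {D : disp_cat C} {w x y : C}
  {ww : D w} {xx : D x} {yy : D y} {f : hom x y} {ff : dhom D xx yy f}
  (Hff : is_cartesian ff) {g : hom w x} {h : hom w y} (p : h = g ;; f)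
  (hh : dhom D ww yy h) : dhom D ww xx g :=
  proj1_sig (Hff w ww g (eq_rect h (dhom D ww yy) hh _ p)).

Lemma cart_factor_tot {C : category} {D : disp_cat C} {w x y : C}
  {ww : D w} {xx : D x} {yy : D y} {f : hom x y} {ff : dhom D xx yy f}
  (Hff : is_cartesian ff) {g : hom w x} {h : hom w y} (p : h = g ;; f)
  (hh : dhom D ww yy h) : tc (tot (cart_factor Hff p hh)) (tot ff) = tot hh.
Proof.
  rewrite <- tot_comp. unfold cart_factor.
  rewrite (proj1 (proj2_sig (Hff w ww g (eq_rect h (dhom D ww yy) hh _ p)))).
  apply tot_transport.
Qed.

Lemma cart_unique_tot {C : category} {D : disp_cat C} {w x y : C}
  {ww : D w} {xx : D x} {yy : D y} {f : hom x y} {ff : dhom D xx yy f}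
  (Hff : is_cartesian ff) {g : hom w x} (gg gg' : dhom D ww xx g) :
  tc (tot gg) (tot ff) = tc (tot gg') (tot ff) -> gg = gg'.
Proof.
  rewrite <- !tot_comp. intros e. apply tot_inj in e.
  destruct (Hff w ww g (gg ;;; ff)) as [u [_ Hu]].
  rewrite <- (Hu gg eq_refl). apply Hu. symmetry. exact e.
Qed.

Section Substitution.
  Context {C : category} {D : disp_cat C} (cl : cleaving D).

  Definition subst_ob {x y : C} (f : hom x y) (yy : D y) : D x := cl_ob (cl x y f yy).

  Definition lift {x y : C} (f : hom x y) (yy : D y) : dhom D (subst_ob f yy) yy f :=
    cl_mor (cl x y f yy).

  Definition lift_cart {x y : C} (f : hom x y) (yy : D y) : is_cartesian (lift f yy) :=
    cl_cart (cl x y f yy).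

  Definition subst_mor {x y : C} (f : hom x y) {yy zz : D y} (gg : dhom D yy zz (idm y)) :
    dhom D (subst_ob f yy) (subst_ob f zz) (idm x) :=
    cart_factor (lift_cart f zz) (eq_trans (id_right f) (eq_sym (id_left f)))
      (lift f yy ;;; gg).

  Lemma subst_mor_tot {x y : C} (f : hom x y) {yy zz : D y} (gg : dhom D yy zz (idm y)) :
    tc (tot (subst_mor f gg)) (tot (lift f zz)) = tc (tot (lift f yy)) (tot gg).
  Proof. apply cart_factor_tot. Qed.

  Definition subst_functor {x y : C} (f : hom x y) : functor (fiber D y) (fiber D x).
  Proof.
    refine (Build_functor (fiber D y) (fiber D x)
      (fun yy => subst_ob f yy) (fun yy zz gg => subst_mor f gg) _ _).
    - intros yy. apply (cart_unique_tot (lift_cart f yy)).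
      rewrite subst_mor_tot. cbn. rewrite !tot_id, tc_id_left. apply tc_id_right.
    - intros a b c g h. apply (cart_unique_tot (lift_cart f c)).
      rewrite subst_mor_tot, !tot_fiber_comp, <- tc_assoc, subst_mor_tot.
      rewrite !tc_assoc, subst_mor_tot. reflexivity.
  Defined.

  (* The canonical comparison s2^* (f2^* yy) -> f1^* (s1^* yy) for a commuting
     square s2 ;; f2 = f1 ;; s1. *)
  Definition subst_square {w x y z : C} {f1 : hom w x} {s1 : hom x z} {s2 : hom w y}
    {f2 : hom y z} (e : s2 ;; f2 = f1 ;; s1) (yy : D z) :
    dhom D (subst_ob s2 (subst_ob f2 yy)) (subst_ob f1 (subst_ob s1 yy)) (idm w) :=
    cart_factor (lift_cart f1 (subst_ob s1 yy)) (eq_sym (id_left f1))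
      (cart_factor (lift_cart s1 yy) e
        (lift s2 (subst_ob f2 yy) ;;; lift f2 yy)).

  (* The Beck-Chevalley comparison L1 (s2^* b) -> s1^* (L2 b): the transpose of
     s2^* b -> s2^* (f2^* (L2 b)) -> f1^* (s1^* (L2 b)). *)
  Definition beck_chevalley_mor {w x y z : C} {f1 : hom w x} {s1 : hom x z} {s2 : hom w y}
    {f2 : hom y z} (e : s2 ;; f2 = f1 ;; s1)
    (L1 : left_adjoint (subst_functor f1)) (L2 : left_adjoint (subst_functor f2))
    (b : fiber D y) :
    hom (L1 (subst_functor s2 b)) (subst_functor s1 (L2 b)) :=
    fmap L1 (fmap (subst_functor s2) (ladj_unit L2 b) ;;
             (subst_square e (L2 b) :
               @hom (fiber D w) (subst_functor s2 (subst_functor f2 (L2 b)))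
                  (subst_functor f1 (subst_functor s1 (L2 b))))) ;;
    ladj_counit L1 (subst_functor s1 (L2 b)).
End Substitution.

Record arr {C : category} (y : C) : Type := {
  arr_dom : C;
  arr_mor :> hom arr_dom y
}.
Arguments arr_dom {_ _} _.
Arguments arr_mor {_ _} _.

Definition sq {C : category} {x y : C} (a : arr x) (b : arr y) (f : hom x y) : Type :=
  { t : hom (arr_dom a) (arr_dom b) | t ;; b = a ;; f }.

Definition sq_top {C : category} {x y : C} {a : arr x} {b : arr y} {f : hom x y}
  (s : sq a b f) : hom (arr_dom a) (arr_dom b) := proj1_sig s.

Lemma sq_pathover {C : category} {x y : C} {a : arr x} {b : arr y} {f g : hom x y}
  (p : f = g) (s : sq a b f) (t : sq a b g) : sq_top s = sq_top t -> pathover p s t.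
Proof.
  destruct p. intros e. unfold pathover. cbn.
  apply sig_eq; [intros; apply hom_set | exact e].
Qed.

Lemma sq_transport_top {C : category} {x y : C} {a : arr x} {b : arr y} {f g : hom x y}
  (p : f = g) (s : sq a b f) : sq_top (eq_rect f (sq a b) s g p) = sq_top s.
Proof. destruct p. reflexivity. Qed.

Lemma sq_pathover_top {C : category} {x y : C} {a : arr x} {b : arr y} {f g : hom x y}
  {p : f = g} {s : sq a b f} {t : sq a b g} : pathover p s t -> sq_top s = sq_top t.
Proof. destruct p. intros []. reflexivity. Qed.

Definition disp_codomain (C : category) : disp_cat C.
Proof.
  unshelve refine (Build_disp_cat C (fun y => arr y) (fun x y a b f => sq a b f)
    (fun x a => exist _ (idm (arr_dom a)) _)
    (fun x y z a b c f g s t => exist _ (sq_top s ;; sq_top t) _) _ _ _ _).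
  - cbn. rewrite id_left, id_right. reflexivity.
  - cbn. destruct s as [s Hs], t as [t Ht]; cbn.
    rewrite <- assoc, Ht, assoc, Hs. symmetry. apply assoc.
  - intros. apply sq_pathover, id_left.
  - intros. apply sq_pathover, id_right.
  - intros. apply sq_pathover, assoc.
  - intros. apply isaset_sig; [intros; apply hom_set | apply hom_set].
Defined.

Definition codomain_functor {C C' : category} (F : functor C C') :
  disp_functor F (disp_codomain C) (disp_codomain C').
Proof.
  unshelve refine (Build_disp_functor C C' F (disp_codomain C) (disp_codomain C')
    (fun x (a : arr x) => {| arr_dom := F (arr_dom a); arr_mor := fmap F a |})
    (fun x y a b f s => exist _ (fmap F (sq_top s)) _) _ _).
  - cbn. rewrite <- !fmap_comp. f_equal. exact (proj2_sig s).
  - intros. apply sq_pathover. cbn. apply fmap_id.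
  - intros. apply sq_pathover. cbn. apply fmap_comp.
Defined.

Declare Scope bicat_scope.
Open Scope bicat_scope.

Reserved Notation "f · g" (at level 38, left associativity).
Reserved Notation "a • b" (at level 50, left associativity).
Reserved Notation "f ◃ a" (at level 37, right associativity).
Reserved Notation "a ▹ g" (at level 36, left associativity).

Record bicat : Type := {
  bob :> Type;
  mor1 : bob -> bob -> Type;
  cell : forall {x y}, mor1 x y -> mor1 x y -> Type;
  id1 : forall x, mor1 x x;
  comp1 : forall {x y z}, mor1 x y -> mor1 y z -> mor1 x z
    where "f · g" := (comp1 f g);
  id2 : forall {x y} (f : mor1 x y), cell f f;
  vcomp : forall {x y} {f g h : mor1 x y}, cell f g -> cell g h -> cell f h
    where "a • b" := (vcomp a b);
  lwhisker : forall {x y z} (f : mor1 x y) {g h : mor1 y z},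
    cell g h -> cell (f · g) (f · h)
    where "f ◃ a" := (lwhisker f a);
  rwhisker : forall {x y z} {f g : mor1 x y} (h : mor1 y z),
    cell f g -> cell (f · h) (g · h)
    where "a ▹ h" := (rwhisker h a);
  lunitor : forall {x y} (f : mor1 x y), cell (id1 x · f) f;
  linvunitor : forall {x y} (f : mor1 x y), cell f (id1 x · f);
  runitor : forall {x y} (f : mor1 x y), cell (f · id1 y) f;
  rinvunitor : forall {x y} (f : mor1 x y), cell f (f · id1 y);
  lassociator : forall {w x y z} (f : mor1 w x) (g : mor1 x y) (h : mor1 y z),
    cell (f · (g · h)) ((f · g) · h);
  rassociator : forall {w x y z} (f : mor1 w x) (g : mor1 x y) (h : mor1 y z),
    cell ((f · g) · h) (f · (g · h));

  id2_left : forall {x y} {f g : mor1 x y} (a : cell f g), id2 f • a = a;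
  id2_right : forall {x y} {f g : mor1 x y} (a : cell f g), a • id2 g = a;
  vassoc : forall {x y} {f g h k : mor1 x y} (a : cell f g) (b : cell g h) (c : cell h k),
    a • (b • c) = (a • b) • c;
  lwhisker_id2 : forall {x y z} (f : mor1 x y) (g : mor1 y z), f ◃ id2 g = id2 (f · g);
  rwhisker_id2 : forall {x y z} (f : mor1 x y) (g : mor1 y z), id2 f ▹ g = id2 (f · g);
  lwhisker_vcomp : forall {x y z} (f : mor1 x y) {g h i : mor1 y z}
    (a : cell g h) (b : cell h i), f ◃ (a • b) = (f ◃ a) • (f ◃ b);
  rwhisker_vcomp : forall {x y z} {f g h : mor1 x y} (i : mor1 y z)
    (a : cell f g) (b : cell g h), (a • b) ▹ i = (a ▹ i) • (b ▹ i);
  vcomp_lunitor : forall {x y} {f g : mor1 x y} (a : cell f g),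
    (id1 x ◃ a) • lunitor g = lunitor f • a;
  vcomp_runitor : forall {x y} {f g : mor1 x y} (a : cell f g),
    (a ▹ id1 y) • runitor g = runitor f • a;
  lwhisker_lwhisker : forall {w x y z} (f : mor1 w x) (g : mor1 x y) {h i : mor1 y z}
    (a : cell h i),
    (f ◃ (g ◃ a)) • lassociator f g i = lassociator f g h • ((f · g) ◃ a);
  rwhisker_lwhisker : forall {w x y z} (f : mor1 w x) {g h : mor1 x y} (i : mor1 y z)
    (a : cell g h),
    (f ◃ (a ▹ i)) • lassociator f h i = lassociator f g i • ((f ◃ a) ▹ i);
  rwhisker_rwhisker : forall {w x y z} {f g : mor1 w x} (h : mor1 x y) (i : mor1 y z)
    (a : cell f g),
    lassociator f h i • ((a ▹ h) ▹ i) = (a ▹ (h · i)) • lassociator g h i;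
  vcomp_whisker : forall {x y z} {f g : mor1 x y} {h i : mor1 y z}
    (a : cell f g) (b : cell h i), (a ▹ h) • (g ◃ b) = (f ◃ b) • (a ▹ i);
  lunitor_linvunitor : forall {x y} (f : mor1 x y),
    lunitor f • linvunitor f = id2 (id1 x · f);
  linvunitor_lunitor : forall {x y} (f : mor1 x y), linvunitor f • lunitor f = id2 f;
  runitor_rinvunitor : forall {x y} (f : mor1 x y),
    runitor f • rinvunitor f = id2 (f · id1 y);
  rinvunitor_runitor : forall {x y} (f : mor1 x y), rinvunitor f • runitor f = id2 f;
  lassociator_rassociator : forall {w x y z} (f : mor1 w x) (g : mor1 x y) (h : mor1 y z),
    lassociator f g h • rassociator f g h = id2 (f · (g · h));
  rassociator_lassociator : forall {w x y z} (f : mor1 w x) (g : mor1 x y) (h : mor1 y z),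
    rassociator f g h • lassociator f g h = id2 ((f · g) · h);
  triangle : forall {x y z} (f : mor1 x y) (g : mor1 y z),
    lassociator f (id1 y) g • (runitor f ▹ g) = f ◃ lunitor g;
  pentagon : forall {v w x y z} (f : mor1 v w) (g : mor1 w x) (h : mor1 x y) (i : mor1 y z),
    ((f ◃ lassociator g h i) • lassociator f (g · h) i) • (lassociator f g h ▹ i) =
    lassociator f g (h · i) • lassociator (f · g) h i;
  cell_set : forall {x y} (f g : mor1 x y), isaset (cell f g)
}.

Arguments mor1 {_} _ _.
Arguments cell {_ _ _} _ _.
Arguments id1 {_} _.
Arguments comp1 {_ _ _ _} _ _.
Arguments id2 {_ _ _} _.
Arguments vcomp {_ _ _ _ _ _} _ _.
Arguments lwhisker {_ _ _ _} _ {_ _} _.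
Arguments rwhisker {_ _ _ _ _ _} _ _.
Arguments lunitor {_ _ _} _.
Arguments linvunitor {_ _ _} _.
Arguments runitor {_ _ _} _.
Arguments rinvunitor {_ _ _} _.
Arguments lassociator {_ _ _ _ _} _ _ _.
Arguments rassociator {_ _ _ _ _} _ _ _.
Arguments id2_left {_ _ _ _ _} _.
Arguments id2_right {_ _ _ _ _} _.
Arguments vassoc {_ _ _ _ _ _ _} _ _ _.
Arguments lwhisker_id2 {_ _ _ _} _ _.
Arguments rwhisker_id2 {_ _ _ _} _ _.
Arguments lwhisker_vcomp {_ _ _ _} _ {_ _ _} _ _.
Arguments rwhisker_vcomp {_ _ _ _ _ _ _} _ _ _.
Arguments vcomp_lunitor {_ _ _ _ _} _.
Arguments vcomp_runitor {_ _ _ _ _} _.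
Arguments lwhisker_lwhisker {_ _ _ _ _} _ _ {_ _} _.
Arguments rwhisker_lwhisker {_ _ _ _ _} _ {_ _} _ _.
Arguments rwhisker_rwhisker {_ _ _ _ _ _ _} _ _ _.
Arguments vcomp_whisker {_ _ _ _ _ _ _ _} _ _.
Arguments lunitor_linvunitor {_ _ _} _.
Arguments linvunitor_lunitor {_ _ _} _.
Arguments runitor_rinvunitor {_ _ _} _.
Arguments rinvunitor_runitor {_ _ _} _.
Arguments lassociator_rassociator {_ _ _ _ _} _ _ _.
Arguments rassociator_lassociator {_ _ _ _ _} _ _ _.
Arguments triangle {_ _ _ _} _ _.
Arguments pentagon {_ _ _ _ _ _} _ _ _ _.
Arguments cell_set _ {_ _} _ _ _ _ _ _.

Notation "f · g" := (comp1 f g) : bicat_scope.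
Notation "a • b" := (vcomp a b) : bicat_scope.
Notation "f ◃ a" := (lwhisker f a) : bicat_scope.
Notation "a ▹ h" := (rwhisker h a) : bicat_scope.

Record is_invertible {B : bicat} {x y : B} {f g : mor1 x y} (a : cell f g) : Type := {
  inv2 : cell g f;
  inv2_r : a • inv2 = id2 f;
  inv2_l : inv2 • a = id2 g
}.
Arguments inv2 {_ _ _ _ _ _} _.
Arguments inv2_r {_ _ _ _ _ _} _.
Arguments inv2_l {_ _ _ _ _ _} _.

Record adjoint_equivalence {B : bicat} {x y : B} (f : mor1 x y) : Type := {
  ae_inv : mor1 y x;
  ae_unit : cell (id1 x) (f · ae_inv);
  ae_counit : cell (ae_inv · f) (id1 y);
  ae_unit_invertible : is_invertible ae_unit;
  ae_counit_invertible : is_invertible ae_counit;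
  ae_triangle1 :
    linvunitor f • (ae_unit ▹ f) • rassociator f ae_inv f • (f ◃ ae_counit) • runitor f
    = id2 f;
  ae_triangle2 :
    rinvunitor ae_inv • (ae_inv ◃ ae_unit) • lassociator ae_inv f ae_inv •
      (ae_counit ▹ ae_inv) • lunitor ae_inv
    = id2 ae_inv
}.

Section BicatLemmas.
  Context {B : bicat}.

  Lemma vcomp_cancel_r {x y : B} {f g h : mor1 x y} (a b : cell f g) {c : cell g h}
    (Hc : is_invertible c) : a • c = b • c -> a = b.
  Proof.
    intros e. rewrite <- (id2_right a), <- (id2_right b), <- (inv2_r Hc), !vassoc, e.
    reflexivity.
  Qed.

  Lemma vcomp_cancel_l {x y : B} {f g h : mor1 x y} {c : cell f g} (a b : cell g h)
    (Hc : is_invertible c) : c • a = c • b -> a = b.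
  Proof.
    intros e. rewrite <- (id2_left a), <- (id2_left b), <- (inv2_l Hc), <- !vassoc, e.
    reflexivity.
  Qed.

  Definition id2_invertible {x y : B} (f : mor1 x y) : is_invertible (id2 f) :=
    {| inv2 := id2 f; inv2_r := id2_left (id2 f); inv2_l := id2_left (id2 f) |}.

  Definition inv2_invertible {x y : B} {f g : mor1 x y} {a : cell f g} (H : is_invertible a) :
    is_invertible (inv2 H) :=
    {| inv2 := a; inv2_r := inv2_l H; inv2_l := inv2_r H |}.

  Definition vcomp_invertible {x y : B} {f g h : mor1 x y} {a : cell f g} {b : cell g h}
    (Ha : is_invertible a) (Hb : is_invertible b) : is_invertible (a • b).
  Proof.
    exists (inv2 Hb • inv2 Ha).
    - rewrite vassoc, <- (vassoc a), inv2_r, id2_right. apply inv2_r.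
    - rewrite vassoc, <- (vassoc _ (inv2 Ha)), inv2_l, id2_right. apply inv2_l.
  Defined.

  Definition lwhisker_invertible {x y z : B} (f : mor1 x y) {g h : mor1 y z} {a : cell g h}
    (Ha : is_invertible a) : is_invertible (f ◃ a).
  Proof.
    exists (f ◃ inv2 Ha); rewrite <- lwhisker_vcomp, ?inv2_r, ?inv2_l; apply lwhisker_id2.
  Defined.

  Definition rwhisker_invertible {x y z : B} {f g : mor1 x y} (h : mor1 y z) {a : cell f g}
    (Ha : is_invertible a) : is_invertible (a ▹ h).
  Proof.
    exists (inv2 Ha ▹ h); rewrite <- rwhisker_vcomp, ?inv2_r, ?inv2_l; apply rwhisker_id2.
  Defined.

  Definition lunitor_invertible {x y : B} (f : mor1 x y) : is_invertible (lunitor f) :=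
    {| inv2 := linvunitor f; inv2_r := lunitor_linvunitor f; inv2_l := linvunitor_lunitor f |}.
  Definition runitor_invertible {x y : B} (f : mor1 x y) : is_invertible (runitor f) :=
    {| inv2 := rinvunitor f; inv2_r := runitor_rinvunitor f; inv2_l := rinvunitor_runitor f |}.
  Definition lassociator_invertible {w x y z : B} (f : mor1 w x) (g : mor1 x y) (h : mor1 y z) :
    is_invertible (lassociator f g h) :=
    {| inv2 := rassociator f g h; inv2_r := lassociator_rassociator f g h;
       inv2_l := rassociator_lassociator f g h |}.

  Lemma rwhisker_id1_inj {x y : B} {f g : mor1 x y} (a b : cell f g) :
    a ▹ id1 y = b ▹ id1 y -> a = b.
  Proof.
    intros e. apply (vcomp_cancel_l _ _ (runitor_invertible f)).
    rewrite <- !vcomp_runitor, e. reflexivity.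
  Qed.

  Lemma lwhisker_id1_inj {x y : B} {f g : mor1 x y} (a b : cell f g) :
    id1 x ◃ a = id1 x ◃ b -> a = b.
  Proof.
    intros e. apply (vcomp_cancel_l _ _ (lunitor_invertible f)).
    rewrite <- !vcomp_lunitor, e. reflexivity.
  Qed.

  Lemma runitor_triangle {x y z : B} (f : mor1 x y) (g : mor1 y z) :
    lassociator f g (id1 z) • runitor (f · g) = f ◃ runitor g.
  Proof.
    apply rwhisker_id1_inj.
    apply (vcomp_cancel_l _ _ (lassociator_invertible _ _ _)).
    apply (vcomp_cancel_l _ _ (lwhisker_invertible f (lassociator_invertible g _ _))).
    rewrite <- rwhisker_lwhisker, (vassoc (f ◃ _) (f ◃ _)), <- lwhisker_vcomp, triangle.
    rewrite lwhisker_lwhisker, rwhisker_vcomp, !vassoc, pentagon, <- vassoc, triangle.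
    reflexivity.
  Qed.
End BicatLemmas.

(* Equations between 2-cells are verified after applying the representable
    pseudofunctors, for which 1-cells compose strictly: an expression [e] for a
    1-cell from [x] to [y] acts on 1-cells [k] into [x] by [act e k], which is
    isomorphic to [k · den e], and associators and unitors act as identities. *)

Section Coherence.
  Context {B : bicat}.

  Inductive expr : B -> B -> Type :=
  | EId : forall x, expr x x
  | EAtom : forall {x y}, mor1 x y -> expr x y
  | EComp : forall {x y z}, expr x y -> expr y z -> expr x z.

  Fixpoint den {x y : B} (e : expr x y) : mor1 x y :=
    match e with
    | EId x => id1 x
    | EAtom f => f
    | EComp e1 e2 => den e1 · den e2
    end.

  Fixpoint act {x y : B} (e : expr x y) {w : B} : mor1 w x -> mor1 w y :=
    match e with
    | EId x => fun k => k
    | EAtom f => fun k => k · f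
    | EComp e1 e2 => fun k => act e2 (act e1 k)
    end.

  Fixpoint act2 {x y : B} (e : expr x y) {w : B} :
    forall {k k' : mor1 w x}, cell k k' -> cell (act e k) (act e k') :=
    match e with
    | EId x => fun k k' t => t
    | EAtom f => fun k k' t => t ▹ f
    | EComp e1 e2 => fun k k' t => act2 e2 (act2 e1 t)
    end.

  Fixpoint act_iso {x y : B} (e : expr x y) {w : B} :
    forall k : mor1 w x, cell (k · den e) (act e k) :=
    match e with
    | EId x => fun k => runitor k
    | EAtom f => fun k => id2 (k · f)
    | EComp e1 e2 => fun k =>
        lassociator k (den e1) (den e2) • ((act_iso e1 k ▹ den e2) • act_iso e2 (act e1 k))
    end.

  Lemma act_iso_invertible {x y : B} (e : expr x y) {w : B} (k : mor1 w x) :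
    is_invertible (act_iso e k).
  Proof.
    revert w k. induction e; intros w k; cbn.
    - apply runitor_invertible.
    - apply id2_invertible.
    - apply vcomp_invertible; [apply lassociator_invertible |].
      apply vcomp_invertible; [apply rwhisker_invertible |]; auto.
  Qed.

  Lemma act2_id {x y : B} (e : expr x y) {w : B} (k : mor1 w x) :
    act2 e (id2 k) = id2 (act e k).
  Proof.
    revert w k. induction e; intros w k; cbn; auto.
    - apply rwhisker_id2.
    - rewrite IHe1. apply IHe2.
  Qed.

  Lemma act2_vcomp {x y : B} (e : expr x y) {w : B} {k1 k2 k3 : mor1 w x}
    (s : cell k1 k2) (t : cell k2 k3) : act2 e (s • t) = act2 e s • act2 e t.
  Proof.
    revert w k1 k2 k3 s t. induction e; intros; cbn; auto.
    - apply rwhisker_vcomp.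
    - rewrite IHe1. apply IHe2.
  Qed.

  Lemma act_iso_nat {x y : B} (e : expr x y) {w : B} {k k' : mor1 w x} (t : cell k k') :
    (t ▹ den e) • act_iso e k' = act_iso e k • act2 e t.
  Proof.
    revert w k k' t. induction e; intros; cbn.
    - apply vcomp_runitor.
    - rewrite id2_left. apply id2_right.
    - rewrite vassoc, <- rwhisker_rwhisker, <- !vassoc. f_equal.
      rewrite vassoc, <- rwhisker_vcomp, IHe1, rwhisker_vcomp, <- !vassoc. f_equal.
      apply IHe2.
  Qed.

  Definition strict {x y : B} (e e' : expr x y) (a : cell (den e) (den e')) {w : B}
    (k : mor1 w x) : cell (act e k) (act e' k) :=
    inv2 (act_iso_invertible e k) • ((k ◃ a) • act_iso e' k).

  Lemma strict_spec {x y : B} (e e' : expr x y) (a : cell (den e) (den e')) {w : B}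
    (k : mor1 w x) : act_iso e k • strict e e' a k = (k ◃ a) • act_iso e' k.
  Proof. unfold strict. rewrite vassoc, inv2_r. apply id2_left. Qed.

  Lemma strict_unique {x y : B} (e e' : expr x y) (a : cell (den e) (den e')) {w : B}
    (k : mor1 w x) (s : cell (act e k) (act e' k)) :
    (k ◃ a) • act_iso e' k = act_iso e k • s -> strict e e' a k = s.
  Proof.
    intros H. apply (vcomp_cancel_l _ _ (act_iso_invertible e k)).
    rewrite strict_spec. exact H.
  Qed.

  Lemma strict_nat {x y : B} (e e' : expr x y) (a : cell (den e) (den e')) {w : B}
    {k k' : mor1 w x} (t : cell k k') :
    act2 e t • strict e e' a k' = strict e e' a k • act2 e' t.
  Proof.
    apply (vcomp_cancel_l _ _ (act_iso_invertible e k)).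
    rewrite !vassoc, <- act_iso_nat, <- vassoc, !strict_spec, vassoc, vcomp_whisker.
    rewrite <- !vassoc, act_iso_nat. reflexivity.
  Qed.

  Lemma strict_inj {x y : B} (e e' : expr x y) (a b : cell (den e) (den e')) :
    strict e e' a (id1 x) = strict e e' b (id1 x) -> a = b.
  Proof.
    intros H. apply lwhisker_id1_inj.
    apply (vcomp_cancel_r _ _ (act_iso_invertible e' (id1 x))).
    rewrite <- !strict_spec, H. reflexivity.
  Qed.

  Inductive cexpr : forall {x y : B}, expr x y -> expr x y -> Type :=
  | CAtom : forall {x y} (e e' : expr x y), cell (den e) (den e') -> cexpr e e'
  | CId : forall {x y} (e : expr x y), cexpr e e
  | CVcomp : forall {x y} {e e' e'' : expr x y}, cexpr e e' -> cexpr e' e'' -> cexpr e e''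
  | CLwhisker : forall {x y z} (f : expr x y) {e e' : expr y z}, cexpr e e' ->
      cexpr (EComp f e) (EComp f e')
  | CRwhisker : forall {x y z} {e e' : expr x y} (f : expr y z), cexpr e e' ->
      cexpr (EComp e f) (EComp e' f)
  | CLunitor : forall {x y} (e : expr x y), cexpr (EComp (EId x) e) e
  | CLinvunitor : forall {x y} (e : expr x y), cexpr e (EComp (EId x) e)
  | CRunitor : forall {x y} (e : expr x y), cexpr (EComp e (EId y)) e
  | CRinvunitor : forall {x y} (e : expr x y), cexpr e (EComp e (EId y))
  | CLassociator : forall {w x y z} (f : expr w x) (g : expr x y) (h : expr y z),
      cexpr (EComp f (EComp g h)) (EComp (EComp f g) h)
  | CRassociator : forall {w x y z} (f : expr w x) (g : expr x y) (h : expr y z),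
      cexpr (EComp (EComp f g) h) (EComp f (EComp g h)).

  Fixpoint cden {x y : B} {e e' : expr x y} (a : cexpr e e') : cell (den e) (den e') :=
    match a with
    | CAtom e e' a => a
    | CId e => id2 (den e)
    | CVcomp a b => cden a • cden b
    | CLwhisker f a => den f ◃ cden a
    | CRwhisker f a => cden a ▹ den f
    | CLunitor e => lunitor (den e)
    | CLinvunitor e => linvunitor (den e)
    | CRunitor e => runitor (den e)
    | CRinvunitor e => rinvunitor (den e)
    | CLassociator f g h => lassociator (den f) (den g) (den h)
    | CRassociator f g h => rassociator (den f) (den g) (den h)
    end.

  Fixpoint cact {x y : B} {e e' : expr x y} (a : cexpr e e') {w : B} :
    forall k : mor1 w x, cell (act e k) (act e' k) :=
    match a in @cexpr x y e e' return forall k : mor1 w x, cell (act e k) (act e' k) with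
    | CAtom e e' a => fun k => strict e e' a k
    | CId e => fun k => id2 (act e k)
    | CVcomp a b => fun k => cact a k • cact b k
    | CLwhisker f a => fun k => cact a (act f k)
    | CRwhisker f a => fun k => act2 f (cact a k)
    | CLunitor e => fun k => id2 (act e k)
    | CLinvunitor e => fun k => id2 (act e k)
    | CRunitor e => fun k => id2 (act e k)
    | CRinvunitor e => fun k => id2 (act e k)
    | CLassociator f g h => fun k => id2 (act h (act g (act f k)))
    | CRassociator f g h => fun k => id2 (act h (act g (act f k)))
    end.

  Lemma strict_inverse {x y : B} (e e' : expr x y) (a : cell (den e) (den e'))
    (b : cell (den e') (den e)) {w : B} (k : mor1 w x) (s : cell (act e k) (act e' k))
    (t : cell (act e' k) (act e k)) :
    b • a = id2 _ -> t • s = id2 _ -> s • t = id2 _ ->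
    (k ◃ a) • act_iso e' k = act_iso e k • s ->
    (k ◃ b) • act_iso e k = act_iso e' k • t.
  Proof.
    intros Hba Hts Hst H.
    apply (vcomp_cancel_r _ _ (Build_is_invertible _ _ _ _ _ s t Hst Hts)).
    rewrite <- !vassoc, <- H, Hts, vassoc, <- lwhisker_vcomp, Hba, lwhisker_id2.
    rewrite id2_left, id2_right. reflexivity.
  Qed.

  Lemma act_iso_lunitor {x y : B} (e : expr x y) {w : B} (k : mor1 w x) :
    (k ◃ lunitor (den e)) • act_iso e k = act_iso (EComp (EId x) e) k • id2 (act e k).
  Proof. cbn. rewrite id2_right, vassoc, triangle. reflexivity. Qed.

  Lemma act_iso_runitor {x y : B} (e : expr x y) {w : B} (k : mor1 w x) :
    (k ◃ runitor (den e)) • act_iso e k = act_iso (EComp e (EId y)) k • id2 (act e k).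
  Proof.
    cbn. rewrite id2_right, vcomp_runitor, vassoc, runitor_triangle. reflexivity.
  Qed.

  Lemma act_iso_lassociator {v x y z : B} (f : expr v x) (g : expr x y) (h : expr y z)
    {w : B} (k : mor1 w v) :
    (k ◃ lassociator (den f) (den g) (den h)) • act_iso (EComp (EComp f g) h) k =
    act_iso (EComp f (EComp g h)) k • id2 (act h (act g (act f k))).
  Proof.
    cbn. rewrite id2_right, !rwhisker_vcomp, !vassoc, pentagon. f_equal. f_equal.
    rewrite <- !vassoc. f_equal. apply rwhisker_rwhisker.
  Qed.

  Lemma cact_spec {x y : B} {e e' : expr x y} (a : cexpr e e') {w : B} (k : mor1 w x) :
    (k ◃ cden a) • act_iso e' k = act_iso e k • cact a k.
  Proof.
    revert w k. induction a; intros w0 k.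
    - symmetry. apply strict_spec.
    - cbn. rewrite lwhisker_id2, id2_left, id2_right. reflexivity.
    - cbn. rewrite lwhisker_vcomp, <- vassoc, IHa2, vassoc, IHa1. symmetry. apply vassoc.
    - cbn. rewrite vassoc, lwhisker_lwhisker, <- !vassoc. f_equal.
      rewrite vassoc, <- vcomp_whisker, <- !vassoc. f_equal. apply IHa.
    - cbn. rewrite vassoc, rwhisker_lwhisker, <- !vassoc. f_equal.
      rewrite vassoc, <- rwhisker_vcomp, IHa, rwhisker_vcomp, <- vassoc. f_equal.
      apply act_iso_nat.
    - apply act_iso_lunitor.
    - exact (strict_inverse (EComp (EId x) e) e (lunitor (den e)) (linvunitor (den e)) k
        (id2 _) (id2 _) (linvunitor_lunitor _) (id2_left _) (id2_left _)
        (act_iso_lunitor e k)).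
    - apply act_iso_runitor.
    - exact (strict_inverse (EComp e (EId y)) e (runitor (den e)) (rinvunitor (den e)) k
        (id2 _) (id2 _) (rinvunitor_runitor _) (id2_left _) (id2_left _)
        (act_iso_runitor e k)).
    - apply act_iso_lassociator.
    - exact (strict_inverse (EComp f (EComp g h)) (EComp (EComp f g) h)
        (lassociator (den f) (den g) (den h)) (rassociator (den f) (den g) (den h)) k
        (id2 _) (id2 _) (rassociator_lassociator _ _ _) (id2_left _) (id2_left _)
        (act_iso_lassociator f g h k)).
  Qed.

  Lemma cden_eq {x y : B} {e e' : expr x y} (a b : cexpr e e') :
    (forall (w : B) (k : mor1 w x), cact a k = cact b k) -> cden a = cden b.
  Proof.
    intros H. apply lwhisker_id1_inj.
    apply (vcomp_cancel_r _ _ (act_iso_invertible e' (id1 x))).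
    rewrite !cact_spec, H. reflexivity.
  Qed.

  Lemma cact_eq {x y : B} {e e' : expr x y} (a b : cexpr e e') :
    cden a = cden b -> forall (w : B) (k : mor1 w x), cact a k = cact b k.
  Proof.
    intros H w k. apply (vcomp_cancel_l _ _ (act_iso_invertible e k)).
    rewrite <- !cact_spec, H. reflexivity.
  Qed.
End Coherence.

Ltac reify1 f :=
  lazymatch f with
  | comp1 ?a ?b => let ea := reify1 a in let eb := reify1 b in constr:(EComp ea eb)
  | id1 ?x => constr:(EId x)
  | _ => constr:(EAtom f)
  end.

Ltac reify2 t :=
  lazymatch t with
  | vcomp ?a ?b => let ea := reify2 a in let eb := reify2 b in constr:(CVcomp ea eb)
  | id2 ?f => let e := reify1 f in constr:(CId e)
  | lwhisker ?f ?a => let e := reify1 f in let ea := reify2 a in constr:(CLwhisker e ea)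
  | rwhisker ?f ?a => let e := reify1 f in let ea := reify2 a in constr:(CRwhisker e ea)
  | lunitor ?f => let e := reify1 f in constr:(CLunitor e)
  | linvunitor ?f => let e := reify1 f in constr:(CLinvunitor e)
  | runitor ?f => let e := reify1 f in constr:(CRunitor e)
  | rinvunitor ?f => let e := reify1 f in constr:(CRinvunitor e)
  | lassociator ?f ?g ?h =>
      let e1 := reify1 f in let e2 := reify1 g in let e3 := reify1 h in
      constr:(CLassociator e1 e2 e3)
  | rassociator ?f ?g ?h =>
      let e1 := reify1 f in let e2 := reify1 g in let e3 := reify1 h in
      constr:(CRassociator e1 e2 e3)
  | _ =>
      lazymatch type of t with
      | cell ?f ?g => let e := reify1 f in let e' := reify1 g in constr:(CAtom e e' t)
      end
  end.

Ltac strict_simpl :=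
  cbn [act act2 cact]; rewrite ?rwhisker_vcomp, ?rwhisker_id2;
  repeat (rewrite ?id2_left, ?id2_right, ?rwhisker_id2); rewrite <- ?vassoc.

Ltac strict_simpl_in H :=
  cbn [act act2 cact] in H; rewrite ?rwhisker_vcomp, ?rwhisker_id2 in H;
  repeat (rewrite ?id2_left, ?id2_right, ?rwhisker_id2 in H); rewrite <- ?vassoc in H.

Ltac strictify :=
  lazymatch goal with
  | |- @eq (cell _ _) ?a ?b =>
      let ea := reify2 a in let eb := reify2 b in
      apply (cden_eq ea eb);
      let w := fresh "w" in let k := fresh "k" in intros w k
  end; strict_simpl.

Ltac strict_law H k N :=
  lazymatch type of H with
  | @eq (cell _ _) ?a ?b =>
      let ea := reify2 a in let eb := reify2 b in
      pose proof (cact_eq ea eb H _ k) as N; strict_simpl_in N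
  end.

Record psfunctor (B1 B2 : bicat) : Type := {
  ps_ob :> B1 -> B2;
  ps_mor : forall {x y : B1}, mor1 x y -> mor1 (ps_ob x) (ps_ob y);
  ps_cell : forall {x y : B1} {f g : mor1 x y}, cell f g -> cell (ps_mor f) (ps_mor g);
  ps_id : forall x : B1, cell (id1 (ps_ob x)) (ps_mor (id1 x));
  ps_comp : forall {x y z : B1} (f : mor1 x y) (g : mor1 y z),
    cell (ps_mor f · ps_mor g) (ps_mor (f · g));
  ps_id_invertible : forall x : B1, is_invertible (ps_id x);
  ps_comp_invertible : forall {x y z : B1} (f : mor1 x y) (g : mor1 y z),
    is_invertible (ps_comp f g);
  ps_cell_id2 : forall {x y : B1} (f : mor1 x y), ps_cell (id2 f) = id2 (ps_mor f);
  ps_cell_vcomp : forall {x y : B1} {f g h : mor1 x y} (a : cell f g) (b : cell g h),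
    ps_cell (a • b) = ps_cell a • ps_cell b;
  ps_lunitor : forall {x y : B1} (f : mor1 x y),
    lunitor (ps_mor f) = (ps_id x ▹ ps_mor f) • ps_comp (id1 x) f • ps_cell (lunitor f);
  ps_runitor : forall {x y : B1} (f : mor1 x y),
    runitor (ps_mor f) = (ps_mor f ◃ ps_id y) • ps_comp f (id1 y) • ps_cell (runitor f);
  ps_lassociator : forall {w x y z : B1} (f : mor1 w x) (g : mor1 x y) (h : mor1 y z),
    (ps_mor f ◃ ps_comp g h) • ps_comp f (g · h) • ps_cell (lassociator f g h) =
    lassociator (ps_mor f) (ps_mor g) (ps_mor h) • (ps_comp f g ▹ ps_mor h) •
      ps_comp (f · g) h;
  ps_lwhisker : forall {x y z : B1} (f : mor1 x y) {g h : mor1 y z} (a : cell g h),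
    ps_comp f g • ps_cell (f ◃ a) = (ps_mor f ◃ ps_cell a) • ps_comp f h;
  ps_rwhisker : forall {x y z : B1} {f g : mor1 x y} (h : mor1 y z) (a : cell f g),
    ps_comp f h • ps_cell (a ▹ h) = (ps_cell a ▹ ps_mor h) • ps_comp g h
}.
Arguments ps_mor {_ _} _ {_ _} _.
Arguments ps_cell {_ _} _ {_ _ _ _} _.
Arguments ps_id {_ _} _ _.
Arguments ps_comp {_ _} _ {_ _ _} _ _.
Arguments ps_id_invertible {_ _} _ _.
Arguments ps_comp_invertible {_ _} _ {_ _ _} _ _.
Arguments ps_cell_id2 {_ _} _ {_ _} _.
Arguments ps_cell_vcomp {_ _} _ {_ _ _ _ _} _ _.
Arguments ps_lunitor {_ _} _ {_ _} _.
Arguments ps_runitor {_ _} _ {_ _} _.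
Arguments ps_lassociator {_ _} _ {_ _ _ _} _ _ _.
Arguments ps_lwhisker {_ _} _ {_ _ _} _ {_ _} _.
Arguments ps_rwhisker {_ _} _ {_ _ _ _ _} _ _.

Definition ps_cell_invertible {B1 B2 : bicat} (F : psfunctor B1 B2) {x y : B1}
  {f g : mor1 x y} {a : cell f g} (Ha : is_invertible a) : is_invertible (ps_cell F a).
Proof.
  exists (ps_cell F (inv2 Ha)); rewrite <- ps_cell_vcomp, ?inv2_r, ?inv2_l;
    apply ps_cell_id2.
Defined.

Definition psfunctor_id (B : bicat) : psfunctor B B.
Proof.
  refine {| ps_ob := fun x => x; ps_mor := fun x y f => f; ps_cell := fun x y f g a => a;
    ps_id := fun x => id2 (id1 x); ps_comp := fun x y z f g => id2 (f · g) |};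
    intros; try apply id2_invertible; try reflexivity;
    rewrite ?lwhisker_id2, ?rwhisker_id2, ?id2_left, ?id2_right; reflexivity.
Defined.

Definition psfunctor_comp {B1 B2 B3 : bicat} (F : psfunctor B1 B2) (G : psfunctor B2 B3) :
  psfunctor B1 B3.
Proof.
  refine {| ps_ob := fun x => G (F x); ps_mor := fun x y f => ps_mor G (ps_mor F f);
    ps_cell := fun x y f g a => ps_cell G (ps_cell F a);
    ps_id := fun x => ps_id G (F x) • ps_cell G (ps_id F x);
    ps_comp := fun x y z f g =>
      ps_comp G (ps_mor F f) (ps_mor F g) • ps_cell G (ps_comp F f g) |}.
  - intros x. apply vcomp_invertible; [apply ps_id_invertible |].
    apply ps_cell_invertible, ps_id_invertible.
  - intros x y z f g. apply vcomp_invertible; [apply ps_comp_invertible |].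
    apply ps_cell_invertible, ps_comp_invertible.
  - intros. rewrite ps_cell_id2. apply ps_cell_id2.
  - intros. rewrite ps_cell_vcomp. apply ps_cell_vcomp.
  - intros x y f. rewrite (ps_lunitor G), (ps_lunitor F), !ps_cell_vcomp, rwhisker_vcomp.
    rewrite <- !vassoc. f_equal. rewrite !vassoc. f_equal. f_equal. apply ps_rwhisker.
  - intros x y f. rewrite (ps_runitor G), (ps_runitor F), !ps_cell_vcomp, lwhisker_vcomp.
    rewrite <- !vassoc. f_equal. rewrite !vassoc. f_equal. f_equal. apply ps_lwhisker.
  - intros w x y z f g h.
    transitivity ((ps_mor G (ps_mor F f) ◃ ps_comp G (ps_mor F g) (ps_mor F h)) •
      ps_comp G (ps_mor F f) (ps_mor F g · ps_mor F h) •
      ps_cell G ((ps_mor F f ◃ ps_comp F g h) • ps_comp F f (g · h) •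
                 ps_cell F (lassociator f g h))).
    { rewrite lwhisker_vcomp, !ps_cell_vcomp, !vassoc. f_equal. f_equal.
      rewrite <- !vassoc. f_equal. symmetry. apply ps_lwhisker. }
    rewrite ps_lassociator, !ps_cell_vcomp, !vassoc, ps_lassociator.
    rewrite rwhisker_vcomp, <- !vassoc. f_equal. f_equal.
    rewrite !vassoc. f_equal. apply ps_rwhisker.
  - intros x y z f g h a. rewrite <- vassoc, <- ps_cell_vcomp, ps_lwhisker, ps_cell_vcomp.
    rewrite !vassoc, ps_lwhisker. reflexivity.
  - intros x y z f g h a. rewrite <- vassoc, <- ps_cell_vcomp, ps_rwhisker, ps_cell_vcomp.
    rewrite !vassoc, ps_rwhisker. reflexivity.
Defined.

Record pstrans {B1 B2 : bicat} (F G : psfunctor B1 B2) : Type := {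
  pt_ob :> forall x : B1, mor1 (F x) (G x);
  pt_mor : forall {x y : B1} (f : mor1 x y),
    cell (pt_ob x · ps_mor G f) (ps_mor F f · pt_ob y);
  pt_mor_invertible : forall {x y : B1} (f : mor1 x y), is_invertible (pt_mor f);
  pt_nat : forall {x y : B1} {f g : mor1 x y} (a : cell f g),
    (pt_ob x ◃ ps_cell G a) • pt_mor g = pt_mor f • (ps_cell F a ▹ pt_ob y);
  pt_id : forall x : B1,
    (pt_ob x ◃ ps_id G x) • pt_mor (id1 x) =
    runitor (pt_ob x) • linvunitor (pt_ob x) • (ps_id F x ▹ pt_ob x);
  pt_comp : forall {x y z : B1} (f : mor1 x y) (g : mor1 y z),
    (pt_ob x ◃ ps_comp G f g) • pt_mor (f · g) =
    lassociator (pt_ob x) (ps_mor G f) (ps_mor G g) • (pt_mor f ▹ ps_mor G g) •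
    rassociator (ps_mor F f) (pt_ob y) (ps_mor G g) • (ps_mor F f ◃ pt_mor g) •
    lassociator (ps_mor F f) (ps_mor F g) (pt_ob z) • (ps_comp F f g ▹ pt_ob z)
}.
Arguments pt_ob {_ _ _ _} _ _.
Arguments pt_mor {_ _ _ _} _ {_ _} _.
Arguments pt_mor_invertible {_ _ _ _} _ {_ _} _.
Arguments pt_nat {_ _ _ _} _ {_ _ _ _} _.
Arguments pt_id {_ _ _ _} _ _.
Arguments pt_comp {_ _ _ _} _ {_ _ _} _ _.

Record modification {B1 B2 : bicat} {F G : psfunctor B1 B2} (s t : pstrans F G) : Type := {
  md_ob :> forall x : B1, cell (s x) (t x);
  md_nat : forall {x y : B1} (f : mor1 x y),
    pt_mor s f • (ps_mor F f ◃ md_ob y) = (md_ob x ▹ ps_mor G f) • pt_mor t f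
}.
Arguments md_ob {_ _ _ _ _ _} _ _.
Arguments md_nat {_ _ _ _ _ _} _ {_ _} _.

Lemma modification_eq {B1 B2 : bicat} {F G : psfunctor B1 B2} {s t : pstrans F G}
  (m n : modification s t) : (forall x, m x = n x) -> m = n.
Proof.
  destruct m as [m Hm], n as [n Hn]; cbn. intros H.
  apply functional_extensionality_dep in H. destruct H. f_equal.
  repeat (apply functional_extensionality_dep; intro). apply cell_set.
Qed.

Lemma isaset_modification {B1 B2 : bicat} {F G : psfunctor B1 B2} (s t : pstrans F G) :
  isaset (modification s t).
Proof.
  apply (isaset_inj (fun m : modification s t => md_ob m)).
  - apply isaset_forall. intros x. apply cell_set.
  - intros m n H. apply modification_eq. intros x. rewrite H. reflexivity.
Qed.

Definition pstrans_id {B1 B2 : bicat} (F : psfunctor B1 B2) : pstrans F F.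
Proof.
  refine {| pt_ob := fun x => id1 (F x);
    pt_mor := fun x y f => lunitor (ps_mor F f) • rinvunitor (ps_mor F f) |}.
  - intros x y f. apply vcomp_invertible.
    + apply lunitor_invertible.
    + exact (inv2_invertible (runitor_invertible _)).
  - intros x y f g a. strictify. reflexivity.
  - intros x. strictify. reflexivity.
  - intros x y z f g. strictify. reflexivity.
Defined.

Definition pstrans_comp {B1 B2 : bicat} {F G H : psfunctor B1 B2}
  (s : pstrans F G) (t : pstrans G H) : pstrans F H.
Proof.
  refine {| pt_ob := fun x => s x · t x;
    pt_mor := fun x y f =>
      rassociator (s x) (t x) (ps_mor H f) • (s x ◃ pt_mor t f) •
      lassociator (s x) (ps_mor G f) (t y) • (pt_mor s f ▹ t y) •
      rassociator (ps_mor F f) (s y) (t y) |}.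
  - intros x y f.
    repeat apply vcomp_invertible.
    + exact (inv2_invertible (lassociator_invertible _ _ _)).
    + apply lwhisker_invertible, pt_mor_invertible.
    + apply lassociator_invertible.
    + apply rwhisker_invertible, pt_mor_invertible.
    + exact (inv2_invertible (lassociator_invertible _ _ _)).
  - intros x y f g a. strictify.
    strict_law (pt_nat t a) (k · s x) N1.
    strict_law (pt_nat s a) k N2.
    rewrite vassoc, N1, <- vassoc, <- rwhisker_vcomp. f_equal.
    rewrite <- rwhisker_vcomp. f_equal. exact N2.
  - intros x. strictify.
    strict_law (pt_id t x) (k · s x) N1.
    strict_law (pt_id s x) k N2.
    rewrite vassoc, N1, <- rwhisker_vcomp, N2. reflexivity.
  - intros x y z f g. strictify.
    strict_law (pt_comp t f g) (k · s x) N1.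
    strict_law (pt_comp s f g) k N2.
    rewrite vassoc, N1, <- !vassoc. f_equal.
    rewrite <- rwhisker_vcomp, N2, !rwhisker_vcomp, !vassoc. f_equal. f_equal.
    symmetry.
    apply (strict_nat (EComp (EAtom (t y)) (EAtom (ps_mor H g)))
       (EComp (EAtom (ps_mor G g)) (EAtom (t z)))).
Defined.

Section PseudofunctorBicat.
  Context {B1 B2 : bicat}.

  Definition mod_id {F G : psfunctor B1 B2} (s : pstrans F G) : modification s s.
  Proof.
    refine {| md_ob := fun x => id2 (s x) |}.
    intros x y f. rewrite lwhisker_id2, rwhisker_id2, id2_left. apply id2_right.
  Defined.

  Definition mod_vcomp {F G : psfunctor B1 B2} {s t u : pstrans F G}
    (m : modification s t) (n : modification t u) : modification s u.
  Proof.
    refine {| md_ob := fun x => m x • n x |}.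
    intros x y f.
    rewrite lwhisker_vcomp, rwhisker_vcomp, vassoc, md_nat, <- vassoc, md_nat. apply vassoc.
  Defined.

  Definition mod_lwhisker {F G H : psfunctor B1 B2} (s : pstrans F G) {t u : pstrans G H}
    (m : modification t u) : modification (pstrans_comp s t) (pstrans_comp s u).
  Proof.
    refine (Build_modification _ _ _ _ (pstrans_comp s t) (pstrans_comp s u)
      (fun x => s x ◃ m x) _).
    intros x y f. cbn. strictify.
    strict_law (md_nat m f) (k · s x) N.
    rewrite (vassoc (_ ▹ ps_mor H f)), <- N, <- !vassoc. f_equal.
    apply (strict_nat (EAtom (t y)) (EAtom (u y)) (m y)).
  Defined.

  Definition mod_rwhisker {F G H : psfunctor B1 B2} {s t : pstrans F G} (u : pstrans G H)
    (m : modification s t) : modification (pstrans_comp s u) (pstrans_comp t u).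
  Proof.
    refine (Build_modification _ _ _ _ (pstrans_comp s u) (pstrans_comp t u)
      (fun x => m x ▹ u x) _).
    intros x y f. cbn. strictify.
    strict_law (md_nat m f) k N.
    rewrite <- rwhisker_vcomp, N, rwhisker_vcomp, !vassoc. f_equal.
    symmetry.
    apply (strict_nat (EComp (EAtom (u x)) (EAtom (ps_mor H f)))
      (EComp (EAtom (ps_mor G f)) (EAtom (u y)))).
  Defined.

  Definition mod_lunitor {F G : psfunctor B1 B2} (s : pstrans F G) :
    modification (pstrans_comp (pstrans_id F) s) s.
  Proof.
    refine (Build_modification _ _ _ _ (pstrans_comp (pstrans_id F) s) s
      (fun x => lunitor (s x)) _).
    intros x y f. cbn. strictify. reflexivity.
  Defined.

  Definition mod_linvunitor {F G : psfunctor B1 B2} (s : pstrans F G) :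
    modification s (pstrans_comp (pstrans_id F) s).
  Proof.
    refine (Build_modification _ _ _ _ s (pstrans_comp (pstrans_id F) s)
      (fun x => linvunitor (s x)) _).
    intros x y f. cbn. strictify. reflexivity.
  Defined.

  Definition mod_runitor {F G : psfunctor B1 B2} (s : pstrans F G) :
    modification (pstrans_comp s (pstrans_id G)) s.
  Proof.
    refine (Build_modification _ _ _ _ (pstrans_comp s (pstrans_id G)) s
      (fun x => runitor (s x)) _).
    intros x y f. cbn. strictify. reflexivity.
  Defined.

  Definition mod_rinvunitor {F G : psfunctor B1 B2} (s : pstrans F G) :
    modification s (pstrans_comp s (pstrans_id G)).
  Proof.
    refine (Build_modification _ _ _ _ s (pstrans_comp s (pstrans_id G))
      (fun x => rinvunitor (s x)) _).
    intros x y f. cbn. strictify. reflexivity.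
  Defined.

  Definition mod_lassociator {F G H K : psfunctor B1 B2}
    (s : pstrans F G) (t : pstrans G H) (u : pstrans H K) :
    modification (pstrans_comp s (pstrans_comp t u)) (pstrans_comp (pstrans_comp s t) u).
  Proof.
    refine (Build_modification _ _ _ _ (pstrans_comp s (pstrans_comp t u))
      (pstrans_comp (pstrans_comp s t) u) (fun x => lassociator (s x) (t x) (u x)) _).
    intros x y f. cbn. strictify. reflexivity.
  Defined.

  Definition mod_rassociator {F G H K : psfunctor B1 B2}
    (s : pstrans F G) (t : pstrans G H) (u : pstrans H K) :
    modification (pstrans_comp (pstrans_comp s t) u) (pstrans_comp s (pstrans_comp t u)).
  Proof.
    refine (Build_modification _ _ _ _ (pstrans_comp (pstrans_comp s t) u)
      (pstrans_comp s (pstrans_comp t u)) (fun x => rassociator (s x) (t x) (u x)) _).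
    intros x y f. cbn. strictify. reflexivity.
  Defined.
End PseudofunctorBicat.

Definition psfunctor_bicat (B1 B2 : bicat) : bicat.
Proof.
  refine {|
    bob := psfunctor B1 B2;
    mor1 := fun F G => pstrans F G;
    cell := fun F G s t => modification s t;
    id1 := fun F => pstrans_id F;
    comp1 := fun F G H s t => pstrans_comp s t;
    id2 := fun F G s => mod_id s;
    vcomp := fun F G s t u m n => mod_vcomp m n;
    lwhisker := fun F G H s t u m => mod_lwhisker s m;
    rwhisker := fun F G H s t u m => mod_rwhisker u m;
    lunitor := fun F G s => mod_lunitor s;
    linvunitor := fun F G s => mod_linvunitor s;
    runitor := fun F G s => mod_runitor s;
    rinvunitor := fun F G s => mod_rinvunitor s;
    lassociator := fun F G H K s t u => mod_lassociator s t u;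
    rassociator := fun F G H K s t u => mod_rassociator s t u
  |}; intros; try apply isaset_modification; apply modification_eq; intros; cbn.
  - apply id2_left.
  - apply id2_right.
  - apply vassoc.
  - apply lwhisker_id2.
  - apply rwhisker_id2.
  - apply lwhisker_vcomp.
  - apply rwhisker_vcomp.
  - apply vcomp_lunitor.
  - apply vcomp_runitor.
  - apply lwhisker_lwhisker.
  - apply rwhisker_lwhisker.
  - apply rwhisker_rwhisker.
  - apply vcomp_whisker.
  - apply lunitor_linvunitor.
  - apply linvunitor_lunitor.
  - apply runitor_rinvunitor.
  - apply rinvunitor_runitor.
  - apply lassociator_rassociator.
  - apply rassociator_lassociator.
  - apply triangle.
  - apply pentagon.
Defined.

Record biequivalence (B1 B2 : bicat) : Type := {
  beq_fun : psfunctor B1 B2;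
  beq_inv : psfunctor B2 B1;
  beq_unit : pstrans (psfunctor_id B2) (psfunctor_comp beq_inv beq_fun);
  beq_counit : pstrans (psfunctor_comp beq_fun beq_inv) (psfunctor_id B1);
  beq_unit_equivalence : @adjoint_equivalence (psfunctor_bicat B2 B2) _ _ beq_unit;
  beq_counit_equivalence : @adjoint_equivalence (psfunctor_bicat B1 B1) _ _ beq_counit
}.

Record finlim_cat : Type := {
  fl_cat :> category;
  fl_univalent : is_univalent fl_cat;
  fl_terminal : terminal fl_cat;
  fl_pullbacks : forall (a b c : fl_cat) (f : hom a c) (g : hom b c), pullback f g
}.

Record finlim_functor (C D : finlim_cat) : Type := {
  ff_functor :> functor C D;
  ff_terminal : preserves_terminal ff_functor;
  ff_pullbacks : preserves_pullbacks ff_functor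
}.
Arguments ff_functor {_ _} _.

Definition finlim_functor_id (C : finlim_cat) : finlim_functor C C :=
  {| ff_functor := functor_id C;
     ff_terminal := fun t Ht => Ht;
     ff_pullbacks := fun a b c p f g p1 p2 H => H |}.

Definition finlim_functor_comp {C D E : finlim_cat} (F : finlim_functor C D)
  (G : finlim_functor D E) : finlim_functor C E :=
  {| ff_functor := functor_comp F G;
     ff_terminal := fun t Ht => ff_terminal _ _ G _ (ff_terminal _ _ F _ Ht);
     ff_pullbacks := fun a b c p f g p1 p2 H =>
       ff_pullbacks _ _ G _ _ _ _ _ _ _ _ (ff_pullbacks _ _ F _ _ _ _ _ _ _ _ H) |}.

Ltac nat_law :=
  intros; cbn; repeat rewrite ?fmap_id, ?fmap_comp, ?id_left, ?id_right, <- ?assoc;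
  rewrite ?nt_nat; try reflexivity.

Definition FinLim : bicat.
Proof.
  refine {|
    bob := finlim_cat;
    mor1 := finlim_functor;
    cell := fun C D F G => nat_trans F G;
    id1 := finlim_functor_id;
    comp1 := fun C D E F G => finlim_functor_comp F G;
    id2 := fun C D F => nat_id F;
    vcomp := fun C D F G H s t => nat_comp s t;
    lwhisker := fun C D E F G H t => nat_lwhisker F t;
    rwhisker := fun C D E F G H s => nat_rwhisker s H;
    lunitor := fun C D F => nat_lunitor F;
    linvunitor := fun C D F => nat_linvunitor F;
    runitor := fun C D F => nat_runitor F;
    rinvunitor := fun C D F => nat_rinvunitor F;
    lassociator := fun C1 C2 C3 C4 F G H => nat_lassociator F G H;
    rassociator := fun C1 C2 C3 C4 F G H => nat_rassociator F G H
  |}; intros; try apply isaset_nat_trans; apply nat_trans_eq; nat_law.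
Defined.

Record comp_cat : Type := {
  cc_cat :> category;
  cc_empty : terminal cc_cat;
  cc_ty : disp_cat cc_cat;
  cc_cleaving : cleaving cc_ty;
  cc_chi : disp_functor (functor_id cc_cat) cc_ty (disp_codomain cc_cat);
  cc_chi_cartesian : is_cartesian_functor cc_chi
}.

Section CompCat.
  Context {X : comp_cat}.

  Definition ext {Γ : X} (A : cc_ty X Γ) : X := arr_dom (dfob (cc_chi X) A).

  Definition proj {Γ : X} (A : cc_ty X Γ) : hom (ext A) Γ := arr_mor (dfob (cc_chi X) A).

  Definition ext_mor {Γ Δ : X} {A : cc_ty X Γ} {B : cc_ty X Δ} {s : hom Γ Δ}
    (f : dhom (cc_ty X) A B s) : hom (ext A) (ext B) := sq_top (dfmap (cc_chi X) f).

  Lemma ext_mor_id {Γ : X} (A : cc_ty X Γ) : ext_mor (did A) = idm (ext A).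
  Proof. exact (sq_pathover_top (dfmap_id (cc_chi X) A)). Qed.

  Lemma ext_mor_comp {Γ Δ Θ : X} {A : cc_ty X Γ} {B : cc_ty X Δ} {E : cc_ty X Θ}
    {s : hom Γ Δ} {t : hom Δ Θ} (f : dhom (cc_ty X) A B s) (g : dhom (cc_ty X) B E t) :
    ext_mor (f ;;; g) = ext_mor f ;; ext_mor g.
  Proof. exact (sq_pathover_top (dfmap_comp (cc_chi X) f g)). Qed.
End CompCat.

Definition is_full (X : comp_cat) : Type :=
  forall (Γ Δ : X) (A : cc_ty X Γ) (B : cc_ty X Δ) (s : hom Γ Δ),
    isweq (fun f : dhom (cc_ty X) A B s => dfmap (cc_chi X) f).

Record is_univalent_comp_cat (X : comp_cat) : Type := {
  uc_cat : is_univalent X;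
  uc_ty : is_univalent_disp (cc_ty X)
}.

Definition weakening {X : comp_cat} {Γ : X} (A : cc_ty X Γ) :
  functor (fiber (cc_ty X) Γ) (fiber (cc_ty X) (ext A)) :=
  subst_functor (cc_cleaving X) (proj A).

(* Left adjoints are given along projections only, so the Beck-Chevalley condition
   ranges over all pullback squares whose vertical sides are projections; [A] need
   not be the chosen substitution of [B]. *)
Record strong_sigma (X : comp_cat) : Type := {
  sg_adj : forall (Γ : X) (A : cc_ty X Γ), left_adjoint (weakening A);
  sg_beck_chevalley : forall (Γ Δ : X) (A : cc_ty X Γ) (B : cc_ty X Δ)
    (s : hom Γ Δ) (t : hom (ext A) (ext B)) (e : t ;; proj B = proj A ;; s),
    is_pullback (proj B) s t (proj A) ->
    forall E : fiber (cc_ty X) (ext B),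
      is_iso (beck_chevalley_mor (cc_cleaving X) e (sg_adj Γ A) (sg_adj Δ B) E);
  sg_strong : forall (Γ : X) (A : cc_ty X Γ) (B : fiber (cc_ty X) (ext A)),
    is_iso (ext_mor (ladj_unit (sg_adj Γ A) B : dhom (cc_ty X) _ _ (idm (ext A))) ;;
            ext_mor (lift (cc_cleaving X) (proj A) (sg_adj Γ A B)))
}.

Record democracy (X : comp_cat) : Type := {
  dem_ty : forall Γ : X, cc_ty X (cc_empty X);
  dem_iso : forall Γ : X, iso Γ (ext (dem_ty Γ))
}.

Record dfl_comp_cat : Type := {
  dfl_cc :> comp_cat;
  dfl_full : is_full dfl_cc;
  dfl_univalent : is_univalent_comp_cat dfl_cc;
  dfl_unit : forall Γ : dfl_cc, terminal (fiber (cc_ty dfl_cc) Γ);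
  dfl_prod : forall (Γ : dfl_cc) (A B : fiber (cc_ty dfl_cc) Γ), bin_product A B;
  dfl_eq : forall (Γ : dfl_cc) (A B : fiber (cc_ty dfl_cc) Γ) (f g : hom A B),
    equalizer f g;
  dfl_subst_unit : forall (Γ Δ : dfl_cc) (s : hom Γ Δ),
    preserves_terminal (subst_functor (cc_cleaving dfl_cc) s);
  dfl_subst_prod : forall (Γ Δ : dfl_cc) (s : hom Γ Δ),
    preserves_bin_products (subst_functor (cc_cleaving dfl_cc) s);
  dfl_subst_eq : forall (Γ Δ : dfl_cc) (s : hom Γ Δ),
    preserves_equalizers (subst_functor (cc_cleaving dfl_cc) s);
  dfl_unit_iso : forall Γ : dfl_cc,
    is_iso (proj (Γ := Γ) (term_ob (dfl_unit Γ)));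
  dfl_sigma : strong_sigma dfl_cc;
  dfl_democracy : democracy dfl_cc
}.

(* The identity, from [F] preceded by the identity functor to [F] followed by
   the identity functor. *)
Definition nat_unit_swap {C D : category} (F : functor C D) :
  nat_trans (functor_comp (functor_id C) F) (functor_comp F (functor_id D)).
Proof.
  refine {| nt_ob := fun x =>
    idm (F x) : hom (functor_comp (functor_id C) F x) (functor_comp F (functor_id D) x) |}.
  nat_unit.
Defined.

Definition nat_unit_swap_iso {C D : category} (F : functor C D) (x : C) :
  is_iso (nat_unit_swap F x) := id_is_iso (F x).

Definition is_disp_nat_iso {C C' : category} {F G : functor C C'} {s : nat_trans F G}
  (Hs : forall x, is_iso (s x)) {D : disp_cat C} {D' : disp_cat C'}
  {FF : disp_functor F D D'} {GG : disp_functor G D D'} (ss : disp_nat_trans s FF GG) : Type :=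
  forall (x : C) (xx : D x), is_disp_iso (Build_iso (s x) (Hs x)) (dnt_ob ss xx).

Record dfl_functor (X Y : dfl_comp_cat) : Type := {
  df_functor :> functor X Y;
  df_terminal : preserves_terminal df_functor;
  df_ty : disp_functor df_functor (cc_ty X) (cc_ty Y);
  df_cartesian : is_cartesian_functor df_ty;
  df_unit : forall Γ : X, preserves_terminal (fiber_functor df_ty Γ);
  df_prod : forall Γ : X, preserves_bin_products (fiber_functor df_ty Γ);
  df_eq : forall Γ : X, preserves_equalizers (fiber_functor df_ty Γ);
  df_chi : disp_nat_trans (nat_unit_swap df_functor)
    (disp_functor_comp (cc_chi X) (codomain_functor df_functor))
    (disp_functor_comp df_ty (cc_chi Y));
  df_chi_iso : is_disp_nat_iso (nat_unit_swap_iso df_functor) df_chi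
}.
Arguments df_functor {_ _} _.
Arguments df_terminal {_ _} _.
Arguments df_ty {_ _} _.
Arguments df_cartesian {_ _} _.
Arguments df_unit {_ _} _.
Arguments df_prod {_ _} _.
Arguments df_eq {_ _} _.
Arguments df_chi {_ _} _.
Arguments df_chi_iso {_ _} _.

Definition df_ext {X Y : dfl_comp_cat} (F : dfl_functor X Y) {Γ : X} (A : cc_ty X Γ) :
  hom (F (ext A)) (ext (dfob (df_ty F) A)) := sq_top (dnt_ob (df_chi F) A).

Lemma df_ext_proj {X Y : dfl_comp_cat} (F : dfl_functor X Y) {Γ : X} (A : cc_ty X Γ) :
  df_ext F A ;; proj (dfob (df_ty F) A) = fmap F (proj A).
Proof.
  transitivity (fmap F (proj A) ;; idm (F Γ)).
  - exact (proj2_sig (dnt_ob (df_chi F) A)).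
  - apply id_right.
Qed.

Lemma df_ext_nat {X Y : dfl_comp_cat} (F : dfl_functor X Y) {Γ Δ : X}
  {A : cc_ty X Γ} {B : cc_ty X Δ} {s : hom Γ Δ} (f : dhom (cc_ty X) A B s) :
  fmap F (ext_mor f) ;; df_ext F B = df_ext F A ;; ext_mor (dfmap (df_ty F) f).
Proof. exact (sq_pathover_top (dnt_nat (df_chi F) f)). Qed.

Definition sq_disp_iso {C : category} {x : C} {a b : arr x} (t : sq a b (idm x)) :
  is_iso (sq_top t) ->
  is_disp_iso (D := disp_codomain C) (xx := a) (yy := b) (Build_iso (idm x) (id_is_iso x)) t.
Proof.
  intros H.
  assert (e : inv H ;; a = b ;; idm x).
  { rewrite id_right, <- (id_left b), <- (inv_l H), <- assoc. f_equal.
    rewrite <- (id_right a). symmetry. exact (proj2_sig t). }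
  exists (exist _ (inv H) e : dhom (disp_codomain C) b a (iso_inv (Build_iso (idm x) (id_is_iso x)))).
  - apply sq_pathover. apply inv_r.
  - apply sq_pathover. apply inv_l.
Defined.

Definition df_ext_iso {X Y : dfl_comp_cat} (F : dfl_functor X Y) {Γ : X} (A : cc_ty X Γ) :
  is_iso (df_ext F A).
Proof.
  destruct (df_chi_iso F Γ A) as [g Hr Hl].
  exists (sq_top g).
  - exact (sq_pathover_top Hr).
  - exact (sq_pathover_top Hl).
Defined.

Definition make_df_chi {X Y : comp_cat} {F : functor X Y}
  (FF : disp_functor F (cc_ty X) (cc_ty Y))
  (t : forall (Γ : X) (A : cc_ty X Γ), hom (F (ext A)) (ext (dfob FF A)))
  (Hp : forall (Γ : X) (A : cc_ty X Γ), t Γ A ;; proj (dfob FF A) = fmap F (proj A))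
  (Hn : forall (Γ Δ : X) (A : cc_ty X Γ) (B : cc_ty X Δ) (s : hom Γ Δ)
    (f : dhom (cc_ty X) A B s),
    fmap F (ext_mor f) ;; t Δ B = t Γ A ;; ext_mor (dfmap FF f)) :
  disp_nat_trans (nat_unit_swap F)
    (disp_functor_comp (cc_chi X) (codomain_functor F))
    (disp_functor_comp FF (cc_chi Y)).
Proof.
  unshelve refine (Build_disp_nat_trans _ _ _ _ (nat_unit_swap F) _ _
    (disp_functor_comp (cc_chi X) (codomain_functor F))
    (disp_functor_comp FF (cc_chi Y))
    (fun Γ A => exist _ (t Γ A) _) _).
  - cbn. rewrite id_right. apply Hp.
  - intros Γ Δ A B s f. apply sq_pathover. apply Hn.
Defined.

Definition dfl_functor_id (X : dfl_comp_cat) : dfl_functor X X.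
Proof.
  unshelve refine {|
    df_functor := functor_id X;
    df_ty := disp_functor_id (cc_ty X);
    df_chi := make_df_chi (disp_functor_id (cc_ty X)) (fun Γ A => idm (ext A)) _ _
  |}.
  - intros. apply id_left.
  - intros. cbn. rewrite id_left. apply id_right.
  - intros t Ht. exact Ht.
  - intros x y xx yy f ff H. exact H.
  - intros Γ t Ht. exact Ht.
  - intros Γ a b p p1 p2 H. exact H.
  - intros Γ a b e f g i H. exact H.
  - intros Γ A. apply sq_disp_iso. apply id_is_iso.
Defined.

Lemma fiber_functor_comp_mor {C1 C2 C3 : category} {F : functor C1 C2} {G : functor C2 C3}
  {D1 : disp_cat C1} {D2 : disp_cat C2} {D3 : disp_cat C3}
  (FF : disp_functor F D1 D2) (GG : disp_functor G D2 D3) {x : C1} {a b : fiber D1 x}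
  (f : hom a b) :
  fmap (fiber_functor (disp_functor_comp FF GG) x) f =
  fmap (fiber_functor GG (F x)) (fmap (fiber_functor FF x) f).
Proof.
  apply tot_inj. cbn -[tot]. rewrite !tot_transport, !tot_map, tot_transport. reflexivity.
Qed.

Definition dfl_functor_comp {X Y Z : dfl_comp_cat} (F : dfl_functor X Y)
  (G : dfl_functor Y Z) : dfl_functor X Z.
Proof.
  unshelve refine {|
    df_functor := functor_comp F G;
    df_ty := disp_functor_comp (df_ty F) (df_ty G);
    df_chi := make_df_chi (disp_functor_comp (df_ty F) (df_ty G))
      (fun Γ A => fmap G (df_ext F A) ;; df_ext G (dfob (df_ty F) A)) _ _
  |}.
  - intros Γ A.
    change (fmap G (df_ext F A) ;; df_ext G (dfob (df_ty F) A) ;;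
      proj (dfob (df_ty G) (dfob (df_ty F) A)) = fmap G (fmap F (proj A))).
    rewrite <- assoc, df_ext_proj, <- fmap_comp, df_ext_proj. reflexivity.
  - intros Γ Δ A B s f. cbn.
    rewrite assoc, <- fmap_comp, df_ext_nat, fmap_comp, <- !assoc, df_ext_nat. reflexivity.
  - intros t Ht. apply (df_terminal G), (df_terminal F), Ht.
  - intros x y xx yy f ff H. apply (df_cartesian G), (df_cartesian F), H.
  - intros Γ t Ht. apply (df_unit G), (df_unit F), Ht.
  - intros Γ a b p p1 p2 H. rewrite !fiber_functor_comp_mor.
    apply (df_prod G), (df_prod F), H.
  - intros Γ a b e f g i H. rewrite !fiber_functor_comp_mor.
    apply (df_eq G), (df_eq F), H.
  - intros Γ A. apply sq_disp_iso.
    exact (comp_is_iso (fmap_is_iso G (df_ext_iso F A)) (df_ext_iso G (dfob (df_ty F) A))).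
Defined.

Record dfl_cell {X Y : dfl_comp_cat} (F G : dfl_functor X Y) : Type := {
  dc_nat :> nat_trans F G;
  dc_ty : disp_nat_trans dc_nat (df_ty F) (df_ty G);
  dc_chi : forall (Γ : X) (A : cc_ty X Γ),
    df_ext F A ;; ext_mor (dnt_ob dc_ty A) = dc_nat (ext A) ;; df_ext G A
}.
Arguments dc_nat {_ _ _ _} _.
Arguments dc_ty {_ _ _ _} _.
Arguments dc_chi {_ _ _ _} _ {_} _.

Lemma dfl_cell_eq {X Y : dfl_comp_cat} {F G : dfl_functor X Y} (s t : dfl_cell F G) :
  (forall Γ, s Γ = t Γ) ->
  (forall Γ (A : cc_ty X Γ), tnt (dc_ty s) A = tnt (dc_ty t) A) -> s = t.
Proof.
  destruct s as [s ss Hs], t as [t tt Ht]; cbn. intros H1 H2.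
  apply nat_trans_eq in H1. destruct H1.
  assert (e : ss = tt).
  { apply disp_nat_trans_eq. intros x xx. apply tot_inj. apply H2. }
  destruct e. f_equal.
  repeat (apply functional_extensionality_dep; intro). apply hom_set.
Qed.

Lemma isaset_dfl_cell {X Y : dfl_comp_cat} (F G : dfl_functor X Y) : isaset (dfl_cell F G).
Proof.
  apply (isaset_inj (fun s : dfl_cell F G =>
    (nt_ob s, fun Γ (A : cc_ty X Γ) => tnt (dc_ty s) A))).
  - apply isaset_prod; repeat (apply isaset_forall; intro); [apply hom_set |].
    apply isaset_thom.
  - intros s t H. apply dfl_cell_eq.
    + intros Γ. exact (f_equal (fun u => fst u Γ) H).
    + intros Γ A. exact (f_equal (fun u => snd u Γ A) H).
Qed.

Definition dfl_cell_id {X Y : dfl_comp_cat} (F : dfl_functor X Y) : dfl_cell F F.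
Proof.
  unshelve refine {| dc_nat := nat_id F;
    dc_ty := Build_disp_nat_trans _ _ _ _ (nat_id F) _ _ _ _
      (fun Γ A => did (dfob (df_ty F) A)) _ |}.
  - intros Γ Δ A B s f. apply pathover_of_tot.
    change (tc (tmap (df_ty F) (tot f)) (ti (dfob (df_ty F) B)) =
      tc (ti (dfob (df_ty F) A)) (tmap (df_ty F) (tot f))).
    rewrite tc_id_right, tc_id_left. reflexivity.
  - intros Γ A. cbn. rewrite ext_mor_id, id_left. apply id_right.
Defined.

Definition dfl_cell_comp {X Y : dfl_comp_cat} {F G H : dfl_functor X Y}
  (s : dfl_cell F G) (t : dfl_cell G H) : dfl_cell F H.
Proof.
  unshelve refine {| dc_nat := nat_comp s t;
    dc_ty := Build_disp_nat_trans _ _ _ _ (nat_comp s t) _ _ _ _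
      (fun Γ A => dnt_ob (dc_ty s) A ;;; dnt_ob (dc_ty t) A) _ |}.
  - intros Γ Δ A B u f. apply pathover_of_tot.
    change (tc (tmap (df_ty F) (tot f)) (tc (tnt (dc_ty s) B) (tnt (dc_ty t) B)) =
      tc (tc (tnt (dc_ty s) A) (tnt (dc_ty t) A)) (tmap (df_ty H) (tot f))).
    rewrite tc_assoc, tnt_nat, <- tc_assoc, tnt_nat. apply tc_assoc.
  - intros Γ A. cbn.
    rewrite ext_mor_comp, assoc, dc_chi, <- assoc, dc_chi. apply assoc.
Defined.

Definition dfl_lwhisker {X Y Z : dfl_comp_cat} (F : dfl_functor X Y)
  {G H : dfl_functor Y Z} (t : dfl_cell G H) :
  dfl_cell (dfl_functor_comp F G) (dfl_functor_comp F H).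
Proof.
  unshelve refine (Build_dfl_cell _ _ (dfl_functor_comp F G) (dfl_functor_comp F H)
    (nat_lwhisker F t)
    (Build_disp_nat_trans _ _ _ _ (nat_lwhisker F t) _ _
      (df_ty (dfl_functor_comp F G)) (df_ty (dfl_functor_comp F H))
      (fun Γ A => dnt_ob (dc_ty t) (dfob (df_ty F) A)) _) _).
  - intros Γ Δ A B u f. exact (dnt_nat (dc_ty t) (dfmap (df_ty F) f)).
  - intros Γ A. cbn. change (df_ext (dfl_functor_comp F ?K) A) with
      (fmap K (df_ext F A) ;; df_ext K (dfob (df_ty F) A)).
    rewrite <- assoc, dc_chi, !assoc, nt_nat. reflexivity.
Defined.

Definition dfl_rwhisker {X Y Z : dfl_comp_cat} {F G : dfl_functor X Y}
  (H : dfl_functor Y Z) (s : dfl_cell F G) :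
  dfl_cell (dfl_functor_comp F H) (dfl_functor_comp G H).
Proof.
  unshelve refine (Build_dfl_cell _ _ (dfl_functor_comp F H) (dfl_functor_comp G H)
    (nat_rwhisker s H)
    (Build_disp_nat_trans _ _ _ _ (nat_rwhisker s H) _ _
      (df_ty (dfl_functor_comp F H)) (df_ty (dfl_functor_comp G H))
      (fun Γ A => dfmap (df_ty H) (dnt_ob (dc_ty s) A)) _) _).
  - intros Γ Δ A B u f. apply pathover_of_tot.
    change (tc (tmap (df_ty H) (tmap (df_ty F) (tot f))) (tmap (df_ty H) (tnt (dc_ty s) B)) =
      tc (tmap (df_ty H) (tnt (dc_ty s) A)) (tmap (df_ty H) (tmap (df_ty G) (tot f)))).
    rewrite <- !tmap_comp, tnt_nat. reflexivity.
  - intros Γ A. cbn. change (df_ext (dfl_functor_comp ?K H) A) with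
      (fmap H (df_ext K A) ;; df_ext H (dfob (df_ty K) A)).
    rewrite <- assoc, <- df_ext_nat, !assoc, <- !fmap_comp, dc_chi. reflexivity.
Defined.

Definition make_dfl_cell {X Y : dfl_comp_cat} (F G : dfl_functor X Y) (s : nat_trans F G)
  (ss : forall (Γ : X) (A : cc_ty X Γ), dhom (cc_ty Y) (dfob (df_ty F) A) (dfob (df_ty G) A) (s Γ))
  (Hn : forall (Γ Δ : X) (A : cc_ty X Γ) (B : cc_ty X Δ) (f : thom A B),
    tc (tmap (df_ty F) f) (tot (ss Δ B)) = tc (tot (ss Γ A)) (tmap (df_ty G) f))
  (Hc : forall (Γ : X) (A : cc_ty X Γ),
    df_ext F A ;; ext_mor (ss Γ A) = s (ext A) ;; df_ext G A) : dfl_cell F G.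
Proof.
  unshelve refine {| dc_nat := s; dc_ty := Build_disp_nat_trans _ _ _ _ s _ _ _ _ ss _ |}.
  - intros Γ Δ A B u f. apply pathover_of_tot. apply (Hn _ _ _ _ (tot f)).
  - exact Hc.
Defined.

Ltac dfl_unit_law :=
  cbn; rewrite id_left; unfold df_ext; cbn;
  rewrite ?fmap_id, ?fmap_comp, ?id_left, ?id_right, ?assoc; reflexivity.

Definition dfl_lunitor {X Y : dfl_comp_cat} (F : dfl_functor X Y) :
  dfl_cell (dfl_functor_comp (dfl_functor_id X) F) F.
Proof.
  refine (make_dfl_cell (dfl_functor_comp (dfl_functor_id X) F) F
    (nat_lunitor F) (fun Γ A => did (dfob (df_ty F) A)) _ _).
  - intros Γ Δ A B f.
    change (tc (tmap (df_ty F) f) (ti (dfob (df_ty F) B)) =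
      tc (ti (dfob (df_ty F) A)) (tmap (df_ty F) f)).
    rewrite tc_id_right, tc_id_left. reflexivity.
  - intros Γ A.
    transitivity (df_ext (dfl_functor_comp (dfl_functor_id X) F) A ;; idm (ext (dfob (df_ty F) A))).
    { exact (f_equal (comp _) (ext_mor_id (dfob (df_ty F) A))). }
    rewrite id_right. symmetry. dfl_unit_law.
Defined.

Definition dfl_linvunitor {X Y : dfl_comp_cat} (F : dfl_functor X Y) :
  dfl_cell F (dfl_functor_comp (dfl_functor_id X) F).
Proof.
  refine (make_dfl_cell F (dfl_functor_comp (dfl_functor_id X) F)
    (nat_linvunitor F) (fun Γ A => did (dfob (df_ty F) A)) _ _).
  - intros Γ Δ A B f.
    change (tc (tmap (df_ty F) f) (ti (dfob (df_ty F) B)) =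
      tc (ti (dfob (df_ty F) A)) (tmap (df_ty F) f)).
    rewrite tc_id_right, tc_id_left. reflexivity.
  - intros Γ A.
    transitivity (df_ext F A ;; idm (ext (dfob (df_ty F) A))).
    { exact (f_equal (comp _) (ext_mor_id (dfob (df_ty F) A))). }
    rewrite id_right. symmetry. dfl_unit_law.
Defined.

Definition dfl_runitor {X Y : dfl_comp_cat} (F : dfl_functor X Y) :
  dfl_cell (dfl_functor_comp F (dfl_functor_id Y)) F.
Proof.
  refine (make_dfl_cell (dfl_functor_comp F (dfl_functor_id Y)) F
    (nat_runitor F) (fun Γ A => did (dfob (df_ty F) A)) _ _).
  - intros Γ Δ A B f.
    change (tc (tmap (df_ty F) f) (ti (dfob (df_ty F) B)) =
      tc (ti (dfob (df_ty F) A)) (tmap (df_ty F) f)).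
    rewrite tc_id_right, tc_id_left. reflexivity.
  - intros Γ A.
    transitivity (df_ext (dfl_functor_comp F (dfl_functor_id Y)) A ;; idm (ext (dfob (df_ty F) A))).
    { exact (f_equal (comp _) (ext_mor_id (dfob (df_ty F) A))). }
    rewrite id_right. symmetry. dfl_unit_law.
Defined.

Definition dfl_rinvunitor {X Y : dfl_comp_cat} (F : dfl_functor X Y) :
  dfl_cell F (dfl_functor_comp F (dfl_functor_id Y)).
Proof.
  refine (make_dfl_cell F (dfl_functor_comp F (dfl_functor_id Y))
    (nat_rinvunitor F) (fun Γ A => did (dfob (df_ty F) A)) _ _).
  - intros Γ Δ A B f.
    change (tc (tmap (df_ty F) f) (ti (dfob (df_ty F) B)) =
      tc (ti (dfob (df_ty F) A)) (tmap (df_ty F) f)).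
    rewrite tc_id_right, tc_id_left. reflexivity.
  - intros Γ A.
    transitivity (df_ext F A ;; idm (ext (dfob (df_ty F) A))).
    { exact (f_equal (comp _) (ext_mor_id (dfob (df_ty F) A))). }
    rewrite id_right. symmetry. dfl_unit_law.
Defined.

Definition dfl_lassociator {X1 X2 X3 X4 : dfl_comp_cat} (F : dfl_functor X1 X2)
  (G : dfl_functor X2 X3) (H : dfl_functor X3 X4) :
  dfl_cell (dfl_functor_comp F (dfl_functor_comp G H)) (dfl_functor_comp (dfl_functor_comp F G) H).
Proof.
  refine (make_dfl_cell (dfl_functor_comp F (dfl_functor_comp G H)) (dfl_functor_comp (dfl_functor_comp F G) H)
    (nat_lassociator F G H) (fun Γ A => did (dfob (df_ty H) (dfob (df_ty G) (dfob (df_ty F) A)))) _ _).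
  - intros Γ Δ A B f.
    change (tc (tmap (df_ty H) (tmap (df_ty G) (tmap (df_ty F) f))) (ti (dfob (df_ty H) (dfob (df_ty G) (dfob (df_ty F) B)))) =
      tc (ti (dfob (df_ty H) (dfob (df_ty G) (dfob (df_ty F) A)))) (tmap (df_ty H) (tmap (df_ty G) (tmap (df_ty F) f)))).
    rewrite tc_id_right, tc_id_left. reflexivity.
  - intros Γ A.
    transitivity (df_ext (dfl_functor_comp F (dfl_functor_comp G H)) A ;; idm (ext (dfob (df_ty H) (dfob (df_ty G) (dfob (df_ty F) A))))).
    { exact (f_equal (comp _) (ext_mor_id (dfob (df_ty H) (dfob (df_ty G) (dfob (df_ty F) A))))). }
    rewrite id_right. symmetry. dfl_unit_law.
Defined.

Definition dfl_rassociator {X1 X2 X3 X4 : dfl_comp_cat} (F : dfl_functor X1 X2)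
  (G : dfl_functor X2 X3) (H : dfl_functor X3 X4) :
  dfl_cell (dfl_functor_comp (dfl_functor_comp F G) H) (dfl_functor_comp F (dfl_functor_comp G H)).
Proof.
  refine (make_dfl_cell (dfl_functor_comp (dfl_functor_comp F G) H) (dfl_functor_comp F (dfl_functor_comp G H))
    (nat_rassociator F G H) (fun Γ A => did (dfob (df_ty H) (dfob (df_ty G) (dfob (df_ty F) A)))) _ _).
  - intros Γ Δ A B f.
    change (tc (tmap (df_ty H) (tmap (df_ty G) (tmap (df_ty F) f))) (ti (dfob (df_ty H) (dfob (df_ty G) (dfob (df_ty F) B)))) =
      tc (ti (dfob (df_ty H) (dfob (df_ty G) (dfob (df_ty F) A)))) (tmap (df_ty H) (tmap (df_ty G) (tmap (df_ty F) f)))).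
    rewrite tc_id_right, tc_id_left. reflexivity.
  - intros Γ A.
    transitivity (df_ext (dfl_functor_comp (dfl_functor_comp F G) H) A ;; idm (ext (dfob (df_ty H) (dfob (df_ty G) (dfob (df_ty F) A))))).
    { exact (f_equal (comp _) (ext_mor_id (dfob (df_ty H) (dfob (df_ty G) (dfob (df_ty F) A))))). }
    rewrite id_right. symmetry. dfl_unit_law.
Defined.

Ltac dfl_law :=
  intros; apply dfl_cell_eq;
  [ nat_law
  | intros; unfold tnt; cbn -[tot]; repeat rewrite ?tot_comp, ?tot_map, ?tot_id;
    repeat rewrite ?tmap_id, ?tmap_comp, ?tc_id_left, ?tc_id_right, <- ?tc_assoc;
    rewrite ?tot_nt, ?tnt_nat; try reflexivity ].

Definition DFLCompCat : bicat.
Proof.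
  refine {|
    bob := dfl_comp_cat;
    mor1 := dfl_functor;
    cell := fun X Y F G => dfl_cell F G;
    id1 := dfl_functor_id;
    comp1 := fun X Y Z F G => dfl_functor_comp F G;
    id2 := fun X Y F => dfl_cell_id F;
    vcomp := fun X Y F G H s t => dfl_cell_comp s t;
    lwhisker := fun X Y Z F G H t => dfl_lwhisker F t;
    rwhisker := fun X Y Z F G H s => dfl_rwhisker H s;
    lunitor := fun X Y F => dfl_lunitor F;
    linvunitor := fun X Y F => dfl_linvunitor F;
    runitor := fun X Y F => dfl_runitor F;
    rinvunitor := fun X Y F => dfl_rinvunitor F;
    lassociator := fun X1 X2 X3 X4 F G H => dfl_lassociator F G H;
    rassociator := fun X1 X2 X3 X4 F G H => dfl_rassociator F G H
  |}; try (intros; apply isaset_dfl_cell); dfl_law.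
Defined.

(* Main.v *)
Require Import Defs.

(** A DFL comprehension category is, up to equivalence, the codomain fibration of
    its category of contexts, and that category has finite limits.

    Forgetting the types gives a pseudofunctor [forget_types] to [FinLim]. It is
    defined because every arrow [f] into [Γ] is isomorphic, over [Γ], to the
    projection of a type ([every_arrow_type]). By democracy the two ends of [f] are
    extensions of the empty context by closed types; weakened to [Γ], these give
    types [B] and [B'] and two maps from [B] to [B'] over [Γ], namely [y |-> f y] and
    the constant map at the given point of [Γ]. The equalizer of these maps is the
    type of all [y] with [f y] equal to that point. To see that its extension is the
    domain of [f] one needs that comprehension sends equalizers of types to
    equalizers of contexts ([ext_equalizer]): as the unit type has an invertible
    projection, maps from [Z] into [Γ.A] over [Γ] are global elements of a
    substituted type over [Z], and substitution preserves equalizers. Pullbacks of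
    projections exist by substitution, so pullbacks of all arrows exist
    ([dfl_pullbacks]); in the same way, a pullback square of contexts is a Cartesian
    morphism of types up to isomorphism, so 1-cells preserve it
    ([dfl_functor_pullbacks]).

    In the other direction, [codomain_psfunctor] sends a category with finite limits
    to its codomain fibration. Substitution there is right adjoint to
    postcomposition, which yields both the dependent sums and the preservation of
    limits by substitution; the Beck-Chevalley condition is the pasting of pullbacks.

    Starting from finite limits, the round trip returns the same category. Starting
    from a DFL comprehension category [X], it returns the codomain fibration of [X],
    and comprehension itself is a 1-cell [chi_dfl_functor] from [X] to it. This 1-cell
    is fully faithful and, by [every_arrow_type], essentially surjective on each
    fiber; a choice of types gives the inverse [psi_dfl_functor].

    What remains is coherence, and there is almost none: by fullness a 2-cell of DFL
    comprehension categories is determined by its natural transformation of contexts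
    ([dfl_cell_ext]), and every such transformation underlies a 2-cell
    ([dfl_cell_of_nat]). All structural 2-cells have identity components on
    contexts, so every coherence law is an equation between composites of
    identities. *)

(** * Isomorphisms, equalizers and pullbacks *)

Lemma is_iso_cancel_l {C : category} {x y z : C} {i : hom x y} (Hi : is_iso i)
  {f g : hom y z} : i ;; f = i ;; g -> f = g.
Proof.
  intros e. rewrite <- (id_left f), <- (id_left g), <- (inv_l Hi), <- !assoc, e. reflexivity.
Qed.

Lemma is_iso_cancel_r {C : category} {x y z : C} {i : hom y z} (Hi : is_iso i)
  {f g : hom x y} : f ;; i = g ;; i -> f = g.
Proof.
  intros e. rewrite <- (id_right f), <- (id_right g), <- (inv_r Hi), !assoc, e. reflexivity.
Qed.

Definition inv_is_iso {C : category} {x y : C} {i : hom x y} (Hi : is_iso i) :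
  is_iso (inv Hi) := {| inv := i; inv_r := inv_l Hi; inv_l := inv_r Hi |}.

Lemma terminal_unique {C : category} {t : C} (Ht : is_terminal t) {x : C}
  (f g : hom x t) : f = g.
Proof. destruct (Ht x) as [h Hh]. rewrite (Hh f). symmetry. apply Hh. Qed.

Lemma equalizer_mono {C : category} {a b e : C} {f g : hom a b} {i : hom e a}
  (H : is_equalizer f g i) {x : C} (k l : hom x e) : k ;; i = l ;; i -> k = l.
Proof.
  intros E. destruct H as [Hc H].
  destruct (H x (l ;; i)) as [m [_ Hm]].
  { rewrite <- !assoc, Hc. reflexivity. }
  rewrite <- (Hm k E). apply Hm. reflexivity.
Qed.

Lemma pullback_unique {C : category} {a b c p : C} {f : hom a c} {g : hom b c}
  {p1 : hom p a} {p2 : hom p b} (H : is_pullback f g p1 p2) {x : C} (u v : hom x p) :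
  u ;; p1 = v ;; p1 -> u ;; p2 = v ;; p2 -> u = v.
Proof.
  intros E1 E2. destruct H as [Hc H].
  destruct (H x (v ;; p1) (v ;; p2)) as [m [_ Hm]].
  { rewrite <- !assoc, Hc. reflexivity. }
  rewrite <- (Hm u (conj E1 E2)). apply Hm. split; reflexivity.
Qed.

Section PullbackPair.
  Context {C : category} {a b c p : C} {f : hom a c} {g : hom b c}
    {p1 : hom p a} {p2 : hom p b} (H : is_pullback f g p1 p2).

  Definition pb_pair {x : C} (h : hom x a) (k : hom x b) (e : h ;; f = k ;; g) : hom x p :=
    proj1_sig (snd H x h k e).

  Lemma pb_pair_fst {x : C} (h : hom x a) (k : hom x b) (e : h ;; f = k ;; g) :
    pb_pair h k e ;; p1 = h.
  Proof. exact (proj1 (proj1 (proj2_sig (snd H x h k e)))). Qed.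

  Lemma pb_pair_snd {x : C} (h : hom x a) (k : hom x b) (e : h ;; f = k ;; g) :
    pb_pair h k e ;; p2 = k.
  Proof. exact (proj2 (proj1 (proj2_sig (snd H x h k e)))). Qed.
End PullbackPair.

Definition make_pullback {C : category} {a b c p : C} {f : hom a c} {g : hom b c}
  {p1 : hom p a} {p2 : hom p b} (e : p1 ;; f = p2 ;; g)
  (ex : forall (x : C) (h : hom x a) (k : hom x b), h ;; f = k ;; g ->
    { u : hom x p | u ;; p1 = h /\ u ;; p2 = k })
  (un : forall (x : C) (u v : hom x p), u ;; p1 = v ;; p1 -> u ;; p2 = v ;; p2 -> u = v) :
  is_pullback f g p1 p2.
Proof.
  split; [exact e |]. intros x h k E. destruct (ex x h k E) as [u [Hu1 Hu2]].
  exists u. split; [split; assumption |]. intros v [Hv1 Hv2].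
  apply un; congruence.
Qed.

(** With this lemma projections of types stand in for arbitrary arrows, to which they
    are isomorphic over the base. *)
Lemma pullback_iso {C : category} {a a' b c p p' : C} {f : hom a c} {f' : hom a' c}
  {g : hom b c} {p1 : hom p a} {p2 : hom p b} {p1' : hom p' a'} {p2' : hom p' b}
  {i : hom a a'} {j : hom p p'} (Hi : is_iso i) (Hj : is_iso j) :
  i ;; f' = f -> j ;; p1' = p1 ;; i -> j ;; p2' = p2 ->
  is_pullback f g p1 p2 -> is_pullback f' g p1' p2'.
Proof.
  intros E1 E2 E3 H. apply make_pullback.
  - apply (is_iso_cancel_l Hj). rewrite !assoc, E2, E3, <- assoc, E1. exact (fst H).
  - intros x h k E.
    assert (E' : h ;; inv Hi ;; f = k ;; g).
    { rewrite <- E1, <- assoc, (assoc (inv Hi)), inv_l, id_left. exact E. }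
    exists (pb_pair H _ _ E' ;; j). split; rewrite <- assoc.
    + rewrite E2, assoc, pb_pair_fst, <- assoc, inv_l. apply id_right.
    + rewrite E3. apply pb_pair_snd.
  - intros x u v Eu Ev. apply (is_iso_cancel_r (inv_is_iso Hj)).
    apply (pullback_unique H).
    + apply (is_iso_cancel_r Hi). rewrite <- !assoc, <- E2, !(assoc (inv Hj)), inv_l, id_left.
      exact Eu.
    + rewrite <- !assoc, <- E3, !(assoc (inv Hj)), inv_l, id_left. exact Ev.
Qed.

Definition pullback_comparison_iso {C : category} {a b c p q : C} {f : hom a c} {g : hom b c}
  {p1 : hom p a} {p2 : hom p b} {q1 : hom q a} {q2 : hom q b}
  (Hp : is_pullback f g p1 p2) (Hq : is_pullback f g q1 q2) {u : hom p q} :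
  u ;; q1 = p1 -> u ;; q2 = p2 -> is_iso u.
Proof.
  intros E1 E2. exists (pb_pair Hp q1 q2 (fst Hq)).
  - apply (pullback_unique Hp); rewrite <- assoc, ?pb_pair_fst, ?pb_pair_snd, id_left; assumption.
  - apply (pullback_unique Hq); rewrite <- assoc, ?E1, ?E2, ?pb_pair_fst, ?pb_pair_snd, id_left;
      reflexivity.
Defined.

(** Pasting is used for the Beck-Chevalley condition: pulling an arrow back along [s2]
    is the same as first postcomposing it with [f2] and then pulling back along [s1]. *)
Lemma pullback_paste {C : category} {w x y z b p : C} {f1 : hom w x} {s1 : hom x z}
  {s2 : hom w y} {f2 : hom y z} {m : hom b y} {p1 : hom p b} {p2 : hom p w} :
  is_pullback f2 s1 s2 f1 -> is_pullback m s2 p1 p2 ->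
  is_pullback (m ;; f2) s1 p1 (p2 ;; f1).
Proof.
  intros H K. apply make_pullback.
  - rewrite assoc, (fst K), <- assoc, (fst H). apply assoc.
  - intros v h k E. rewrite assoc in E.
    exists (pb_pair K h (pb_pair H _ k E) (eq_sym (pb_pair_fst H _ k E))). split.
    + apply pb_pair_fst.
    + rewrite assoc, pb_pair_snd. apply pb_pair_snd.
  - intros v h k E1 E2. rewrite !assoc in E2. apply (pullback_unique K); [exact E1 |].
    apply (pullback_unique H); [| exact E2].
    rewrite <- !assoc, <- (fst K), !assoc, E1. reflexivity.
Qed.

(** * Universal arrows and right adjoints *)

(** A family of these is a left adjoint in its most economical form: neither
    functoriality nor naturality has to be given. It serves both to construct
    dependent sums and to show that a functor preserves limits. *)
Record universal_arrow {C D : category} (R : functor D C) (x : C) : Type := {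
  ua_ob : D;
  ua_mor : hom x (R ua_ob);
  ua_is : forall (y : D) (g : hom x (R y)),
    unique_sol (fun h : hom ua_ob y => ua_mor ;; fmap R h = g)
}.
Arguments ua_ob {_ _ _ _} _.
Arguments ua_mor {_ _ _ _} _.
Arguments ua_is {_ _ _ _} _ _ _.

Section UniversalArrows.
  Context {C D : category} {R : functor D C} (U : forall x : C, universal_arrow R x).

  Definition transpose {x : C} {y : D} (g : hom x (R y)) : hom (ua_ob (U x)) y :=
    proj1_sig (ua_is (U x) y g).

  Lemma transpose_spec {x : C} {y : D} (g : hom x (R y)) :
    ua_mor (U x) ;; fmap R (transpose g) = g.
  Proof. exact (proj1 (proj2_sig (ua_is (U x) y g))). Qed.

  Lemma transpose_unique {x : C} {y : D} (h k : hom (ua_ob (U x)) y) :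
    ua_mor (U x) ;; fmap R h = ua_mor (U x) ;; fmap R k -> h = k.
  Proof.
    intros E. destruct (ua_is (U x) y (ua_mor (U x) ;; fmap R k)) as [l [_ Hl]].
    rewrite <- (Hl h E). apply Hl. reflexivity.
  Qed.

  Definition universal_functor : functor C D.
  Proof.
    refine {| fob := fun x => ua_ob (U x);
              fmap := fun x y f => transpose (f ;; ua_mor (U y)) |}.
    - intros x. apply transpose_unique. rewrite transpose_spec, fmap_id, id_left, id_right.
      reflexivity.
    - intros x y z f g. apply transpose_unique.
      rewrite transpose_spec, fmap_comp, assoc, transpose_spec, <- !assoc, transpose_spec.
      reflexivity.
  Defined.

  Definition left_adjoint_of_universal : left_adjoint R.
  Proof.
    unshelve refine {|
      ladj := universal_functor;
      ladj_unit := Build_nat_trans _ _ (functor_id C) (functor_comp universal_functor R)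
        (fun x => ua_mor (U x)) _;
      ladj_counit := Build_nat_trans _ _ (functor_comp R universal_functor) (functor_id D)
        (fun y => transpose (idm (R y))) _
    |}.
    - intros x y f. cbn. symmetry. apply transpose_spec.
    - intros x y f. cbn. apply transpose_unique.
      rewrite !fmap_comp, !assoc, !transpose_spec, <- assoc, transpose_spec, id_left.
      apply id_right.
    - intros x. cbn. apply transpose_unique.
      rewrite fmap_comp, assoc, transpose_spec, <- assoc, transpose_spec, fmap_id. reflexivity.
    - intros y. apply transpose_spec.
  Defined.

  Lemma transpose_counit {x : C} {y : D} (g : hom x (R y)) :
    fmap left_adjoint_of_universal g ;; ladj_counit left_adjoint_of_universal y = transpose g.
  Proof.
    cbn. apply transpose_unique.
    rewrite fmap_comp, assoc, !transpose_spec, <- assoc, transpose_spec. apply id_right.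
  Qed.

  (** Right adjoints preserve limits. *)
  Lemma universal_preserves_terminal : preserves_terminal R.
  Proof.
    intros t Ht x. exists (ua_mor (U x) ;; fmap R (proj1_sig (Ht (ua_ob (U x))))).
    intros g. rewrite <- (transpose_spec g). f_equal. f_equal. apply (terminal_unique Ht).
  Qed.

  Lemma universal_preserves_bin_products : preserves_bin_products R.
  Proof.
    intros a b p p1 p2 H x f g.
    destruct (H _ (transpose f) (transpose g)) as [h [[E1 E2] Hu]].
    exists (ua_mor (U x) ;; fmap R h). split.
    - split; rewrite <- assoc, <- fmap_comp, ?E1, ?E2; apply transpose_spec.
    - intros k [K1 K2]. rewrite <- (transpose_spec k). f_equal. f_equal. apply Hu.
      split; apply transpose_unique; rewrite fmap_comp, assoc, !transpose_spec; assumption.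
  Qed.

  Lemma universal_preserves_equalizers : preserves_equalizers R.
  Proof.
    intros a b e f g i [Hc H]. split.
    - rewrite <- !fmap_comp, Hc. reflexivity.
    - intros x h E. destruct (H _ (transpose h)) as [k [Hk Hu]].
      { apply transpose_unique. rewrite !fmap_comp, !assoc, !transpose_spec. exact E. }
      exists (ua_mor (U x) ;; fmap R k). split.
      + rewrite <- assoc, <- fmap_comp, Hk. apply transpose_spec.
      + intros l Hl. rewrite <- (transpose_spec l). f_equal. f_equal. apply Hu.
        apply transpose_unique. rewrite fmap_comp, assoc, !transpose_spec. exact Hl.
  Qed.
End UniversalArrows.

(** * Cartesian squares *)

Lemma sq_eq {C : category} {x y : C} {a : arr x} {b : arr y} {f : hom x y}
  (s t : sq a b f) : sq_top s = sq_top t -> s = t.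
Proof. apply sig_eq. intros; apply hom_set. Qed.

(** The universal property of a Cartesian morphism is tested only against identity
    arrows [idm w], which represent cones with vertex [w]. *)
Lemma cartesian_pullback {C : category} {x y : C} {a : arr x} {b : arr y} {f : hom x y}
  (t : sq a b f) : is_cartesian (D := disp_codomain C) (xx := a) (yy := b) t ->
  is_pullback b f (sq_top t) a.
Proof.
  intros H. apply make_pullback.
  - exact (proj2_sig t).
  - intros w h k E.
    assert (E' : h ;; b = idm w ;; (k ;; f)) by (rewrite id_left; exact E).
    destruct (H w {| arr_dom := w; arr_mor := idm w |} k (exist _ h E')) as [u [Hu _]].
    exists (sq_top u). split.
    + exact (f_equal sq_top Hu).
    + etransitivity; [exact (proj2_sig u) | apply id_left].
  - intros w u v E1 E2.
    pose (o := {| arr_dom := w; arr_mor := idm w |}).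
    assert (Eu : u ;; a = idm w ;; (u ;; a)) by (symmetry; apply id_left).
    assert (Ev : v ;; a = idm w ;; (u ;; a)) by (rewrite E2; symmetry; apply id_left).
    pose (su := exist _ u Eu : dhom (disp_codomain C) o a (u ;; a)).
    pose (sv := exist _ v Ev : dhom (disp_codomain C) o a (u ;; a)).
    enough (E : su = sv) by exact (f_equal sq_top E).
    destruct (H w o (u ;; a) (dcomp (d := disp_codomain C) (yy := a) sv t)) as [m [_ Hm]].
    transitivity m; [symmetry |]; apply Hm; [| reflexivity].
    apply sq_eq. exact E1.
Qed.

Lemma pullback_cartesian {C : category} {x y : C} {a : arr x} {b : arr y} {f : hom x y}
  (t : sq a b f) : is_pullback b f (sq_top t) a ->
  is_cartesian (D := disp_codomain C) (xx := a) (yy := b) t.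
Proof.
  intros H w c g h.
  assert (E : sq_top h ;; b = c ;; g ;; f).
  { rewrite <- assoc. exact (proj2_sig h). }
  exists (exist _ (pb_pair H _ _ E) (pb_pair_snd H _ _ E)). split.
  - apply sq_eq. apply (pb_pair_fst H).
  - intros k Hk. apply sq_eq. apply (pullback_unique H).
    + etransitivity; [apply (pb_pair_fst H) |]. symmetry. exact (f_equal sq_top Hk).
    + etransitivity; [apply (pb_pair_snd H) |]. symmetry. exact (proj2_sig k).
Qed.

(** * Limits in slices *)

Section Slices.
  Context {C : category} {x : C}.
  Notation slice := (fiber (disp_codomain C) x).

  Definition slice_top {a b : slice} (f : hom a b) :
    hom (arr_dom (a : arr x)) (arr_dom (b : arr x)) := sq_top (f : sq _ _ (idm x)).

  Lemma slice_comm {a b : slice} (f : hom a b) : slice_top f ;; (b : arr x) = (a : arr x).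
  Proof. etransitivity; [exact (proj2_sig (f : sq _ _ (idm x))) | apply id_right]. Qed.

  Definition slice_mor {a b : slice} (t : hom (arr_dom (a : arr x)) (arr_dom (b : arr x)))
    (e : t ;; (b : arr x) = (a : arr x)) : hom a b :=
    exist _ t (eq_trans e (eq_sym (id_right _))).

  Lemma slice_eq {a b : slice} (f g : hom a b) : slice_top f = slice_top g -> f = g.
  Proof. apply sq_eq. Qed.

  Lemma slice_top_comp {a b c : slice} (f : hom a b) (g : hom b c) :
    slice_top (f ;; g) = slice_top f ;; slice_top g.
  Proof. apply sq_transport_top. Qed.

  Lemma slice_triangle {a b c : slice} {f : hom a b} {g : hom b c} {h : hom a c} :
    f ;; g = h -> slice_top f ;; slice_top g = slice_top h.
  Proof. intros <-. symmetry. apply slice_top_comp. Qed.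

  Definition slice_iso {a b : slice} (f : hom a b) : is_iso (slice_top f) -> is_iso f.
  Proof.
    intros H.
    assert (e : inv H ;; (a : arr x) = (b : arr x)).
    { rewrite <- (slice_comm f), assoc, inv_l. apply id_left. }
    exists (slice_mor (inv H) e); apply slice_eq; rewrite slice_top_comp.
    - apply inv_r.
    - apply inv_l.
  Defined.

  (** The next six lemmas rephrase limits in a slice in the ambient category, in
      both directions: one direction constructs limits in slices, both together show
      that the action of a functor on slices preserves them. *)
  Lemma slice_terminal_of_iso (t : slice) : is_iso (arr_mor (t : arr x)) -> is_terminal t.
  Proof.
    intros H a.
    assert (e : (a : arr x) ;; inv H ;; (t : arr x) = (a : arr x)).
    { rewrite <- assoc, inv_l. apply id_right. }
    exists (slice_mor _ e). intros g. apply slice_eq. apply (is_iso_cancel_r H).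
    rewrite slice_comm. symmetry. exact e.
  Qed.

  Lemma slice_iso_of_terminal (t : slice) : is_terminal t -> is_iso (arr_mor (t : arr x)).
  Proof.
    intros H.
    destruct (H ({| arr_dom := x; arr_mor := idm x |} : arr x)) as [g _].
    exists (slice_top g).
    - assert (e : arr_mor (t : arr x) ;; slice_top g ;; (t : arr x) = (t : arr x)).
      { rewrite <- assoc. etransitivity; [exact (f_equal _ (slice_comm g)) | apply id_right]. }
      apply (f_equal slice_top (terminal_unique H (slice_mor _ e) (idm t))).
    - apply (slice_comm g).
  Qed.

  Lemma slice_product_of_pullback (a b p : slice) (p1 : hom p a) (p2 : hom p b) :
    is_pullback (arr_mor (a : arr x)) (arr_mor (b : arr x)) (slice_top p1) (slice_top p2) ->
    is_bin_product p1 p2.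
  Proof.
    intros H c f g.
    assert (E : slice_top f ;; (a : arr x) = slice_top g ;; (b : arr x)).
    { rewrite !slice_comm. reflexivity. }
    assert (e : pb_pair H _ _ E ;; (p : arr x) = (c : arr x)).
    { rewrite <- (slice_comm p1), assoc, pb_pair_fst. apply slice_comm. }
    exists (slice_mor _ e). split.
    - split; apply slice_eq; rewrite slice_top_comp; [apply pb_pair_fst | apply pb_pair_snd].
    - intros k [<- <-]. apply slice_eq. apply (pullback_unique H).
      + etransitivity; [apply (pb_pair_fst H) | apply slice_top_comp].
      + etransitivity; [apply (pb_pair_snd H) | apply slice_top_comp].
  Qed.

  Lemma pullback_of_slice_product (a b p : slice) (p1 : hom p a) (p2 : hom p b) :
    is_bin_product p1 p2 ->
    is_pullback (arr_mor (a : arr x)) (arr_mor (b : arr x)) (slice_top p1) (slice_top p2).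
  Proof.
    intros H. apply make_pullback.
    - rewrite !slice_comm. reflexivity.
    - intros w h k E. pose (c := {| arr_dom := w; arr_mor := h ;; (a : arr x) |} : slice).
      destruct (H c (slice_mor (a := c) h eq_refl) (slice_mor (a := c) k (eq_sym E)))
        as [u [[H1 H2] _]].
      exists (slice_top u). split.
      + exact (slice_triangle H1).
      + exact (slice_triangle H2).
    - intros w u v E1 E2.
      pose (c := {| arr_dom := w; arr_mor := u ;; (p : arr x) |} : slice).
      assert (e : v ;; (p : arr x) = u ;; (p : arr x)).
      { rewrite <- (slice_comm p1), !assoc, E1. reflexivity. }
      pose (su := slice_mor (a := c) (b := p) u eq_refl).
      pose (sv := slice_mor (a := c) (b := p) v e).
      destruct (H c (sv ;; p1) (sv ;; p2)) as [m [_ Hm]].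
      enough (E : su = sv) by exact (f_equal slice_top E).
      transitivity m; [symmetry |]; apply Hm; split; try reflexivity;
        apply slice_eq; rewrite !slice_top_comp; assumption.
  Qed.

  Lemma slice_equalizer (a b e : slice) (f g : hom a b) (i : hom e a) :
    is_equalizer (slice_top f) (slice_top g) (slice_top i) -> is_equalizer f g i.
  Proof.
    intros H. split.
    - apply slice_eq. rewrite !slice_top_comp. exact (fst H).
    - intros c h E. apply (f_equal slice_top) in E. rewrite !slice_top_comp in E.
      destruct (snd H _ _ E) as [k [Hk _]].
      assert (e' : k ;; (e : arr x) = (c : arr x)).
      { rewrite <- (slice_comm i), assoc, Hk. apply slice_comm. }
      exists (slice_mor k e'). split.
      + apply slice_eq. rewrite slice_top_comp. exact Hk.
      + intros l Hl. apply slice_eq. apply (equalizer_mono H).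
        exact (eq_trans Hk (eq_sym (slice_triangle Hl))).
  Qed.

  Lemma equalizer_of_slice (a b e : slice) (f g : hom a b) (i : hom e a) :
    is_equalizer f g i -> is_equalizer (slice_top f) (slice_top g) (slice_top i).
  Proof.
    intros H. split.
    - rewrite <- !slice_top_comp, (fst H). reflexivity.
    - intros w h E. pose (c := {| arr_dom := w; arr_mor := h ;; (a : arr x) |} : slice).
      destruct (snd H c (slice_mor (a := c) (b := a) h eq_refl)) as [k [Hk _]].
      { apply slice_eq. rewrite !slice_top_comp. exact E. }
      assert (Hk' : slice_top k ;; slice_top i = h).
      { exact (slice_triangle Hk). }
      exists (slice_top k). split; [exact Hk' |].
      intros l Hl.
      assert (e' : l ;; (e : arr x) = (c : arr x)).
      { rewrite <- (slice_comm i), assoc, Hl. reflexivity. }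
      apply (f_equal slice_top (y := slice_mor (a := c) (b := e) l e')).
      apply (equalizer_mono H). rewrite Hk. apply slice_eq. rewrite slice_top_comp.
      symmetry. exact Hl.
  Qed.
End Slices.

(** * Equalizers as pullbacks *)

(** An equalizer of [f] and [g] is a pullback of their graphs [u] and [v]. As the
    product [q] is an arbitrary pullback over a terminal object, the argument also
    applies to the image of such a diagram under a functor preserving finite
    limits. *)
Section EqualizersAsPullbacks.
  Context {C : category} {a b q t : C} {m : hom a t} {n : hom b t}
    {q1 : hom q a} {q2 : hom q b} (Hq : is_pullback m n q1 q2)
    {f g : hom a b} {u v : hom a q}
    (u1 : u ;; q1 = idm a) (u2 : u ;; q2 = f) (v1 : v ;; q1 = idm a) (v2 : v ;; q2 = g).

  Lemma graph_pullback_legs {p : C} {p1 p2 : hom p a} : p1 ;; u = p2 ;; v -> p1 = p2.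
  Proof.
    intros E. transitivity (p1 ;; (u ;; q1)); [rewrite u1; symmetry; apply id_right |].
    rewrite assoc, E, <- assoc, v1. apply id_right.
  Qed.

  Lemma graphs_agree {p : C} (h : hom p a) : h ;; f = h ;; g -> h ;; u = h ;; v.
  Proof.
    intros E. apply (pullback_unique Hq); rewrite <- !assoc.
    - rewrite u1, v1. reflexivity.
    - rewrite u2, v2. exact E.
  Qed.

  Lemma equalizer_of_pullback {e : C} {i1 i2 : hom e a} :
    is_pullback u v i1 i2 -> is_equalizer f g i1.
  Proof.
    intros H. pose proof (graph_pullback_legs (fst H)) as E12. destruct E12. split.
    - rewrite <- u2, <- v2, !assoc, (fst H). reflexivity.
    - intros x h E. exists (pb_pair H h h (graphs_agree h E)). split.
      + apply pb_pair_fst.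
      + intros k <-. apply (pullback_unique H).
        * apply pb_pair_fst.
        * apply (pb_pair_snd H).
  Qed.

  Lemma pullback_of_equalizer {e : C} {i : hom e a} :
    is_equalizer f g i -> is_pullback u v i i.
  Proof.
    intros H. apply make_pullback.
    - apply graphs_agree, (fst H).
    - intros x h k E. pose proof (graph_pullback_legs E) as <-.
      destruct (snd H x h) as [l [Hl _]].
      { rewrite <- u2, <- v2, !assoc, E. reflexivity. }
      exists l. split; exact Hl.
    - intros x k l E _. exact (equalizer_mono H k l E).
  Qed.
End EqualizersAsPullbacks.

Section FinLimEqualizers.
  Context (C : finlim_cat).

  Definition to_terminal (x : C) : hom x (fl_terminal C) :=
    proj1_sig (term_is (fl_terminal C) x).

  Definition graph_product (a b : C) : pullback (to_terminal a) (to_terminal b) :=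
    fl_pullbacks C a b _ _ _.

  Definition graph {a b : C} (f : hom a b) : hom a (pb_ob _ _ (graph_product a b)) :=
    pb_pair (pb_is _ _ (graph_product a b)) (idm a) f (terminal_unique (term_is _) _ _).

  Lemma graph_fst {a b : C} (f : hom a b) : graph f ;; pb_pr1 _ _ (graph_product a b) = idm a.
  Proof. apply pb_pair_fst. Qed.
  Lemma graph_snd {a b : C} (f : hom a b) : graph f ;; pb_pr2 _ _ (graph_product a b) = f.
  Proof. apply pb_pair_snd. Qed.

  Definition finlim_equalizer {a b : C} (f g : hom a b) : equalizer f g :=
    let P := fl_pullbacks C _ _ _ (graph f) (graph g) in
    {| eq_ob := pb_ob _ _ P; eq_arr := pb_pr1 _ _ P;
       eq_is := equalizer_of_pullback (pb_is _ _ (graph_product a b))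
         (graph_fst f) (graph_snd f) (graph_fst g) (graph_snd g) (pb_is _ _ P) |}.

  Lemma finlim_preserves_equalizers {D : finlim_cat} (F : finlim_functor C D) :
    preserves_equalizers F.
  Proof.
    intros a b e f g i H.
    pose proof (ff_pullbacks _ _ F _ _ _ _ _ _ _ _ (pb_is _ _ (graph_product a b))) as Hq.
    pose proof (pullback_of_equalizer (pb_is _ _ (graph_product a b))
      (graph_fst f) (graph_snd f) (graph_fst g) (graph_snd g) H) as HP.
    apply (ff_pullbacks _ _ F) in HP.
    refine (equalizer_of_pullback Hq _ _ _ _ HP);
      rewrite <- fmap_comp, ?graph_fst, ?graph_snd; try apply fmap_id; reflexivity.
  Qed.
End FinLimEqualizers.

(** * Univalence of the codomain fibration *)

Lemma iscontr_all_paths {A : Type} : iscontr A -> forall a b : A, a = b.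
Proof. intros [c H] a b. rewrite (H a). symmetry. apply H. Qed.

Lemma iscontr_isaset {A : Type} : iscontr A -> isaset A.
Proof.
  intros H. apply (isaset_const_endo (fun x y _ => iscontr_all_paths H x y)). reflexivity.
Qed.

(** Over a contractible base every point is the center, and the loop in the base that
    would obstruct the comparison of two points of the fiber is trivial. *)
Lemma iscontr_fiber {A : Type} (W : A -> Type) :
  iscontr A -> iscontr { a : A & W a } -> forall a : A, iscontr (W a).
Proof.
  intros HA [[a0 w0] Hw] a.
  destruct (iscontr_all_paths HA a0 a). exists w0. intros w.
  pose proof (Hw (existT _ a0 w)) as E.
  generalize (projT2_eq E). cbn.
  rewrite (iscontr_isaset HA _ _ (projT1_eq E) eq_refl). cbn. trivial.
Qed.

(** The fundamental theorem of identity types: a fiberwise map out of a based identity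
    type is an equivalence as soon as the total space of its target is
    contractible. *)
Lemma isweq_of_contr_total {A : Type} (a : A) (Q : A -> Type) (q : Q a) :
  iscontr { b : A & Q b } ->
  forall b : A, isweq (fun p : a = b => match p in _ = z return Q z with eq_refl => q end).
Proof.
  intros H b y.
  refine (iscontr_fiber (fun u : { b : A & Q b } =>
    { p : a = projT1 u | match p in _ = z return Q z with eq_refl => q end = projT2 u })
    H _ (existT _ b y)).
  exists (existT _ (existT _ a q) (exist _ eq_refl eq_refl)).
  intros [[b' y'] [p e]]. cbn in *. destruct p. destruct e. reflexivity.
Qed.

Lemma is_disp_iso_isaprop {C : category} {D : disp_cat C} {x y : C} {i : iso x y}
  {xx : D x} {yy : D y} {ff : dhom D xx yy i} (p q : is_disp_iso i ff) : p = q.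
Proof.
  destruct p as [g p1 p2], q as [h q1 q2].
  assert (e : g = h).
  { apply tot_inj. rewrite <- (tc_id_right D (tot g)).
    apply tot_of_pathover in p1, p2, q1, q2. rewrite tot_comp, !tot_id in *.
    rewrite <- q1, tc_assoc, p2. apply tc_id_left. }
  destruct e. f_equal; apply dhom_set.
Qed.

Lemma disp_iso_eq {C : category} {D : disp_cat C} {x y : C} {i : iso x y}
  {xx : D x} {yy : D y} (f g : disp_iso i xx yy) :
  disp_iso_mor _ _ _ f = disp_iso_mor _ _ _ g -> f = g.
Proof.
  destruct f as [f Hf], g as [g Hg]; cbn. intros <-. f_equal. apply is_disp_iso_isaprop.
Qed.

(** An isomorphism over the identity is an isomorphism of domains under which the
    second arrow is determined by the first, so univalence of [C] contracts it. *)
Lemma disp_codomain_iso_contr {C : category} (HC : is_univalent C) {x : C}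
  (a : disp_codomain C x) :
  iscontr { b : disp_codomain C x & disp_iso (D := disp_codomain C) (id_iso x) a b }.
Proof.
  exists (existT _ a (id_disp_iso (D := disp_codomain C) a)).
  intros [b [t Ht]].
  assert (Hi : is_iso (sq_top t)).
  { destruct Ht as [g Hr Hl]. exists (sq_top g).
    - exact (sq_pathover_top Hr).
    - exact (sq_pathover_top Hl). }
  destruct b as [d m].
  (* Univalence replaces the top side of the square by an identity. *)
  destruct (HC (arr_dom a) d (Build_iso (sq_top t) Hi)) as [[p Hp] _].
  destruct p. apply (f_equal iso_mor) in Hp. cbn in Hp.
  destruct a as [d n]. cbn in Hp.
  assert (E : n = m).
  { pose proof (proj2_sig t) as E. change (proj1_sig t) with (sq_top t) in E.
    rewrite <- Hp in E. cbn in E. rewrite id_left, id_right in E. symmetry. exact E. }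
  destruct E. f_equal. apply disp_iso_eq. cbn. apply sq_eq. symmetry. exact Hp.
Qed.

Lemma disp_codomain_univalent {C : category} (HC : is_univalent C) :
  is_univalent_disp (disp_codomain C).
Proof.
  intros x y p a b. destruct p.
  exact (isweq_of_contr_total a (fun b => disp_iso (id_iso x) a b) (id_disp_iso a)
    (disp_codomain_iso_contr HC a) b).
Qed.

(** * The codomain fibration of a category with finite limits *)

Section Codomain.
  Context (C : finlim_cat).

  Definition codomain_cleaving : cleaving (disp_codomain C).
  Proof.
    intros x y f b.
    pose (P := fl_pullbacks C _ _ _ (arr_mor (b : arr y)) f).
    pose (t := exist _ (pb_pr1 _ _ P) (fst (pb_is _ _ P)) :
      sq {| arr_dom := pb_ob _ _ P; arr_mor := pb_pr2 _ _ P |} b f).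
    exact {| cl_ob := {| arr_dom := pb_ob _ _ P; arr_mor := pb_pr2 _ _ P |} : disp_codomain C x;
             cl_mor := t; cl_cart := pullback_cartesian t (pb_is _ _ P) |}.
  Defined.

  Notation pull := (subst_ob codomain_cleaving).

  Definition pull_top {x y : C} (f : hom x y) (b : arr y) :
    hom (arr_dom (pull f b)) (arr_dom b) :=
    sq_top (lift codomain_cleaving f b : sq _ _ f).

  Lemma pull_pullback {x y : C} (f : hom x y) (b : arr y) :
    is_pullback b f (pull_top f b) (arr_mor (pull f b : arr x)).
  Proof. exact (pb_is _ _ (fl_pullbacks C _ _ _ (arr_mor b) f)). Qed.

  Definition total_top {x y : C} {a : disp_codomain C x} {b : disp_codomain C y}
    (u : thom a b) : hom (arr_dom a) (arr_dom b) := sq_top (projT2 u : sq a b (projT1 u)).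

  Lemma pull_functor_top {x y : C} (f : hom x y) {a b : fiber (disp_codomain C) y}
    (g : hom a b) :
    slice_top (fmap (subst_functor codomain_cleaving f) g) ;; pull_top f b =
    pull_top f a ;; slice_top g.
  Proof.
    exact (f_equal total_top (subst_mor_tot codomain_cleaving f g)).
  Qed.

  Lemma pull_functor_comp_top {x y : C} (f : hom x y) {a : fiber (disp_codomain C) x}
    {b c : fiber (disp_codomain C) y} (u : hom a (subst_functor codomain_cleaving f b))
    (h : hom b c) :
    slice_top (u ;; fmap (subst_functor codomain_cleaving f) h) ;; pull_top f c =
    slice_top u ;; pull_top f b ;; slice_top h.
  Proof.
    etransitivity; [exact (f_equal (fun v => v ;; _) (slice_top_comp _ _)) |].
    etransitivity; [symmetry; apply assoc |].
    etransitivity; [exact (f_equal _ (pull_functor_top f h)) | apply assoc].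
  Qed.

  Definition post_compose {x y : C} (f : hom x y) (a : arr x) : arr y :=
    {| arr_dom := arr_dom a; arr_mor := a ;; f |}.

  (** Postcomposition with [f] is left adjoint to pulling back along [f]. *)
  Definition pull_universal {x y : C} (f : hom x y) (a : fiber (disp_codomain C) x) :
    universal_arrow (subst_functor codomain_cleaving f) a.
  Proof.
    pose (L := post_compose f a : fiber (disp_codomain C) y).
    assert (E : idm (arr_dom (a : arr x)) ;; arr_mor (L : arr y) = (a : arr x) ;; f)
      by apply id_left.
    refine {| ua_ob := L;
      ua_mor := slice_mor (a := a) (b := subst_functor codomain_cleaving f L)
        (pb_pair (pull_pullback f L) _ _ E) (pb_pair_snd _ _ _ _) |}.
    intros b g.
    assert (e : slice_top g ;; pull_top f b ;; (b : arr y) = (a : arr x) ;; f).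
    { etransitivity; [symmetry; apply assoc |].
      etransitivity; [exact (f_equal (comp (slice_top g)) (fst (pull_pullback f b))) |].
      etransitivity; [apply assoc |]. exact (f_equal (fun u => u ;; f) (slice_comm g)). }
    exists (slice_mor (a := L) (b := b) _ e). split.
    - apply slice_eq, (pullback_unique (pull_pullback f b)).
      + etransitivity; [apply pull_functor_comp_top |].
        etransitivity; [exact (f_equal (fun u => u ;; _) (pb_pair_fst (pull_pullback f L) _ _ E)) |].
        apply id_left.
      + etransitivity; [apply slice_comm |]. symmetry. apply slice_comm.
    - intros k <-. apply slice_eq.
      etransitivity; [exact (pull_functor_comp_top f _ k) |].
      etransitivity; [exact (f_equal (fun u => u ;; _) (pb_pair_fst (pull_pullback f L) _ _ E)) |].
      apply id_left.
  Defined.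

  Lemma pull_universal_top {x y : C} (f : hom x y) (a : fiber (disp_codomain C) x) :
    slice_top (ua_mor (pull_universal f a)) ;; pull_top f (ua_ob (pull_universal f a)) =
    idm (arr_dom (a : arr x)).
  Proof. apply (pb_pair_fst (pull_pullback f _)). Qed.

  Definition codomain_comp_cat : comp_cat := {|
    cc_cat := C; cc_empty := fl_terminal C; cc_ty := disp_codomain C;
    cc_cleaving := codomain_cleaving;
    cc_chi := disp_functor_id (disp_codomain C);
    cc_chi_cartesian := fun x y a b f t H => H
  |}.

  Lemma codomain_full : is_full codomain_comp_cat.
  Proof.
    intros x y a b s t. exists (exist (fun u : sq a b s => u = t) t eq_refl). intros [u Hu]. destruct Hu. reflexivity.
  Qed.

  Definition codomain_sigma_adjoint {x : C} (a : arr x) :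
    left_adjoint (weakening (X := codomain_comp_cat) (Γ := x) a) :=
    left_adjoint_of_universal (pull_universal (arr_mor a)).

  Lemma transpose_top {x y : C} (f : hom x y) {a : fiber (disp_codomain C) x}
    {b : fiber (disp_codomain C) y} (g : hom a (subst_functor codomain_cleaving f b)) :
    slice_top (transpose (pull_universal f) g) = slice_top g ;; pull_top f b.
  Proof.
    transitivity (slice_top (ua_mor (pull_universal f a) ;;
      fmap (subst_functor codomain_cleaving f) (transpose (pull_universal f) g)) ;; pull_top f b).
    - symmetry. etransitivity.
      { exact (pull_functor_comp_top f (ua_mor (pull_universal f a))
          (transpose (pull_universal f) g)). }
      etransitivity; [exact (f_equal (fun u => u ;; _) (pull_universal_top f a)) |].
      apply id_left.
    - exact (f_equal (fun u => slice_top u ;; pull_top f b)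
        (transpose_spec (pull_universal f) g)).
  Qed.

  Lemma subst_square_top {w x y z : C} {f1 : hom w x} {s1 : hom x z} {s2 : hom w y}
    {f2 : hom y z} (e : s2 ;; f2 = f1 ;; s1) (b : fiber (disp_codomain C) z) :
    slice_top (x := w) (a := pull s2 (pull f2 b)) (b := pull f1 (pull s1 b))
      (subst_square codomain_cleaving e b) ;; pull_top f1 (pull s1 b) ;; pull_top s1 b =
    pull_top s2 (pull f2 b) ;; pull_top f2 b.
  Proof.
    pose (t := cart_factor (lift_cart codomain_cleaving s1 b) e
      (dcomp (lift codomain_cleaving s2 (pull f2 b)) (lift codomain_cleaving f2 b))).
    transitivity (sq_top t ;; pull_top s1 b).
    - exact (f_equal (fun u => u ;; pull_top s1 b)
        (f_equal total_top (cart_factor_tot (lift_cart codomain_cleaving f1 (pull s1 b))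
          (eq_sym (id_left f1)) t))).
    - exact (f_equal total_top (cart_factor_tot (lift_cart codomain_cleaving s1 b) e _)).
  Qed.

  (** When [u] is the unit along [f2], the arrow under the first [slice_top] is the one
      whose transpose is the Beck-Chevalley comparison. *)
  Lemma subst_square_after_top {w x y z : C} {f1 : hom w x} {s1 : hom x z} {s2 : hom w y}
    {f2 : hom y z} (e : s2 ;; f2 = f1 ;; s1) {a : fiber (disp_codomain C) y}
    {b : fiber (disp_codomain C) z} (u : hom a (subst_functor codomain_cleaving f2 b)) :
    slice_top (fmap (subst_functor codomain_cleaving s2) u ;;
      (subst_square codomain_cleaving e b :
        @hom (fiber (disp_codomain C) w) (pull s2 (pull f2 b)) (pull f1 (pull s1 b)))) ;;
      pull_top f1 (pull s1 b) ;; pull_top s1 b =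
    pull_top s2 a ;; slice_top u ;; pull_top f2 b.
  Proof.
    etransitivity; [exact (f_equal (fun v => v ;; _ ;; _) (slice_top_comp _ _)) |].
    rewrite <- !assoc.
    etransitivity; [apply f_equal; etransitivity; [apply assoc | exact (subst_square_top e b)] |].
    etransitivity; [apply assoc |].
    etransitivity; [exact (f_equal (fun v => v ;; _) (pull_functor_top s2 u)) |].
    symmetry. apply assoc.
  Qed.

  (** By pasting, the pullback of [b] along [s2], composed with [f1], is also a pullback
      along [s1] of the composite of [b] with [f2]. The comparison respects the two
      projections, hence is the isomorphism between two pullbacks of one cospan. *)
  Lemma codomain_beck_chevalley {w x y z : C} {f1 : hom w x} {s1 : hom x z} {s2 : hom w y}
    {f2 : hom y z} (e : s2 ;; f2 = f1 ;; s1) (b : fiber (disp_codomain C) y) :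
    is_pullback f2 s1 s2 f1 ->
    is_iso (beck_chevalley_mor codomain_cleaving e
      (left_adjoint_of_universal (pull_universal f1))
      (left_adjoint_of_universal (pull_universal f2)) b).
  Proof.
    intros H. apply slice_iso.
    assert (E : slice_top (beck_chevalley_mor codomain_cleaving e
      (left_adjoint_of_universal (pull_universal f1))
      (left_adjoint_of_universal (pull_universal f2)) b) ;;
      pull_top s1 (post_compose f2 b) = pull_top s2 b).
    { unfold beck_chevalley_mor. rewrite transpose_counit.
      etransitivity.
      { exact (f_equal (fun u => u ;; pull_top s1 (post_compose f2 b))
          (transpose_top f1 (b := pull s1 (post_compose f2 b)) _)). }
      etransitivity; [exact (subst_square_after_top e _) |].
      rewrite <- assoc. etransitivity; [exact (f_equal _ (pull_universal_top f2 b)) |].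
      apply id_right. }
    refine (pullback_comparison_iso (pullback_paste H (pull_pullback s2 b))
      (pull_pullback s1 (post_compose f2 b)) E _).
    exact (slice_comm (beck_chevalley_mor codomain_cleaving e
      (left_adjoint_of_universal (pull_universal f1))
      (left_adjoint_of_universal (pull_universal f2)) b)).
  Qed.

  (** Strength holds on the nose: the unit followed by the lift of the projection is an
      identity. *)
  Definition codomain_strong_sigma : strong_sigma codomain_comp_cat.
  Proof.
    refine (Build_strong_sigma codomain_comp_cat
      (fun (x : C) (a : arr x) => codomain_sigma_adjoint a) _ _).
    - intros x y a b s t e H c. exact (codomain_beck_chevalley e c H).
    - intros x a b.
      change (is_iso (slice_top (ua_mor (pull_universal (arr_mor a) b)) ;;
        pull_top (arr_mor a) (ua_ob (pull_universal (arr_mor a) b)))).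
      rewrite pull_universal_top. apply id_is_iso.
  Qed.

  Definition codomain_dfl : dfl_comp_cat.
  Proof.
    unshelve refine {| dfl_cc := codomain_comp_cat; dfl_full := codomain_full;
      dfl_sigma := codomain_strong_sigma |}.
    - intros x. pose (t := {| arr_dom := x; arr_mor := idm x |} : fiber (disp_codomain C) x).
      exact {| term_ob := t; term_is := slice_terminal_of_iso t (id_is_iso x) |}.
    - split; [apply fl_univalent | apply disp_codomain_univalent, fl_univalent].
    - intros x a b. pose (P := fl_pullbacks C _ _ _ (arr_mor a) (arr_mor b)).
      pose (p := {| arr_dom := pb_ob _ _ P; arr_mor := pb_pr1 _ _ P ;; arr_mor a |} :
        fiber (disp_codomain C) x).
      exact {| bp_ob := p;
        bp_pr1 := slice_mor (a := p) (b := a) (pb_pr1 _ _ P) eq_refl;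
        bp_pr2 := slice_mor (a := p) (b := b) (pb_pr2 _ _ P) (eq_sym (fst (pb_is _ _ P)));
        bp_is := slice_product_of_pullback a b p (slice_mor _ _) (slice_mor _ _)
          (pb_is _ _ P) |}.
    - intros x a b f g. pose (E := finlim_equalizer C (slice_top f) (slice_top g)).
      pose (c := {| arr_dom := eq_ob _ _ E; arr_mor := eq_arr _ _ E ;; arr_mor a |} :
        fiber (disp_codomain C) x).
      exact {| eq_ob := c; eq_arr := slice_mor (a := c) (b := a) (eq_arr _ _ E) eq_refl;
        eq_is := slice_equalizer a b c f g (slice_mor _ _) (eq_is _ _ E) |}.
    - intros x y f. exact (universal_preserves_terminal (pull_universal f)).
    - intros x y f. exact (universal_preserves_bin_products (pull_universal f)).
    - intros x y f. exact (universal_preserves_equalizers (pull_universal f)).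
    - intros x. apply id_is_iso.
    - refine {| dem_ty := fun x : codomain_comp_cat =>
          {| arr_dom := x; arr_mor := to_terminal C x |} : cc_ty codomain_comp_cat _;
        dem_iso := fun x => id_iso x |}.
  Defined.
End Codomain.

(** * Functors preserving finite limits act on codomain fibrations *)

Section CodomainFunctor.
  Context {C D : finlim_cat} (F : finlim_functor C D).

  Lemma codomain_fiber_top {x : C} {a b : fiber (disp_codomain C) x} (f : hom a b) :
    slice_top (fmap (fiber_functor (codomain_functor F) x) f) = fmap F (slice_top f).
  Proof. apply sq_transport_top. Qed.

  Lemma codomain_functor_cartesian : is_cartesian_functor (codomain_functor F).
  Proof.
    intros x y a b f t H. apply pullback_cartesian.
    exact (ff_pullbacks _ _ F _ _ _ _ _ _ _ _ (cartesian_pullback t H)).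
  Qed.

  Definition codomain_dfl_functor : dfl_functor (codomain_dfl C) (codomain_dfl D).
  Proof.
    unshelve refine (Build_dfl_functor (codomain_dfl C) (codomain_dfl D) F
      (ff_terminal _ _ F) (codomain_functor F) codomain_functor_cartesian _ _ _
      (make_df_chi (X := codomain_dfl C) (Y := codomain_dfl D) (codomain_functor F)
        (fun x a => idm (F (arr_dom a))) _ _) _).
    - intros. apply id_left.
    - intros. cbn. rewrite id_left. apply id_right.
    - intros x t H. apply slice_terminal_of_iso, (fmap_is_iso F).
      exact (slice_iso_of_terminal t H).
    - intros x a b p p1 p2 H. apply slice_product_of_pullback. rewrite !codomain_fiber_top.
      apply (ff_pullbacks _ _ F _ _ _ _ _ _ _ _ (pullback_of_slice_product _ _ _ _ _ H)).
    - intros x a b e f g i H. apply slice_equalizer. rewrite !codomain_fiber_top.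
      apply (finlim_preserves_equalizers C F), equalizer_of_slice, H.
    - intros x a. apply sq_disp_iso, id_is_iso.
  Defined.
End CodomainFunctor.

(** * Types as arrows *)

Section Comprehension.
  Context {X : dfl_comp_cat}.

  Definition full_mor {Γ Δ : X} {A : cc_ty X Γ} {B : cc_ty X Δ} {s : hom Γ Δ}
    (t : hom (ext A) (ext B)) (e : t ;; proj B = proj A ;; s) : dhom (cc_ty X) A B s :=
    proj1_sig (proj1_sig (dfl_full X Γ Δ A B s (exist _ t e))).

  Lemma ext_full_mor {Γ Δ : X} {A : cc_ty X Γ} {B : cc_ty X Δ} {s : hom Γ Δ}
    (t : hom (ext A) (ext B)) (e : t ;; proj B = proj A ;; s) :
    ext_mor (full_mor t e) = t.
  Proof.
    exact (f_equal sq_top (proj2_sig (proj1_sig (dfl_full X Γ Δ A B s (exist _ t e))))).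
  Qed.

  Lemma ext_mor_inj {Γ Δ : X} {A : cc_ty X Γ} {B : cc_ty X Δ} {s : hom Γ Δ}
    (f g : dhom (cc_ty X) A B s) : ext_mor f = ext_mor g -> f = g.
  Proof.
    intros E.
    pose proof (iscontr_all_paths (dfl_full X Γ Δ A B s (dfmap (cc_chi X) g))
      (exist _ f (sq_eq _ _ E)) (exist _ g eq_refl)) as H.
    exact (f_equal (@proj1_sig _ _) H).
  Qed.

  (** Comprehension on morphisms whose base is left variable. Dependent equations then
      become equations of arrows, by [ext_total_inj]. *)
  Definition ext_total {Γ Δ : X} {A : cc_ty X Γ} {B : cc_ty X Δ} (f : thom A B) :
    hom (ext A) (ext B) := ext_mor (projT2 f).

  Lemma ext_total_comp {Γ Δ Θ : X} {A : cc_ty X Γ} {B : cc_ty X Δ} {E : cc_ty X Θ}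
    (f : thom A B) (g : thom B E) : ext_total (tc f g) = ext_total f ;; ext_total g.
  Proof. apply ext_mor_comp. Qed.

  Lemma ext_total_inj {Γ Δ : X} {A : cc_ty X Γ} {B : cc_ty X Δ} (f g : thom A B) :
    projT1 f = projT1 g -> ext_total f = ext_total g -> f = g.
  Proof.
    destruct f as [s f], g as [s' g]. cbn. intros <- E. f_equal. apply ext_mor_inj. exact E.
  Qed.

  Lemma ext_mor_proj {Γ Δ : X} {A : cc_ty X Γ} {B : cc_ty X Δ} {s : hom Γ Δ}
    (f : dhom (cc_ty X) A B s) : ext_mor f ;; proj B = proj A ;; s.
  Proof. exact (proj2_sig (dfmap (cc_chi X) f)). Qed.

  Lemma ext_mor_proj_id {Γ : X} {A B : cc_ty X Γ} (f : dhom (cc_ty X) A B (idm Γ)) :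
    ext_mor f ;; proj B = proj A.
  Proof. rewrite ext_mor_proj. apply id_right. Qed.

  Lemma ext_mor_transport {Γ Δ : X} {A : cc_ty X Γ} {B : cc_ty X Δ} {s s' : hom Γ Δ}
    (p : s = s') (f : dhom (cc_ty X) A B s) :
    ext_mor (eq_rect s (dhom (cc_ty X) A B) f s' p) = ext_mor f.
  Proof. destruct p. reflexivity. Qed.

  Lemma ext_mor_fiber_comp {Γ : X} {A B E : fiber (cc_ty X) Γ} (f : hom A B) (g : hom B E) :
    ext_mor (f ;; g : dhom (cc_ty X) A E (idm Γ)) =
    ext_mor (f : dhom (cc_ty X) A B (idm Γ)) ;; ext_mor (g : dhom (cc_ty X) B E (idm Γ)).
  Proof. etransitivity; [apply ext_mor_transport | apply ext_mor_comp]. Qed.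

  (** A fully faithful displayed functor reflects Cartesian morphisms; together with
      the next lemma, Cartesian morphisms of types are pullback squares of
      contexts. *)
  Lemma cartesian_of_ext_pullback {Γ Δ : X} {A : cc_ty X Γ} {B : cc_ty X Δ} {s : hom Γ Δ}
    (f : dhom (cc_ty X) A B s) :
    is_pullback (proj B) s (ext_mor f) (proj A) -> is_cartesian f.
  Proof.
    intros H Θ E r h.
    assert (e : ext_mor h ;; proj B = proj E ;; r ;; s).
    { rewrite <- assoc. apply ext_mor_proj. }
    exists (full_mor (pb_pair H _ _ e) (pb_pair_snd H _ _ e)). split.
    - apply ext_mor_inj. rewrite ext_mor_comp, ext_full_mor. apply pb_pair_fst.
    - intros k <-. apply ext_mor_inj. rewrite ext_full_mor. apply (pullback_unique H).
      + rewrite pb_pair_fst. apply ext_mor_comp.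
      + rewrite pb_pair_snd. symmetry. apply ext_mor_proj.
  Qed.

  Lemma ext_pullback_of_cartesian {Γ Δ : X} {A : cc_ty X Γ} {B : cc_ty X Δ} {s : hom Γ Δ}
    (f : dhom (cc_ty X) A B s) :
    is_cartesian f -> is_pullback (proj B) s (ext_mor f) (proj A).
  Proof. intros H. exact (cartesian_pullback _ (cc_chi_cartesian X _ _ _ _ _ _ H)). Qed.

  (** Maps from [Z] into [Γ.A] over [z : Z -> Γ] are global elements of [z^* A], that is,
      maps into it from the unit type [u] over [Z], because the projection [p] of [u]
      is invertible and comprehension is full. The equalizer [z^* E] over [Z] thus
      decides which of these maps factor through [Γ.E]. *)
  Lemma ext_equalizer {Γ : X} {A B E : fiber (cc_ty X) Γ} {f g : hom A B} {i : hom E A} :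
    is_equalizer f g i ->
    is_equalizer (ext_mor (f : dhom (cc_ty X) A B (idm Γ)))
      (ext_mor (g : dhom (cc_ty X) A B (idm Γ)))
      (ext_mor (i : dhom (cc_ty X) E A (idm Γ))).
  Proof.
    intros H. split.
    { rewrite <- !ext_mor_fiber_comp, (fst H). reflexivity. }
    intros Z v Ev.
    pose (z := v ;; proj A).
    pose (u := term_ob (dfl_unit X Z)).
    pose (Hp := dfl_unit_iso X Z : is_iso (proj (u : cc_ty X Z))).
    pose (p := proj (u : cc_ty X Z)).
    pose (cl := cc_cleaving X).
    pose proof (dfl_subst_eq X _ _ z _ _ _ _ _ _ H) as Hz.
    (* Postcomposing a global element of [z^* A] with [z^* f] is postcomposing the
       corresponding map into [A] over [z] with [f]. *)
    assert (lift_fmap : forall (A B : fiber (cc_ty X) Γ) (k : hom u (subst_functor cl z A))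
      (f : hom A B),
      tc (tot (k ;; fmap (subst_functor cl z) f : dhom (cc_ty X) u _ (idm Z)))
         (tot (lift cl z B)) =
      tc (tc (tot (k : dhom (cc_ty X) u _ (idm Z))) (tot (lift cl z A)))
         (tot (f : dhom (cc_ty X) A B (idm Γ)))).
    { intros A' B' k f'. rewrite tot_fiber_comp, <- tc_assoc.
      etransitivity; [exact (f_equal _ (subst_mor_tot cl z f')) | apply tc_assoc]. }
    assert (uniq : forall w1 w2 : hom Z (ext (E : cc_ty X Γ)),
      w1 ;; ext_mor (i : dhom (cc_ty X) E A (idm Γ)) = v ->
      w2 ;; ext_mor (i : dhom (cc_ty X) E A (idm Γ)) = v -> w1 = w2).
    { assert (Hw : forall w : hom Z (ext (E : cc_ty X Γ)),
        w ;; ext_mor (i : dhom (cc_ty X) E A (idm Γ)) = v -> p ;; w ;; proj E = p ;; z).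
      { intros w Hw. unfold z. rewrite <- Hw, <- !assoc, ext_mor_proj_id. reflexivity. }
      intros w1 w2 H1 H2.
      pose (f1 := full_mor (A := u) (B := E) (p ;; w1) (Hw w1 H1)).
      pose (f2 := full_mor (A := u) (B := E) (p ;; w2) (Hw w2 H2)).
      pose (k1 := cart_factor (lift_cart cl z E) (eq_sym (id_left z)) f1
        : hom u (subst_functor cl z E)).
      pose (k2 := cart_factor (lift_cart cl z E) (eq_sym (id_left z)) f2
        : hom u (subst_functor cl z E)).
      assert (K1 : tc (tot (k1 : dhom (cc_ty X) u _ (idm Z))) (tot (lift cl z E)) = tot f1)
        by apply cart_factor_tot.
      assert (K2 : tc (tot (k2 : dhom (cc_ty X) u _ (idm Z))) (tot (lift cl z E)) = tot f2)
        by apply cart_factor_tot.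
      assert (Ek : k1 = k2).
      { apply (equalizer_mono Hz). apply (cart_unique_tot (lift_cart cl z A)).
        etransitivity; [apply lift_fmap |]. etransitivity; [| symmetry; apply lift_fmap].
        rewrite K1, K2. apply ext_total_inj; [reflexivity |].
        rewrite !ext_total_comp. unfold ext_total. cbn. unfold f1, f2.
        rewrite !ext_full_mor, <- !assoc, H1, H2. reflexivity. }
      apply (is_iso_cancel_l Hp). fold p.
      rewrite <- (ext_full_mor (A := u) (B := E) (p ;; w1) (Hw w1 H1)).
      rewrite <- (ext_full_mor (A := u) (B := E) (p ;; w2) (Hw w2 H2)).
      change (ext_total (tot f1) = ext_total (tot f2)). rewrite <- K1, <- K2, Ek. reflexivity. }
    assert (e : p ;; v ;; proj A = p ;; z) by (symmetry; apply assoc).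
    pose (vv := full_mor (A := u) (B := A) (p ;; v) e).
    pose (l := cart_factor (lift_cart cl z A) (eq_sym (id_left z)) vv
      : hom u (subst_functor cl z A)).
    assert (L : tc (tot (l : dhom (cc_ty X) u _ (idm Z))) (tot (lift cl z A)) = tot vv)
      by apply cart_factor_tot.
    destruct (snd Hz _ l) as [k [Hk _]].
    { apply (cart_unique_tot (lift_cart cl z B)).
      etransitivity; [apply lift_fmap |]. etransitivity; [| symmetry; apply lift_fmap].
      rewrite L. apply ext_total_inj; [reflexivity |].
      rewrite !ext_total_comp. unfold ext_total. cbn. unfold vv.
      rewrite !ext_full_mor, <- !assoc, Ev. reflexivity. }
    pose (w := inv Hp ;; ext_total (tc (tot (k : dhom (cc_ty X) u _ (idm Z))) (tot (lift cl z E)))).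
    assert (Hw : w ;; ext_mor (i : dhom (cc_ty X) E A (idm Γ)) = v).
    { unfold w. rewrite <- assoc.
      change (ext_mor i) with (ext_total (tot (i : dhom (cc_ty X) E A (idm Γ)))).
      rewrite <- ext_total_comp. transitivity (inv Hp ;; ext_total (tot vv)).
      { apply f_equal, f_equal. etransitivity; [symmetry; apply lift_fmap |].
        etransitivity; [| exact L].
        exact (f_equal (fun m : hom u (subst_functor cl z A) =>
          tc (tot (m : dhom (cc_ty X) u _ (idm Z))) (tot (lift cl z A))) Hk). }
      unfold ext_total. cbn. unfold vv.
      rewrite ext_full_mor, assoc. unfold p. rewrite inv_l. apply id_left. }
    exists w. split; [exact Hw |]. intros w' Hw'. exact (uniq w w' Hw Hw').
  Qed.
End Comprehension.

(** * Every arrow is a projection *)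

Record type_of_arrow {X : comp_cat} {Γ : X} (a : arr Γ) : Type := {
  ta_ty : cc_ty X Γ;
  ta_mor : hom (ext ta_ty) (arr_dom a);
  ta_iso : is_iso ta_mor;
  ta_proj : ta_mor ;; a = proj ta_ty
}.
Arguments ta_ty {_ _ _} _.
Arguments ta_mor {_ _ _} _.
Arguments ta_iso {_ _ _} _.
Arguments ta_proj {_ _ _} _.

Section Democracy.
  Context {X : dfl_comp_cat}.

  (** The type [E] is the equalizer over [Γ] of the maps [y |-> a y] and [y |-> x], where
      [x] is the given point of [Γ] and [y] ranges over the domain of [a], both
      seen as closed types by democracy. *)
  Lemma every_arrow_type {Γ : X} (a : arr Γ) : type_of_arrow a.
  Proof.
    pose (cl := cc_cleaving X). pose (Δ := arr_dom a).
    pose (dem := dem_ty _ (dfl_democracy X)).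
    pose (bang := proj1_sig (term_is (cc_empty X) Γ) : hom Γ (cc_empty X)).
    pose (dΓ := iso_mor (dem_iso _ (dfl_democracy X) Γ) : hom Γ (ext (dem Γ))).
    pose (dΔ := iso_mor (dem_iso _ (dfl_democracy X) Δ) : hom Δ (ext (dem Δ))).
    pose (Hγ := iso_is_iso (dem_iso _ (dfl_democracy X) Γ) : is_iso dΓ).
    pose (Hδ := iso_is_iso (dem_iso _ (dfl_democracy X) Δ) : is_iso dΔ).
    pose (B := subst_ob cl bang (dem Δ)). pose (B' := subst_ob cl bang (dem Γ)).
    pose (q := ext_mor (lift cl bang (dem Δ)) : hom (ext B) _).
    pose proof (ext_pullback_of_cartesian _ (lift_cart cl bang (dem Δ))) as HB.
    pose proof (ext_pullback_of_cartesian _ (lift_cart cl bang (dem Γ))) as HB'.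
    fold B q in HB. fold B' in HB'.
    pose proof (fun Z (f g : hom Z (cc_empty X)) => terminal_unique (term_is (cc_empty X)) f g)
      as Hbang.
    (* [φ] is the map [y |-> a y] and [ψ] the constant map at the point of [Γ]; both are
       given by their components into the pullback [ext B']. *)
    pose (φ := full_mor (A := B) (B := B') (s := idm Γ)
      (pb_pair HB' (q ;; inv Hδ ;; a ;; dΓ) (proj B) (Hbang _ _ _))
      (eq_trans (pb_pair_snd HB' _ _ _) (eq_sym (id_right _)))).
    pose (ψ := full_mor (A := B) (B := B') (s := idm Γ)
      (pb_pair HB' (proj B ;; dΓ) (proj B) (Hbang _ _ _))
      (eq_trans (pb_pair_snd HB' _ _ _) (eq_sym (id_right _)))).
    destruct (dfl_eq X Γ B B' φ ψ) as [E e He].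
    apply ext_equalizer in He.
    pose (i := ext_mor (e : dhom (cc_ty X) E B (idm Γ))). fold i in He.
    pose (m := i ;; q ;; inv Hδ).
    assert (Ei : i ;; proj B = proj (E : cc_ty X Γ)) by apply ext_mor_proj_id.
    assert (Hm : m ;; a = proj (E : cc_ty X Γ)).
    { apply (is_iso_cancel_r Hγ). pose proof (fst He) as H. cbn in H. unfold φ, ψ in H.
      rewrite !ext_full_mor in H.
      apply (f_equal (fun u => u ;; ext_mor (lift cl bang (dem Γ)))) in H.
      rewrite <- !assoc, !pb_pair_fst, !assoc, Ei in H. exact H. }
    (* The graph of [a] equalizes [φ] and [ψ]; its factorization is inverse to [m]. *)
    pose (v := pb_pair HB dΔ a (Hbang _ _ _)).
    destruct (snd He _ v) as [w [Hw _]].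
    { unfold φ, ψ. cbn. rewrite !ext_full_mor.
      apply (pullback_unique HB'); rewrite <- !assoc, ?pb_pair_fst, ?pb_pair_snd; [| reflexivity].
      unfold v. rewrite !assoc. unfold q. rewrite pb_pair_fst, pb_pair_snd, inv_r, id_left.
      reflexivity. }
    assert (Hwm : w ;; m = idm Δ).
    { unfold m. rewrite !assoc, Hw. unfold v, q. rewrite pb_pair_fst. apply inv_r. }
    refine {| ta_ty := E; ta_mor := m; ta_iso := {| inv := w; inv_r := _; inv_l := Hwm |};
      ta_proj := Hm |}.
    apply (equalizer_mono He). rewrite <- assoc, Hw, id_left.
    apply (pullback_unique HB); rewrite <- assoc; unfold v.
    - rewrite pb_pair_fst. unfold m. rewrite <- assoc, inv_l. apply id_right.
    - rewrite pb_pair_snd, Hm. symmetry. exact Ei.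
  Qed.

  (** Up to isomorphism [f] is a projection, whose pullback is given by substitution. *)
  Lemma dfl_pullbacks (a b c : X) (f : hom a c) (g : hom b c) : pullback f g.
  Proof.
    destruct (every_arrow_type {| arr_dom := a; arr_mor := f |}) as [A i Hi Ei].
    cbn in i, Hi, Ei.
    refine {| pb_pr1 := ext_mor (lift (cc_cleaving X) g A) ;; i;
      pb_pr2 := proj (subst_ob (cc_cleaving X) g A) |}.
    refine (pullback_iso Hi (id_is_iso _) Ei (id_left _) (id_left _)
      (ext_pullback_of_cartesian _ (lift_cart (cc_cleaving X) g A))).
  Qed.
End Democracy.

(** * The category of contexts *)

Definition underlying_finlim (X : dfl_comp_cat) : finlim_cat := {|
  fl_cat := X;
  fl_univalent := uc_cat X (dfl_univalent X);
  fl_terminal := cc_empty X;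
  fl_pullbacks := dfl_pullbacks
|}.

(** The sides [f] and [p2] of a pullback square are isomorphic to projections of types
    [A] and [B], which turns the square into a Cartesian morphism from [B] to [A]. Its
    image is Cartesian, hence a pullback square of extensions, and these are compared
    with the images of the extensions by [df_ext]. *)
Lemma dfl_functor_pullbacks {X Y : dfl_comp_cat} (F : dfl_functor X Y) :
  preserves_pullbacks F.
Proof.
  intros a b c p f g p1 p2 H.
  destruct (every_arrow_type {| arr_dom := a; arr_mor := f |}) as [A i Hi Ei].
  destruct (every_arrow_type {| arr_dom := p; arr_mor := p2 |}) as [B j Hj Ej].
  cbn in i, Hi, Ei, j, Hj, Ej.
  assert (e : j ;; p1 ;; inv Hi ;; proj A = proj B ;; g).
  { rewrite <- Ei, <- (assoc (j ;; p1)), (assoc (inv Hi)), inv_l, id_left, <- assoc.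
    rewrite (fst H), assoc, Ej. reflexivity. }
  assert (K : is_pullback (proj A) g (j ;; p1 ;; inv Hi) (proj B)).
  { refine (pullback_iso (i := inv Hi) (j := inv Hj) (inv_is_iso Hi) (inv_is_iso Hj)
      _ _ _ H).
    - rewrite <- Ei, assoc, inv_l. apply id_left.
    - rewrite !assoc, inv_l, id_left. reflexivity.
    - rewrite <- Ej, assoc, inv_l. apply id_left. }
  rewrite <- (ext_full_mor _ e) in K. apply cartesian_of_ext_pullback in K.
  apply (df_cartesian F), ext_pullback_of_cartesian in K.
  refine (pullback_iso
    (i := inv (df_ext_iso F A) ;; fmap F i) (j := inv (df_ext_iso F B) ;; fmap F j)
    (comp_is_iso (inv_is_iso _) (fmap_is_iso F Hi))
    (comp_is_iso (inv_is_iso _) (fmap_is_iso F Hj)) _ _ _ K).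
  - rewrite <- assoc, <- fmap_comp, Ei, <- df_ext_proj, assoc, inv_l. apply id_left.
  - apply (is_iso_cancel_l (df_ext_iso F B)).
    rewrite !assoc, inv_r, id_left, <- df_ext_nat, ext_full_mor.
    rewrite <- (assoc (fmap F (j ;; p1 ;; inv Hi))), inv_r, id_right, <- !fmap_comp.
    rewrite <- (assoc (j ;; p1)), inv_l, id_right. reflexivity.
  - rewrite <- assoc, <- fmap_comp, Ej, <- df_ext_proj, assoc, inv_l. apply id_left.
Qed.

Definition underlying_finlim_functor {X Y : dfl_comp_cat} (F : dfl_functor X Y) :
  finlim_functor (underlying_finlim X) (underlying_finlim Y) :=
  Build_finlim_functor (underlying_finlim X) (underlying_finlim Y) F
    (df_terminal F) (dfl_functor_pullbacks F).

(** * 2-cells are natural transformations *)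

Section Cells.
  Context {X Y : dfl_comp_cat} {F G : dfl_functor X Y}.

  (** By [dc_chi] the extension of the component at [A] is determined by the natural
      transformation at [ext A], and comprehension is faithful. *)
  Lemma dfl_cell_ext (s t : dfl_cell F G) : (forall Γ, s Γ = t Γ) -> s = t.
  Proof.
    intros H. apply dfl_cell_eq; [exact H |]. intros Γ A. apply ext_total_inj; [apply H |].
    apply (is_iso_cancel_l (df_ext_iso F A)).
    etransitivity; [apply (dc_chi s) |]. rewrite H. symmetry. apply (dc_chi t).
  Qed.

  (** Conversely [dc_chi], solved for the component at [A], prescribes an arrow of
      extensions, which fullness turns into a morphism of types. *)
  Definition dfl_cell_of_nat (s : nat_trans F G) : dfl_cell F G.
  Proof.
    assert (e : forall (Γ : X) (A : cc_ty X Γ),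
      inv (df_ext_iso F A) ;; s (ext A) ;; df_ext G A ;; proj (dfob (df_ty G) A) =
      proj (dfob (df_ty F) A) ;; s Γ).
    { intros Γ A. rewrite <- assoc, df_ext_proj, <- assoc, <- nt_nat, <- df_ext_proj.
      rewrite !assoc, inv_l, id_left. reflexivity. }
    refine (make_dfl_cell F G s (fun Γ A => full_mor _ (e Γ A)) _ _).
    - intros Γ Δ A B [u f]. apply ext_total_inj; [exact (nt_nat s u) |]. rewrite !ext_total_comp.
      unfold ext_total. cbn. rewrite !ext_full_mor.
      apply (is_iso_cancel_l (df_ext_iso F A)).
      rewrite !assoc, <- df_ext_nat, inv_r, id_left.
      rewrite <- (assoc (fmap F _)), inv_r, id_right, nt_nat, <- !assoc, df_ext_nat.
      reflexivity.
    - intros Γ A. rewrite ext_full_mor, !assoc, inv_r, id_left. reflexivity.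
  Defined.
End Cells.

(** * Comprehension is an equivalence *)

Section Comparison.
  Context (X : dfl_comp_cat).

  (** Being fully faithful and essentially surjective on fibers, comprehension has the
      chosen types as left adjoint and thus preserves the limits of fibers. The same
      holds for [psi] below, with the roles exchanged. *)
  Definition chi_universal (Γ : X) (a : fiber (disp_codomain X) Γ) :
    universal_arrow (fiber_functor (cc_chi X) Γ) a.
  Proof.
    pose (T := every_arrow_type (a : arr Γ)).
    assert (e : inv (ta_iso T) ;; proj (ta_ty T) = (a : arr Γ)).
    { rewrite <- (ta_proj T), assoc, inv_l. apply id_left. }
    refine (Build_universal_arrow _ _ (fiber_functor (cc_chi X) Γ) a
      (ta_ty T : fiber (cc_ty X) Γ)
      (slice_mor (x := Γ) (a := a) (b := dfob (cc_chi X) (ta_ty T)) (inv (ta_iso T)) e) _).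
    intros B g.
    assert (eg : ta_mor T ;; slice_top (x := Γ) g ;; proj (B : cc_ty X Γ) =
      proj (ta_ty T) ;; idm Γ).
    { rewrite id_right, <- (ta_proj T), <- assoc. apply f_equal, (slice_comm g). }
    exists (full_mor (A := ta_ty T) (B := B) _ eg). split.
    - apply (slice_eq (x := Γ)). etransitivity; [apply (slice_top_comp (x := Γ)) |].
      etransitivity; [apply (f_equal (comp (inv (ta_iso T)))); etransitivity;
        [apply sq_transport_top | exact (ext_full_mor _ eg)] |].
      rewrite assoc, inv_l. apply id_left.
    - intros h <-. apply ext_mor_inj. rewrite ext_full_mor.
      etransitivity; [apply (f_equal (comp (ta_mor T))), (slice_top_comp (x := Γ)) |].
      etransitivity; [apply (f_equal (comp (ta_mor T))), (f_equal (comp (inv (ta_iso T)))),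
        sq_transport_top |].
      rewrite assoc, inv_r. apply id_left.
  Qed.

  Definition chi_dfl_functor : dfl_functor X (codomain_dfl (underlying_finlim X)).
  Proof.
    unshelve refine (Build_dfl_functor X (codomain_dfl (underlying_finlim X)) (functor_id X)
      (fun t H => H) (cc_chi X) (cc_chi_cartesian X)
      (fun Γ => universal_preserves_terminal (chi_universal Γ))
      (fun Γ => universal_preserves_bin_products (chi_universal Γ))
      (fun Γ => universal_preserves_equalizers (chi_universal Γ))
      (make_df_chi (X := X) (Y := codomain_dfl (underlying_finlim X)) (cc_chi X)
        (fun Γ A => idm (ext A)) _ _) _).
    - intros Γ A. apply id_left.
    - intros. cbn. rewrite id_left. apply id_right.
    - intros Γ A. apply sq_disp_iso, id_is_iso.
  Defined.

  Definition psi_ty {Γ : X} (a : arr Γ) : cc_ty X Γ := ta_ty (every_arrow_type a).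
  Definition psi_mor {Γ : X} (a : arr Γ) : hom (ext (psi_ty a)) (arr_dom a) :=
    ta_mor (every_arrow_type a).
  Definition psi_iso {Γ : X} (a : arr Γ) : is_iso (psi_mor a) := ta_iso (every_arrow_type a).
  Lemma psi_proj {Γ : X} (a : arr Γ) : psi_mor a ;; a = proj (psi_ty a).
  Proof. apply ta_proj. Qed.
  Lemma psi_inv_proj {Γ : X} (a : arr Γ) : inv (psi_iso a) ;; proj (psi_ty a) = a.
  Proof. rewrite <- psi_proj, assoc, inv_l. apply id_left. Qed.

  Lemma psi_sq {Γ Δ : X} {a : arr Γ} {b : arr Δ} {s : hom Γ Δ} (t : sq a b s) :
    psi_mor a ;; sq_top t ;; inv (psi_iso b) ;; proj (psi_ty b) = proj (psi_ty a) ;; s.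
  Proof.
    rewrite <- assoc, psi_inv_proj, <- psi_proj, <- !assoc. apply f_equal, (proj2_sig t).
  Qed.

  (** The inverse of comprehension, defined on morphisms by conjugation with the chosen
      isomorphisms. *)
  Definition psi : disp_functor (functor_id X) (disp_codomain X) (cc_ty X).
  Proof.
    refine (Build_disp_functor _ _ (functor_id X) (disp_codomain X) (cc_ty X)
      (fun Γ a => psi_ty a) (fun Γ Δ a b s t => full_mor _ (psi_sq t)) _ _).
    - intros Γ a. apply pathover_of_tot, ext_total_inj; [reflexivity |]. unfold ext_total. cbn.
      rewrite ext_full_mor, ext_mor_id. cbn. rewrite id_right. apply inv_r.
    - intros Γ Δ Θ a b c f g s t. apply pathover_of_tot, ext_total_inj; [reflexivity |].
      unfold ext_total. cbn. rewrite ext_mor_comp, !ext_full_mor. cbn.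
      rewrite !assoc, <- (assoc _ (inv (psi_iso b)) (psi_mor b)), inv_l, id_right.
      reflexivity.
  Defined.

  Lemma psi_ext {Γ Δ : X} {a : arr Γ} {b : arr Δ} {s : hom Γ Δ} (t : sq a b s) :
    ext_mor (dfmap psi t) ;; psi_mor b = psi_mor a ;; sq_top t.
  Proof.
    cbn. rewrite ext_full_mor, <- assoc, inv_l. apply id_right.
  Qed.

  Lemma psi_cartesian : is_cartesian_functor psi.
  Proof.
    intros Γ Δ a b s t H. apply cartesian_of_ext_pullback.
    refine (pullback_iso (inv_is_iso (psi_iso b)) (inv_is_iso (psi_iso a))
      (psi_inv_proj b) _ (psi_inv_proj a) (cartesian_pullback t H)).
    apply (is_iso_cancel_r (psi_iso b)).
    etransitivity; [symmetry; apply assoc |].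
    etransitivity; [exact (f_equal _ (psi_ext t)) |].
    rewrite assoc, inv_l, id_left, <- assoc, inv_l, id_right. reflexivity.
  Qed.

  Definition psi_universal (Γ : X) (A : fiber (cc_ty X) Γ) :
    universal_arrow (fiber_functor psi Γ) A.
  Proof.
    pose (a := dfob (cc_chi X) (A : cc_ty X Γ) : arr Γ).
    assert (e : inv (psi_iso a) ;; proj (psi_ty a) = proj (A : cc_ty X Γ) ;; idm Γ).
    { rewrite id_right. apply psi_inv_proj. }
    refine (Build_universal_arrow _ _ (fiber_functor psi Γ) A
      (a : fiber (disp_codomain X) Γ) (full_mor (A := A) (B := psi_ty a) _ e) _).
    (* The transpose of [h] is [h] itself, up to the chosen isomorphism at [b]. *)
    assert (key : forall (b : fiber (disp_codomain X) Γ)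
      (h : @hom (fiber (disp_codomain X) Γ) a b),
      ext_mor ((full_mor (A := A) (B := psi_ty a) _ e :
          @hom (fiber (cc_ty X) Γ) A (fiber_functor psi Γ a)) ;;
        fmap (fiber_functor psi Γ) h : dhom (cc_ty X) A (psi_ty b) (idm Γ)) ;; psi_mor b
      = slice_top (x := Γ) h).
    { intros b h. etransitivity; [exact (f_equal (fun u => u ;; _) (ext_mor_fiber_comp _ _)) |].
      rewrite ext_full_mor.
      etransitivity; [exact (f_equal (fun u => inv (psi_iso a) ;; u ;; psi_mor b)
        (ext_mor_transport _ _)) |].
      rewrite <- assoc. etransitivity; [exact (f_equal _ (psi_ext (h : sq _ _ (idm Γ)))) |].
      rewrite assoc, inv_l. apply id_left. }
    intros b g.
    assert (eg : ext_mor (g : dhom (cc_ty X) A (psi_ty b) (idm Γ)) ;; psi_mor b ;; (b : arr Γ)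
      = a).
    { rewrite <- assoc, psi_proj. exact (ext_mor_proj_id (A := A) (B := psi_ty b) g). }
    exists (slice_mor (x := Γ) (a := a) (b := b) _ eg). split.
    - apply ext_mor_inj. apply (is_iso_cancel_r (psi_iso b)).
      exact (key b _).
    - intros h <-. apply (slice_eq (x := Γ)). exact (key b h).
  Qed.

  Definition psi_dfl_functor : dfl_functor (codomain_dfl (underlying_finlim X)) X.
  Proof.
    unshelve refine (Build_dfl_functor (codomain_dfl (underlying_finlim X)) X (functor_id X)
      (fun t H => H) psi psi_cartesian
      (fun Γ => universal_preserves_terminal (psi_universal Γ))
      (fun Γ => universal_preserves_bin_products (psi_universal Γ))
      (fun Γ => universal_preserves_equalizers (psi_universal Γ))
      (make_df_chi (X := codomain_dfl (underlying_finlim X)) (Y := X) psi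
        (fun Γ a => inv (psi_iso a)) _ _) _).
    - intros Γ a. apply psi_inv_proj.
    - intros Γ Δ a b s t. apply (is_iso_cancel_r (psi_iso b)).
      rewrite <- !assoc, inv_l, id_right.
      etransitivity; [| apply f_equal; symmetry; apply psi_ext].
      rewrite assoc, inv_l, id_left. reflexivity.
    - intros Γ a. apply sq_disp_iso, inv_is_iso.
  Defined.
End Comparison.

(** * The pseudofunctors *)

(** All structural 2-cells below have identity components on contexts. In [DFLCompCat]
    this is made visible by [dfl_cell_ext], which discards the components on types. *)
Ltac cell_law := intros; (apply nat_trans_eq || apply dfl_cell_ext); nat_law.

Definition forget_types : psfunctor DFLCompCat FinLim.
Proof.
  unshelve refine (Build_psfunctor DFLCompCat FinLim
    underlying_finlim (fun X Y F => underlying_finlim_functor F)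
    (fun X Y F G s => dc_nat s) (fun X => nat_id (functor_id X))
    (fun X Y Z F G => nat_id (functor_comp F G)) _ _ _ _ _ _ _ _ _).
  - intros X. exists (nat_id (functor_id X)); cell_law.
  - intros X Y Z F G. exists (nat_id (functor_comp F G)); cell_law.
  - cell_law.
  - cell_law.
  - cell_law.
  - cell_law.
  - cell_law.
  - cell_law.
  - cell_law.
Defined.

Definition codomain_psfunctor : psfunctor FinLim DFLCompCat.
Proof.
  unshelve refine (Build_psfunctor FinLim DFLCompCat
    codomain_dfl (fun C D F => codomain_dfl_functor F)
    (fun C D F G s => dfl_cell_of_nat (F := codomain_dfl_functor F)
      (G := codomain_dfl_functor G) s)
    (fun C => dfl_cell_of_nat (F := dfl_functor_id (codomain_dfl C))
      (G := codomain_dfl_functor (finlim_functor_id C)) (nat_id (functor_id C)))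
    (fun C D E F G => dfl_cell_of_nat
      (F := dfl_functor_comp (codomain_dfl_functor F) (codomain_dfl_functor G))
      (G := codomain_dfl_functor (finlim_functor_comp F G))
      (nat_id (functor_comp F G))) _ _ _ _ _ _ _ _ _).
  - intros C. exists (dfl_cell_of_nat (F := codomain_dfl_functor (finlim_functor_id C))
      (G := dfl_functor_id (codomain_dfl C)) (nat_id (functor_id C))); cell_law.
  - intros C D E F G. exists (dfl_cell_of_nat
      (F := codomain_dfl_functor (finlim_functor_comp F G))
      (G := dfl_functor_comp (codomain_dfl_functor F) (codomain_dfl_functor G))
      (nat_id (functor_comp F G))); cell_law.
  - cell_law.
  - cell_law.
  - cell_law.
  - cell_law.
  - cell_law.
  - cell_law.
  - cell_law.
Defined.

(** * Unit and counit *)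

Definition nat_unit_swap_inv {C D : category} (F : functor C D) :
  nat_trans (functor_comp F (functor_id D)) (functor_comp (functor_id C) F).
Proof.
  refine {| nt_ob := fun x =>
    idm (F x) : hom (functor_comp F (functor_id D) x) (functor_comp (functor_id C) F x) |}.
  nat_unit.
Defined.

(** The underlying category of the codomain fibration of [C] is [C] itself, but with
    pullbacks constructed anew from its types; these two identity functors switch
    between the two choices of limits. *)
Definition to_round_trip (C : finlim_cat) :
  finlim_functor C (underlying_finlim (codomain_dfl C)) :=
  Build_finlim_functor C (underlying_finlim (codomain_dfl C)) (functor_id C)
    (fun t H => H) (fun a b c p f g p1 p2 H => H).

Definition of_round_trip (C : finlim_cat) :
  finlim_functor (underlying_finlim (codomain_dfl C)) C :=
  Build_finlim_functor (underlying_finlim (codomain_dfl C)) C (functor_id C)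
    (fun t H => H) (fun a b c p f g p1 p2 H => H).

Definition unit_trans :
  pstrans (psfunctor_id FinLim) (psfunctor_comp codomain_psfunctor forget_types).
Proof.
  unshelve refine (Build_pstrans FinLim FinLim (psfunctor_id FinLim)
    (psfunctor_comp codomain_psfunctor forget_types)
    to_round_trip (fun C D F => nat_unit_swap F) _ _ _ _).
  - intros C D F. exists (nat_unit_swap_inv F); cell_law.
  - cell_law.
  - cell_law.
  - cell_law.
Defined.

Definition unit_inverse :
  pstrans (psfunctor_comp codomain_psfunctor forget_types) (psfunctor_id FinLim).
Proof.
  unshelve refine (Build_pstrans FinLim FinLim
    (psfunctor_comp codomain_psfunctor forget_types) (psfunctor_id FinLim)
    of_round_trip (fun C D F => nat_unit_swap F) _ _ _ _).
  - intros C D F. exists (nat_unit_swap_inv F); cell_law.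
  - cell_law.
  - cell_law.
  - cell_law.
Defined.

Definition counit_trans :
  pstrans (psfunctor_comp forget_types codomain_psfunctor) (psfunctor_id DFLCompCat).
Proof.
  unshelve refine (Build_pstrans DFLCompCat DFLCompCat
    (psfunctor_comp forget_types codomain_psfunctor) (psfunctor_id DFLCompCat)
    psi_dfl_functor
    (fun X Y F => dfl_cell_of_nat
      (F := dfl_functor_comp (psi_dfl_functor X) F)
      (G := dfl_functor_comp (codomain_dfl_functor (underlying_finlim_functor F))
        (psi_dfl_functor Y)) (nat_unit_swap F)) _ _ _ _).
  - intros X Y F. exists (dfl_cell_of_nat
      (F := dfl_functor_comp (codomain_dfl_functor (underlying_finlim_functor F))
        (psi_dfl_functor Y))
      (G := dfl_functor_comp (psi_dfl_functor X) F) (nat_unit_swap_inv F)); cell_law.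
  - cell_law.
  - cell_law.
  - cell_law.
Defined.

Definition counit_inverse :
  pstrans (psfunctor_id DFLCompCat) (psfunctor_comp forget_types codomain_psfunctor).
Proof.
  unshelve refine (Build_pstrans DFLCompCat DFLCompCat
    (psfunctor_id DFLCompCat) (psfunctor_comp forget_types codomain_psfunctor)
    chi_dfl_functor
    (fun X Y F => dfl_cell_of_nat
      (F := dfl_functor_comp (chi_dfl_functor X)
        (codomain_dfl_functor (underlying_finlim_functor F)))
      (G := dfl_functor_comp F (chi_dfl_functor Y)) (nat_unit_swap F)) _ _ _ _).
  - intros X Y F. exists (dfl_cell_of_nat
      (F := dfl_functor_comp F (chi_dfl_functor Y))
      (G := dfl_functor_comp (chi_dfl_functor X)
        (codomain_dfl_functor (underlying_finlim_functor F))) (nat_unit_swap_inv F)); cell_law.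
  - cell_law.
  - cell_law.
  - cell_law.
Defined.

Ltac modification_law := apply modification_eq; cell_law.

Definition unit_equivalence :
  @adjoint_equivalence (psfunctor_bicat FinLim FinLim) _ _ unit_trans.
Proof.
  unshelve refine (Build_adjoint_equivalence (psfunctor_bicat FinLim FinLim) _ _
    unit_trans unit_inverse
    (Build_modification _ _ _ _ (pstrans_id (psfunctor_id FinLim))
      (pstrans_comp unit_trans unit_inverse)
      (fun C => nat_linvunitor (functor_id (C : finlim_cat))) _)
    (Build_modification _ _ _ _ (pstrans_comp unit_inverse unit_trans)
      (pstrans_id (psfunctor_comp codomain_psfunctor forget_types))
      (fun C => nat_lunitor (functor_id (C : finlim_cat))) _) _ _ _ _).
  - cell_law.
  - cell_law.
  - unshelve eexists.
    + refine (Build_modification _ _ _ _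
        (pstrans_comp unit_trans unit_inverse) (pstrans_id (psfunctor_id FinLim))
        (fun C => nat_lunitor (functor_id (C : finlim_cat))) _). cell_law.
    + modification_law.
    + modification_law.
  - unshelve eexists.
    + refine (Build_modification _ _ _ _
        (pstrans_id (psfunctor_comp codomain_psfunctor forget_types))
        (pstrans_comp unit_inverse unit_trans)
        (fun C => nat_linvunitor (functor_id (C : finlim_cat))) _). cell_law.
    + modification_law.
    + modification_law.
  - modification_law.
  - modification_law.
Qed.

Definition counit_equivalence :
  @adjoint_equivalence (psfunctor_bicat DFLCompCat DFLCompCat) _ _ counit_trans.
Proof.
  unshelve refine (Build_adjoint_equivalence (psfunctor_bicat DFLCompCat DFLCompCat) _ _
    counit_trans counit_inverse
    (Build_modification _ _ _ _ (pstrans_id (psfunctor_comp forget_types codomain_psfunctor))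
      (pstrans_comp counit_trans counit_inverse)
      (fun X => dfl_cell_of_nat (F := dfl_functor_id (codomain_dfl (underlying_finlim X)))
        (G := dfl_functor_comp (psi_dfl_functor X) (chi_dfl_functor X))
        (nat_linvunitor (functor_id (X : dfl_comp_cat)))) _)
    (Build_modification _ _ _ _ (pstrans_comp counit_inverse counit_trans)
      (pstrans_id (psfunctor_id DFLCompCat))
      (fun X => dfl_cell_of_nat (F := dfl_functor_comp (chi_dfl_functor X) (psi_dfl_functor X))
        (G := dfl_functor_id X)
        (nat_lunitor (functor_id (X : dfl_comp_cat)))) _) _ _ _ _).
  - cell_law.
  - cell_law.
  - unshelve eexists.
    + refine (Build_modification _ _ _ _ (pstrans_comp counit_trans counit_inverse)
        (pstrans_id (psfunctor_comp forget_types codomain_psfunctor))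
        (fun X => dfl_cell_of_nat
          (F := dfl_functor_comp (psi_dfl_functor X) (chi_dfl_functor X))
          (G := dfl_functor_id (codomain_dfl (underlying_finlim X)))
          (nat_lunitor (functor_id (X : dfl_comp_cat)))) _). cell_law.
    + modification_law.
    + modification_law.
  - unshelve eexists.
    + refine (Build_modification _ _ _ _
        (pstrans_id (psfunctor_id DFLCompCat)) (pstrans_comp counit_inverse counit_trans)
        (fun X => dfl_cell_of_nat (F := dfl_functor_id X)
          (G := dfl_functor_comp (chi_dfl_functor X) (psi_dfl_functor X))
          (nat_linvunitor (functor_id (X : dfl_comp_cat)))) _). cell_law.
    + modification_law.
    + modification_law.
  - modification_law.
  - modification_law.
Qed.

Theorem mainTheorem1 : biequivalence DFLCompCat FinLim.
Proof.
  exact {|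
    beq_fun := forget_types;
    beq_inv := codomain_psfunctor;
    beq_unit := unit_trans;
    beq_counit := counit_trans;
    beq_unit_equivalence := unit_equivalence;
    beq_counit_equivalence := counit_equivalence
  |}.
Qed.
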